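(* Let $\mu$ be a pseudo-positive signed moment measure on $\mathbb{R}^d$ with component measures $\mu_{k,l}$, such that $$\sum_{k=0}^{\infty}\sum_{l=1}^{a_k}\int_0^\infty r^N r^{-k}\,d\mu_{k,l}(r)<\infty\qquad\text{for all } N\in\mathbb{N}_0 .$$ Let $$V_\mu=\Big\{\sigma:\ \sigma \text{ is a pseudo-positive signed moment measure on }\mathbb{R}^d \text{ and } \int f\,d\sigma=\int f\,d\mu\ \text{ for all } f\in\mathbb{C}[x_1,\dots,x_d]\Big\}.$$ Then $V_\mu$ contains exactly one element if and only if each $\mu_{k,l}^\psi$ ($k\in\mathbb{N}_0$, $l=1,\dots,a_k$) is determined in the sense of Stieltjes.
   Context: Fix an integer $d\ge 2$. $|x|$ is the Euclidean norm and $\mathbb{S}^{d-1}$ the unit sphere of $\mathbb{R}^d$ with surface measure $d\theta$. For each $k\in\mathbb{N}_0=\{0,1,2,\dots\}$, $Y_{k,1},\dots,Y_{k,a_k}:\mathbb{R}^d\to\mathbb{R}$ is a fixed basis of the space of harmonic homogeneous polynomials of degree $k$, orthonormal with respect to $\langle f,g\rangle=\int_{\mathbb{S}^{d-1}}f(\theta)\overline{g(\theta)}\,d\theta$. By convention $r^{-k}=+\infty$ at $r=0$ for $k\ge1$. A signed measure on $\mathbb{R}^d$ is a real-valued $\sigma$-additive set function on the Borel sets; it is a moment measure if all polynomials are integrable with respect to its total variation. A signed measure $\mu$ is pseudo-positive if $\int_{\mathbb{R}^d}h(|x|)Y_{k,l}(x)\,d\mu(x)\ge0$ for every continuous compactly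 supported $h:[0,\infty)\to[0,\infty)$ and all $k,l$. The component measures of a pseudo-positive moment measure $\mu$ are the unique (non-negative) measures $\mu_{k,l}$ on $[0,\infty)$ with all moments finite such that $\int_0^\infty h\,d\mu_{k,l}=\int_{\mathbb{R}^d}h(|x|)Y_{k,l}(x)\,d\mu(x)$ for all continuous polynomially bounded $h:[0,\infty)\to\mathbb{C}$. $\psi:[0,\infty)\to[0,\infty)$ is $\psi(t)=t^2$, and $\nu^\psi(B)=\nu(\psi^{-1}(B))$ is the image measure. A non-negative measure $\nu$ on $[0,\infty)$ with finite moments is determined in the sense of Stieltjes if it is the only non-negative measure on $[0,\infty)$ having the moments $\int_0^\infty t^m\,d\nu$, $m\in\mathbb{N}_0$. *)

(* Defs.v *)
From HB Require Import structures.
From mathcomp Require Import all_boot all_order all_algebra.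
From mathcomp Require mpoly.
(* The notations of mpoly clash with those of MathComp-Analysis. *)
Import -(notations) mpoly.
From mathcomp Require Import all_classical all_reals all_analysis.
From mathcomp Require Import measurable_realfun complex.

Set Implicit Arguments.
Unset Strict Implicit.
Unset Printing Implicit Defensive.

Import Order.TTheory GRing.Theory Num.Theory.
Import numFieldNormedType.Exports.

Local Open Scope classical_set_scope.
Local Open Scope ring_scope.

(* R^d is [d.-tuple R] with the product sigma-algebra, which is the Borel
   sigma-algebra since R is second countable. *)

Section euclidean_space.
Context {R : realType}.
Implicit Types d n : nat.

Definition enorm d (x : d.-tuple R) : R :=
  Num.sqrt (\sum_(i < d) tnth x i ^+ 2).

Definition usphere d : set (d.-tuple R) := [set x | enorm x = 1].

Definition peval d (p : mpoly d R) (x : d.-tuple R) : R := meval (tnth x) p.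

Definition cpeval d (p : mpoly d R[i]) (x : d.-tuple R) : R[i] :=
  meval (fun i => (tnth x i)%:C%C) p.

Lemma measurable_enorm d : measurable_fun setT (@enorm d).
Proof.
apply: (measurableT_comp (f := @Num.sqrt R)).
  by apply: continuous_measurable_fun; exact: sqrt_continuous.
apply: measurable_sum => i.
by apply: measurable_funX; exact: measurable_tnth.
Qed.

End euclidean_space.

Lemma prod_sigma_finite d1 d2 (T1 : measurableType d1) (T2 : measurableType d2)
    (R : realType) (m1 : {sigma_finite_measure set T1 -> \bar R})
    (m2 : {sigma_finite_measure set T2 -> \bar R}) :
  sigma_finite setT (m1 \x m2)%E.
Proof.
have /sigma_finiteP[F [TF ndF Foo]] := sigma_finiteT m1.
have /sigma_finiteP[G [TG ndG Goo]] := sigma_finiteT m2.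
exists (fun n => F n `*` G n).
  rewrite -setXTT TF TG predeqE => -[x y]; split.
    move=> [/= [n _ Fnx] [k _ Gky]]; exists (maxn n k) => //; split.
    - by move: x Fnx; exact/subsetPset/ndF/leq_maxl.
    - by move: y Gky; exact/subsetPset/ndG/leq_maxr.
  by move=> [n _ []/= ? ?]; split; exists n.
move=> k; have [? ?] := Foo k; have [? ?] := Goo k.
split; first exact: measurableX.
by rewrite product_measure1E// lte_mul_pinfty// ge0_fin_numE.
Qed.

Section lebesgue_tuple.
Context {R : realType}.

Definition cons_pair n (p : measurableTypeR R * n.-tuple R) : n.+1.-tuple R :=
  [the n.+1.-tuple R of p.1 :: p.2].

Lemma measurable_cons_pair n : measurable_fun setT (@cons_pair n).
Proof.
apply: measurable_cons; last exact: measurable_snd.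
by move=> mT A mA; exact: (@measurable_fst _ _ (measurableTypeR R)).
Qed.

Fixpoint lebesgue_tuple n : set (n.-tuple R) -> \bar R :=
  match n with
  | 0%N => \d_[tuple]
  | m.+1 => pushforward (@lebesgue_measure R \x @lebesgue_tuple m)%E
              (@cons_pair m)
  end.

Lemma lebesgue_tuple_sigma_finite_measure n :
  {m : {sigma_finite_measure set (n.-tuple R) -> \bar R} |
    m = @lebesgue_tuple n :> (set (n.-tuple R) -> \bar R)}.
Proof.
elim: n => [|n [m mE]].
  by exists [the {sigma_finite_measure set (0.-tuple R) -> \bar R} of
    \d_([tuple] : 0.-tuple R)].
pose p : {measure set (measurableTypeR R * n.-tuple R)%type -> \bar R} :=
  (@lebesgue_measure R \x m)%E.
pose q : set (n.+1.-tuple R) -> \bar R := pushforward p (@cons_pair n).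
have mc A : measurable A -> measurable (@cons_pair n @^-1` A).
  by move=> mA; rewrite -[X in measurable X]setTI; exact: measurable_cons_pair.
have q0 : q set0 = 0%E by rewrite /q /pushforward preimage_set0 measure0.
have q_ge0 A : (0 <= q A)%E by apply: (measure_ge0 p).
have q_sigma : semi_sigma_additive q.
  move=> F mF tF mUF; rewrite /q /pushforward preimage_bigcup.
  apply: measure_semi_sigma_additive.
  - by move=> i; exact: mc.
  - apply/trivIsetP => i j _ _ ij; rewrite -preimage_setI.
    by move/trivIsetP : tF => /(_ _ _ _ _ ij) ->//; rewrite preimage_set0.
  - by rewrite -preimage_bigcup; exact: mc.
pose uncons (t : n.+1.-tuple R) : measurableTypeR R * n.-tuple R :=
  (thead t, [tuple of behead t]).
have consK t : cons_pair (uncons t) = t.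
  by apply/val_inj; case: (tupleP t).
have unconsK z : uncons (cons_pair z) = z.
  case: z => x t; rewrite /uncons /cons_pair/= theadE; congr pair.
  exact/val_inj.
have muncons : measurable_fun setT uncons.
  apply: measurable_fun_pair; first exact: measurable_tnth.
  exact: measurable_behead.
have q_sf : sigma_finite setT q.
  have [F FT Ffin] := prod_sigma_finite (@lebesgue_measure R) m.
  exists (fun i => uncons @^-1` F i).
    by rewrite -preimage_bigcup -FT preimage_setT.
  move=> i; split.
    rewrite -[X in measurable X]setTI; apply: muncons => //.
    exact: (Ffin i).1.
  rewrite /q /pushforward -comp_preimage (_ : _ \o _ = id); last exact/funext.
  exact: (Ffin i).2.
pose mx := isMeasure.Build _ _ _ q q0 q_ge0 q_sigma.
pose Q : {measure set (n.+1.-tuple R) -> \bar R} := HB.pack q mx.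
pose sx := Measure_isSigmaFinite.Build _ _ _ Q q_sf.
pose S : {sigma_finite_measure set (n.+1.-tuple R) -> \bar R} :=
  HB.pack q mx sx.
by exists S; rewrite /= -mE.
Qed.

Let lebesgue_tuple0 n : @lebesgue_tuple n set0 = 0%E.
Proof. by have [m <-] := lebesgue_tuple_sigma_finite_measure n. Qed.

Let lebesgue_tuple_ge0 n A : (0 <= @lebesgue_tuple n A)%E.
Proof. by have [m <-] := lebesgue_tuple_sigma_finite_measure n. Qed.

Let lebesgue_tuple_sigma n : semi_sigma_additive (@lebesgue_tuple n).
Proof.
have [m <-] := lebesgue_tuple_sigma_finite_measure n.
exact: measure_semi_sigma_additive.
Qed.

HB.instance Definition _ n := isMeasure.Build _ _ _ (@lebesgue_tuple n)
  (lebesgue_tuple0 n) (@lebesgue_tuple_ge0 n) (@lebesgue_tuple_sigma n).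

Let lebesgue_tuple_sigma_finite n : sigma_finite setT (@lebesgue_tuple n).
Proof.
have [m <-] := lebesgue_tuple_sigma_finite_measure n; exact: sigma_finiteT.
Qed.

HB.instance Definition _ n := Measure_isSigmaFinite.Build _ _ _
  (@lebesgue_tuple n) (@lebesgue_tuple_sigma_finite n).

End lebesgue_tuple.

Section surface_measure.
Context {R : realType}.

(* The direction x / |x|, with value 0 at x = 0. *)
Definition radial_proj d (x : d.-tuple R) : d.-tuple R :=
  [tuple (enorm x)^-1 * tnth x i | i < d].

Definition punctured_ball d : set (d.-tuple R) := [set x | 0 < enorm x <= 1].

Lemma measurable_punctured_ball d : measurable (@punctured_ball d).
Proof.
rewrite (_ : @punctured_ball d = setT `&` @enorm R d @^-1` `]0, 1]%classic).
  by apply: measurable_enorm => //; exact: measurable_itv.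
by rewrite setTI; apply/seteqP; split => x; rewrite /punctured_ball/= in_itv.
Qed.

Lemma measurable_radial_proj d : measurable_fun setT (@radial_proj d).
Proof.
have minv : measurable_fun setT (@GRing.inv R).
  have -> : [set: R] = [set 0] `|` ~` [set 0] by rewrite setUv.
  apply/measurable_funU; first exact: measurable_set1.
    by apply: measurableC; exact: measurable_set1.
  split; first exact: measurable_fun_set1.
  apply: open_continuous_measurable_fun.
    apply: closed_openC; apply: accessible_closed_set1.
    exact: hausdorff_accessible.
  by move=> x; rewrite inE/= => /eqP; exact: inv_continuous.
apply/measurable_fun_tnthP => i.
rewrite (_ : _ \o _ = fun x => (enorm x)^-1 * tnth x i); last first.
  by apply/funext => x /=; rewrite tnth_mktuple.
apply: measurable_funM; last exact: measurable_tnth.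
exact: (measurableT_comp minv (@measurable_enorm R d)).
Qed.

(* Polar coordinates: the surface measure of a Borel subset A of the sphere is
   d times the Lebesgue measure of the cone {r x | 0 < r <= 1, x in A}.  As a
   measure on R^d it is carried by the sphere. *)
Definition surface_measure d (A : set (d.-tuple R)) : \bar R :=
  (d%:R%:E * lebesgue_tuple (@radial_proj d @^-1` A `&` @punctured_ball d))%E.

Let surface_measure0 d : @surface_measure d set0 = 0%E.
Proof. by rewrite /surface_measure preimage_set0 set0I measure0 mule0. Qed.

Let surface_measure_ge0 d A : (0 <= @surface_measure d A)%E.
Proof. by rewrite /surface_measure mule_ge0. Qed.

Let surface_measure_sigma d : semi_sigma_additive (@surface_measure d).
Proof.
have mr A : measurable A -> measurable (@radial_proj d @^-1` A).
  move=> mA; rewrite -[X in measurable X]setTI.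
  exact: measurable_radial_proj.
move=> F mF tF mUF; pose m := mscale (NngNum (ler0n R d))
  (mrestr (@lebesgue_tuple R d) (@measurable_punctured_ball d)).
rewrite /surface_measure preimage_bigcup.
apply: (@measure_semi_sigma_additive _ _ _ m
  (fun i => @radial_proj d @^-1` F i)).
- by move=> i; exact: mr.
- apply/trivIsetP => i j _ _ ij; rewrite -preimage_setI.
  by move/trivIsetP : tF => /(_ _ _ _ _ ij) ->//; rewrite preimage_set0.
- by rewrite -preimage_bigcup; exact: mr.
Qed.

HB.instance Definition _ d := isMeasure.Build _ _ _ (@surface_measure d)
  (@surface_measure0 d) (@surface_measure_ge0 d) (@surface_measure_sigma d).

End surface_measure.

Section spherical_harmonics.
Context {R : realType}.

Definition harmonic_homog d k (p : mpoly d R) : Prop :=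
  p \is ishomog1 k mdeg /\ \sum_(i < d) mderiv i (mderiv i p) = 0.

(* Polynomials are real-valued, so no conjugation appears. *)
Definition sphere_inner d (p q : mpoly d R) : R :=
  \int[surface_measure (d := d)]_(x in usphere (d := d))
    (peval p x * peval q x).

Definition orthonormal_harmonic_basis d (a : nat -> nat)
    (Y : forall k, 'I_(a k) -> mpoly d R) : Prop :=
  forall k, [/\ forall l, harmonic_homog k (Y k l),
    forall p, harmonic_homog k p ->
      exists! c : {ffun 'I_(a k) -> R}, p = \sum_(l < a k) c l *: Y k l &
    forall l l', sphere_inner (Y k l) (Y k l') = (l == l')%:R].

End spherical_harmonics.

Section charge_integral.
Context {disp : measure_display} {T : measurableType disp} {R : realType}.
Variable mu : {charge set T -> \bar R}.

Lemma hahn_pair_subproof :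
  exists PN : set T * set T, hahn_decomposition mu PN.1 PN.2.
Proof. by have [P [N PN]] := Hahn_decomposition mu; exists (P, N). Qed.

Definition hahn_pair := proj1_sig (cid hahn_pair_subproof).

Definition hahn_pairP : hahn_decomposition mu hahn_pair.1 hahn_pair.2 :=
  proj2_sig (cid hahn_pair_subproof).

(* By uniqueness of the Jordan decomposition, none of the following depends on
   the chosen Hahn decomposition. *)
Definition charge_total_variation : {measure set T -> \bar R} :=
  charge_variation hahn_pairP.

Definition charge_integral (f : T -> R) : R :=
  \int[jordan_pos hahn_pairP]_x f x - \int[jordan_neg hahn_pairP]_x f x.

Definition ccharge_integral (f : T -> R[i]) : R[i] :=
  (charge_integral (fun x => complex.Re (f x)) +i*
   charge_integral (fun x => complex.Im (f x)))%C.

End charge_integral.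

Definition cintegral {disp : measure_display} {T : measurableType disp}
    {R : realType} (nu : {measure set T -> \bar R}) (D : set T)
    (f : T -> R[i]) : R[i] :=
  (\int[nu]_(x in D) complex.Re (f x) +i*
   \int[nu]_(x in D) complex.Im (f x))%C.

Definition cintegrable {disp : measure_display} {T : measurableType disp}
    {R : realType} (nu : {measure set T -> \bar R}) (f : T -> R[i]) : Prop :=
  nu.-integrable setT (fun x => (complex.Re (f x))%:E) /\
  nu.-integrable setT (fun x => (complex.Im (f x))%:E).

Section moment_problem.
Context {R : realType}.

(* Elements of [{charge set T -> \bar R}] are finite on measurable sets. *)
Definition moment_measure d (mu : {charge set (d.-tuple R) -> \bar R}) : Prop :=
  forall p : mpoly d R[i], cintegrable (charge_total_variation mu) (cpeval p).

Definition pseudo_positive d (a : nat -> nat)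
    (Y : forall k, 'I_(a k) -> mpoly d R)
    (mu : {charge set (d.-tuple R) -> \bar R}) : Prop :=
  forall h : R -> R, {within `[0, +oo[, continuous h} ->
    (forall r, 0 <= r -> 0 <= h r) ->
    compact (closure [set r | 0 <= r /\ h r != 0]) ->
  forall k (l : 'I_(a k)),
    0 <= charge_integral mu (fun x => h (enorm x) * peval (Y k l) x).

(* Measures on [0, +oo) are measures on R carried by [0, +oo). *)
Definition on_halfline (nu : set R -> \bar R) : Prop :=
  nu `]-oo, 0[%classic = 0%E.

Definition polynomially_bounded (h : R -> R[i]) : Prop :=
  exists p : {poly R}, forall r, 0 <= r -> `|h r| <= (p.[r])%:C%C.

(* For a moment measure and a basis Y at most one nu satisfies this. *)
Definition component_measure d (mu : {charge set (d.-tuple R) -> \bar R})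
    (p : mpoly d R) (nu : {measure set R -> \bar R}) : Prop :=
  [/\ on_halfline nu,
    forall m : nat, (\int[nu]_(r in `[0%R, +oo[) (r ^+ m)%:E < +oo)%E &
    forall h : R -> R[i]^o, {within `[0, +oo[, continuous h} ->
      polynomially_bounded h ->
      cintegral nu `[0, +oo[ h =
      ccharge_integral mu (fun x => h (enorm x) * (peval p x)%:C%C)].

Definition solution_set d (a : nat -> nat)
    (Y : forall k, 'I_(a k) -> mpoly d R)
    (mu : {charge set (d.-tuple R) -> \bar R}) :
    set ({charge set (d.-tuple R) -> \bar R})%R :=
  [set sigma | [/\ moment_measure sigma, pseudo_positive Y sigma &
    forall f : mpoly d R[i],
      ccharge_integral sigma (cpeval f) = ccharge_integral mu (cpeval f)]].

Definition psi (t : R) : R := t ^+ 2.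

(* Set functions are compared on measurable sets only: elsewhere the values of
   a measure are irrelevant. *)
Definition stieltjes_determined (nu : set R -> \bar R) : Prop :=
  forall nu' : {measure set R -> \bar R}, on_halfline nu' ->
    (forall m : nat, \int[nu']_(t in `[0%R, +oo[) (t ^+ m)%:E =
                     \int[nu]_(t in `[0%R, +oo[) (t ^+ m)%:E)%E ->
  forall A, measurable A -> nu' A = nu A.

End moment_problem.

(* Main.v *)
(* A polynomial is a sum of terms |x|^(2j) Y_kl(x), so the moments of a
   pseudo-positive sigma are the even moments of its component measures, i.e.
   the Stieltjes moments of their images under psi.

   If all these images are determined, every solution has the components of
   mu.  It then gives the same integral as mu to every polynomial restricted to
   a ball, and the polynomials determine a measure on a bounded set.

   If the image of mu_kl is not determined, let tau <> mu_kl have the same even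
   moments.  Adding to mu the image of r^-k (tau - mu_kl)(dr) Y_kl(theta) dtheta
   under (r, theta) |-> r theta replaces the component mu_kl by tau and keeps
   the others, which gives a second solution.  This requires r^-k to be
   integrable for tau, so tau is chosen without mass near 0: if two solutions of
   a Stieltjes problem differ and one has no atom at 0, then the value q(x) of a
   polynomial q at x near 0 is bounded by the L^1-norm of q away from 0, and by
   Hahn-Banach there is a solution made of a small mass at x and of a measure
   carried by a half-line away from 0.

   Solid harmonics of different degrees are orthogonal for the Gaussian weight
   by integration by parts and Euler's identity, hence on the sphere. *)

From HB Require Import structures.
Require Import Defs.
From mathcomp Require Import all_boot all_order all_algebra.
From mathcomp Require mpoly.
Import -(notations) mpoly.
From mathcomp Require Import all_classical all_reals all_analysis.
From mathcomp Require Import measurable_realfun complex.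
From mathcomp Require Import ring lra zify.
Set Implicit Arguments.
Unset Strict Implicit.
Unset Printing Implicit Defensive.
Import Order.TTheory GRing.Theory Num.Theory.
Import numFieldNormedType.Exports.
Local Open Scope classical_set_scope.
Local Open Scope ring_scope.

(** Indeterminacy supplies only two different solutions [a] and [b] of a Stieltjes problem, whereas
    a solution without mass near 0 is wanted. Their difference D annihilates polynomials but not
    every power of u(t) = 1/(1 + t), because powers of u determine a measure on [0, +oo). If n is
    the least exponent with D(u^n) non-zero, division by t + 1 gives D(q u^n) = q(-1) D(u^n), so
    evaluation at -1 is bounded by an L^1-norm; moving the roots of q to [0, +oo) transfers the
    bound from -1 to points near 0. Atoms at 0 are a separate obstacle. Summability with N = 0
    excludes them for mu_kl when k > 0, because r^-k is infinite there, but the competing solution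
    may still have one. For k = 0 the weight is 1 and any competitor serves. In the other direction
    polynomial moments need not determine a charge. Its components are therefore tested against
    discontinuous radial functions, such as indicators of balls; on a ball polynomials are bounded,
    and limits of them contain the indicators of orthants. *)

Local Notation integ m f := (m.-integrable setT (EFin \o f)).

(** * Integrals of real functions *)

Section weighted_pushforward.
Import HBNNSimple.
Context d1 d2 (X : measurableType d1) (Y : measurableType d2) (R : realType).
Variables (m : {measure set X -> \bar R}) (w : X -> R) (phi : X -> Y).
Hypotheses (mw : measurable_fun setT w) (w0 : forall x, 0 <= w x).
Hypothesis mphi : measurable_fun setT phi.
Local Open Scope ereal_scope.

Let nu (A : set Y) : \bar R := \int[m]_x ((w x)%:E * (\1_A (phi x))%:E).

Let mind A : measurable A -> measurable_fun setT (fun x => (\1_A (phi x) : R)).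
Proof.
move=> mA.
exact: (measurableT_comp (@measurable_indic _ Y R setT A mA) mphi).
Qed.

Let mwind A : measurable A ->
  measurable_fun setT (fun x => (w x)%:E * (\1_A (phi x))%:E).
Proof.
by move=> mA; apply: emeasurable_funM; apply/measurable_EFinP => //; exact: mind.
Qed.

Let wind0 A x : 0 <= (w x)%:E * (\1_A (phi x))%:E.
Proof. by rewrite mule_ge0// lee_fin. Qed.

Let nu0 : nu set0 = 0.
Proof. by rewrite /nu integral0_eq// => x _; rewrite indic0 mule0. Qed.

Let nu_ge0 A : 0 <= nu A.
Proof. by apply: integral_ge0 => x _; exact: wind0. Qed.

Let nu_sigma : semi_sigma_additive nu.
Proof.
move=> F mF tF mUF.
have -> : nu (\bigcup_n F n) = \sum_(n <oo) nu (F n).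
  rewrite /nu -integral_nneseries//; last by move=> n; exact: mwind.
  apply: eq_integral => x _.
  rewrite nneseriesZl//; congr (_ * _).
  rewrite (_ : (\1_(\bigcup_n F n) (phi x))%:E = \d_(phi x) (\bigcup_n F n) :> \bar R)//.
  apply/esym/cvg_lim => //; exact: (@measure_semi_sigma_additive _ _ _ (\d_(phi x)) F).
by apply: is_cvg_nneseries => n _ _.
Qed.

(** The measure is A |-> int w 1_A(phi) dm, and its integral formula passes from simple functions to
    all non-negative ones by monotone convergence. Densities, restrictions, image measures, scaled
    point masses and polar coordinates are all instances. *)
Lemma weighted_pushforward : exists n : {measure set Y -> \bar R},
  forall g : Y -> \bar R, measurable_fun setT g -> (forall y, 0 <= g y) ->
    \int[n]_y g y = \int[m]_x ((w x)%:E * g (phi x)).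
Proof.
pose nx := isMeasure.Build _ _ _ nu nu0 nu_ge0 nu_sigma.
pose n : {measure set Y -> \bar R} := HB.pack nu nx.
exists n => g mg g0.
pose f_ := nnsfun_approx measurableT mg.
have fg y : g y = limn (EFin \o f_^~ y).
  by apply/esym/cvg_lim => //; apply: cvg_nnsfun_approx.
transitivity (limn (fun k => \int[n]_y (f_ k y)%:E)).
  rewrite -monotone_convergence//.
  - by apply: eq_integral => y _; exact: fg.
  - by move=> k; exact/measurable_EFinP/measurable_funP.
  - by move=> k y _; rewrite lee_fin.
  - by move=> y _ k l kl; rewrite lee_fin; exact/lefP/nd_nnsfun_approx.
transitivity (limn (fun k => \int[m]_x ((w x)%:E * (f_ k (phi x))%:E))); last first.
  rewrite -monotone_convergence//; last 3 first.
  - move=> k; apply: emeasurable_funM; apply/measurable_EFinP => //.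
    exact: (measurableT_comp _ mphi).
  - by move=> k x _; rewrite mule_ge0// lee_fin.
  - move=> x _ k l kl; apply: lee_wpmul2l; rewrite ?lee_fin//.
    exact/lefP/nd_nnsfun_approx.
  apply: eq_integral => x _; apply/cvg_lim => //.
  by apply: cvgeZl => //; apply: cvg_nnsfun_approx.
congr (limn _); apply/funext => k.
transitivity (\sum_(r \in range (f_ k)) r%:E * n (f_ k @^-1` [set r])).
  transitivity (\int[n]_y (\sum_(r \in range (f_ k)) (r * \1_(f_ k @^-1` [set r]) y)%:E)).
    by apply: eq_integral => y _; rewrite fimfunE -fsumEFin.
  rewrite ge0_integral_fsum//; last 2 first.
  - by move=> r; exact/measurable_EFinP/measurable_funM.
  - by move=> r y _; rewrite nnfun_muleindic_ge0.
  apply: eq_fsbigr => r _.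
  by rewrite integralZl_indic_nnsfun// integral_indic//= setIT.
transitivity (\int[m]_x (\sum_(r \in range (f_ k))
    r%:E * ((w x)%:E * (\1_(f_ k @^-1` [set r]) (phi x))%:E))); last first.
  apply: eq_integral => x _; rewrite fimfunE -fsumEFin// ge0_mule_fsumr//.
    by apply: eq_fsbigr => r _; rewrite EFinM muleCA.
  by move=> r; rewrite nnfun_muleindic_ge0.
rewrite ge0_integral_fsum//; last 2 first.
- by move=> r; apply: emeasurable_funM => //; exact: mwind.
- move=> r x _; rewrite muleCA mule_ge0 ?lee_fin//.
  exact: nnfun_muleindic_ge0 (f_ k) r (phi x).
apply: eq_fsbigr => r; rewrite inE => -[y _ <-].
by rewrite ge0_integralZl//; [exact: mwind|rewrite lee_fin].
Qed.

End weighted_pushforward.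

Section real_integral.
Context d (T : measurableType d) (R : realType).
Variable m : {measure set T -> \bar R}.
Implicit Types f g : T -> R.

Lemma integ_meas f : integ m f -> measurable_fun setT f.
Proof. by move=> /measurable_int/measurable_EFinP. Qed.

Lemma integD f g : integ m f -> integ m g -> integ m (fun x => f x + g x).
Proof. by move=> h1 h2; have := integrableD measurableT h1 h2. Qed.

Lemma integB f g : integ m f -> integ m g -> integ m (fun x => f x - g x).
Proof. by move=> h1 h2; have := integrableB measurableT h1 h2. Qed.

Lemma integZ c f : integ m f -> integ m (fun x => c * f x).
Proof. by move=> h; have := integrableZl measurableT c h. Qed.

Lemma integN f : integ m f -> integ m (fun x => - f x).
Proof. by move=> h; have := integrableN h. Qed.

Lemma integ0 : integ m (fun=> 0).
Proof. exact: (integrable0 m setT). Qed.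

Lemma integ_sum I (s : seq I) (F : I -> T -> R) :
  (forall i, integ m (F i)) -> integ m (fun x => \sum_(i <- s) F i x).
Proof.
move=> h; elim: s => [|a s IH].
  by under eq_fun do rewrite big_nil; exact: integ0.
by under eq_fun do rewrite big_cons; exact: integD.
Qed.

Lemma integ_abs f : integ m f -> integ m (fun x => `|f x|).
Proof. exact: integrable_norm. Qed.

Lemma integ_le f g : measurable_fun setT f -> integ m g ->
  (forall x, `|f x| <= g x) -> integ m f.
Proof.
move=> mf ig fg; apply: le_integrable ig => //; first exact/measurable_EFinP.
by move=> x _; rewrite lee_fin (le_trans (fg x))// ler_norm.
Qed.

Lemma Rint0 : \int[m]_x (0 : R) = 0.
Proof. by rewrite /Rintegral integral0. Qed.

Lemma RintD f g : integ m f -> integ m g ->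
  \int[m]_x (f x + g x) = \int[m]_x f x + \int[m]_x g x.
Proof. by move=> h1 h2; rewrite RintegralD. Qed.

Lemma RintB f g : integ m f -> integ m g ->
  \int[m]_x (f x - g x) = \int[m]_x f x - \int[m]_x g x.
Proof. by move=> h1 h2; rewrite RintegralB. Qed.

Lemma RintZ c f : integ m f -> \int[m]_x (c * f x) = c * \int[m]_x f x.
Proof. by move=> h; rewrite RintegralZl. Qed.

Lemma Rint_sum I (s : seq I) (F : I -> T -> R) : (forall i, integ m (F i)) ->
  \int[m]_x (\sum_(i <- s) F i x) = \sum_(i <- s) \int[m]_x F i x.
Proof.
move=> h; elim: s => [|a s IH].
  by rewrite big_nil; under eq_Rintegral do rewrite big_nil; exact: Rint0.
rewrite big_cons -IH -RintD//; last exact: integ_sum.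
by apply: eq_Rintegral => x _; rewrite big_cons.
Qed.

Lemma Rint_le f g : integ m f -> integ m g -> (forall x, f x <= g x) ->
  \int[m]_x f x <= \int[m]_x g x.
Proof. by move=> h1 h2 fg; apply: le_Rintegral. Qed.

Lemma Rint_abs f : integ m f -> `|\int[m]_x f x| <= \int[m]_x `|f x|.
Proof. by move=> h; apply: le_normr_Rintegral. Qed.

Lemma Rint_ge0 f : (forall x, 0 <= f x) -> 0 <= \int[m]_x f x.
Proof. by move=> h; apply: Rintegral_ge0. Qed.

Lemma RintE f : integ m f -> (\int[m]_x f x)%:E = (\int[m]_x (f x)%:E)%E.
Proof. by move=> h; rewrite /Rintegral fineK//; exact: integrable_fin_num. Qed.

Lemma integ_bounded f c : (m setT < +oo)%E -> measurable_fun setT f ->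
  (forall x, `|f x| <= c) -> integ m f.
Proof.
move=> moo mf fc; apply: measurable_bounded_integrable => //.
exists c; split; first exact: num_real.
move=> M cM x _ /=; exact: le_trans (fc x) (ltW cM).
Qed.

Lemma integ_indic A : (m setT < +oo)%E -> measurable A -> integ m (\1_A).
Proof.
move=> moo mA; apply: (@integ_bounded _ 1) => // x.
by rewrite ger0_norm// indicE; case: (_ \in _).
Qed.

Lemma Rint_indic A : measurable A -> (\int[m]_x \1_A x)%:E = (fine (m A))%:E.
Proof. by move=> mA; rewrite /Rintegral integral_indic// setIT. Qed.

(** A half-line is encoded by a null set of R, so identities that hold only for t >= 0 enter
    integrals through this lemma. *)
Lemma ae_eq0_Rint N f g : measurable N -> m N = 0%E ->
  measurable_fun setT f -> measurable_fun setT g ->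
  (forall x, ~ N x -> f x = g x) ->
  (integ m f -> integ m g) /\ \int[m]_x f x = \int[m]_x g x.
Proof.
move=> mN N0 mf mg fg.
have mf' : measurable_fun setT (EFin \o f) by exact/measurable_EFinP.
have mg' : measurable_fun setT (EFin \o g) by exact/measurable_EFinP.
have ae : ae_eq m setT (EFin \o f) (EFin \o g).
  exists N; split => // x /= /not_implyP[_ h].
  by apply: contrapT => Nx; apply: h; rewrite fg.
split; last by rewrite /Rintegral; congr fine; exact: ae_eq_integral.
move=> /integrableP[_ h]; apply/integrableP; split => //.
apply: le_lt_trans h; rewrite le_eqVlt; apply/orP; left; apply/eqP.
apply: ae_eq_integral => //; try exact: measurableT_comp.
exists N; split => // x /= /not_implyP[_ h].
by apply: contrapT => Nx; apply: h; rewrite fg.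
Qed.

End real_integral.

Section measure_operations.
Context d1 d2 (X : measurableType d1) (Y : measurableType d2) (R : realType).

Lemma weighted_pushforward_real (m : {measure set X -> \bar R}) (w : X -> R)
    (phi : X -> Y) :
  measurable_fun setT w -> (forall x, 0 <= w x) -> measurable_fun setT phi ->
  exists n : {measure set Y -> \bar R},
  [/\ forall g : Y -> \bar R, measurable_fun setT g -> (forall y, 0 <= g y)%E ->
        (\int[n]_y g y = \int[m]_x ((w x)%:E * g (phi x)))%E,
      forall g : Y -> R, measurable_fun setT g ->
        (integ n g <-> integ m (fun x => w x * g (phi x))) &
      forall g : Y -> R, measurable_fun setT g ->
        \int[n]_y g y = \int[m]_x (w x * g (phi x))].
Proof.
move=> mw w0 mphi.
have [n nE] := @weighted_pushforward _ _ X Y R m w phi mw w0 mphi.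
have mwg (g : Y -> R) : measurable_fun setT g ->
    measurable_fun setT (fun x => w x * g (phi x)).
  by move=> mg; apply: measurable_funM => //; exact: (measurableT_comp mg).
exists n; split => // g mg.
  have e : (\int[n]_y `|(g y)%:E| = \int[m]_x `|(w x * g (phi x))%:E|)%E.
    rewrite nE//; last by apply: measurableT_comp => //; exact/measurable_EFinP.
    by apply: eq_integral => x _; rewrite EFinM abseM; congr (_ * _)%E; rewrite gee0_abs // lee_fin.
  split => /integrableP[_ h]; apply/integrableP; split.
  - by apply/measurable_EFinP; exact: mwg.
  - by move: h; rewrite /= e.
  - exact/measurable_EFinP.
  - by rewrite /= e.
have mg' : measurable_fun setT (EFin \o g) by exact/measurable_EFinP.
rewrite /Rintegral; congr fine; rewrite integralE [RHS]integralE.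
rewrite !nE//; [|exact: measurable_funeneg|exact: measurable_funepos].
congr (_ - _)%E; apply: eq_integral => x _.
  by rewrite !funeposE/= EFinM maxe_pMr// ?mule0// lee_fin.
by rewrite !funenegE/= -mulrN EFinM maxe_pMr// ?mule0// lee_fin.
Qed.

Lemma measure_sum (m1 m2 : {measure set X -> \bar R}) :
  exists n : {measure set X -> \bar R},
  [/\ forall A, n A = (m1 A + m2 A)%E,
      forall g : X -> \bar R, measurable_fun setT g -> (forall y, 0 <= g y)%E ->
        (\int[n]_y g y = \int[m1]_x g x + \int[m2]_x g x)%E,
      forall g : X -> R, (integ n g <-> integ m1 g /\ integ m2 g) &
      forall g : X -> R, integ m1 g -> integ m2 g ->
        \int[n]_y g y = \int[m1]_x g x + \int[m2]_x g x].
Proof.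
pose n : {measure set X -> \bar R} := measure_add m1 m2.
have nE (A : set X) : n A = (m1 A + m2 A)%E by exact: measure_addE.
have ge0E (g : X -> \bar R) : measurable_fun setT g -> (forall y, 0 <= g y)%E ->
    (\int[n]_y g y = \int[m1]_x g x + \int[m2]_x g x)%E.
  by move=> mg g0; rewrite ge0_integral_measure_add.
have iE (g : X -> R) : (integ n g <-> integ m1 g /\ integ m2 g).
  have e : measurable_fun setT g ->
      (\int[n]_y `|(g y)%:E| = \int[m1]_x `|(g x)%:E| + \int[m2]_x `|(g x)%:E|)%E.
    move=> mg; apply: ge0E => //.
    by apply: measurableT_comp => //; exact/measurable_EFinP.
  split.
    move=> /integrableP[mg]; rewrite /= e; last exact/measurable_EFinP.
    move=> h; split; apply/integrableP; split => //; apply: le_lt_trans h.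
      by rewrite leeDl// integral_ge0.
    by rewrite leeDr// integral_ge0.
  move=> [/integrableP[mg h1] /integrableP[_ h2]]; apply/integrableP; split => //.
  by rewrite /= e; [exact: lte_add_pinfty|exact/measurable_EFinP].
exists n; split => // g h1 h2.
apply: EFin_inj; rewrite EFinD !RintE//; last exact/iE.
by rewrite /n integral_measure_add.
Qed.

End measure_operations.

Section measure_comparison.
Context d (T : measurableType d) (R : realType).
Implicit Types m : {measure set T -> \bar R}.

Lemma eq_measure_integ m1 m2 (f : T -> R) :
  (forall A, measurable A -> m1 A = m2 A) -> integ m1 f -> integ m2 f.
Proof.
move=> e /integrableP[mf h]; apply/integrableP; split => //.
by rewrite (eq_measure_integral m1)// => A mA _; rewrite e.
Qed.

Lemma eq_measure_Rintegral m1 m2 (f : T -> R) :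
  (forall A, measurable A -> m1 A = m2 A) -> \int[m1]_t f t = \int[m2]_t f t.
Proof.
by move=> e; congr fine; apply: eq_measure_integral => A mA _; exact: e.
Qed.

Lemma le_measure_integ m1 m2 (f : T -> R) :
  (forall A, measurable A -> (m1 A <= m2 A)%E) -> integ m2 f -> integ m1 f.
Proof.
move=> e /integrableP[mf h]; apply/integrableP; split => //.
apply: le_lt_trans h; apply: ge0_le_measure_integral => //.
exact: measurableT_comp.
Qed.

Lemma finite_measure_of m : (m setT < +oo)%E ->
  exists n : {finite_measure set T -> \bar R}, n = m :> (set T -> \bar R).
Proof.
move=> moo; exists (mfrestr measurableT moo); apply/funext => A.
by change (m (A `&` setT) = m A); rewrite setIT.
Qed.

Lemma charge_of_measures m1 m2 : (m1 setT < +oo)%E -> (m2 setT < +oo)%E ->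
  exists s : {charge set T -> \bar R}, forall A, s A = (m1 A - m2 A)%E.
Proof.
move=> /finite_measure_of[n1 n1E] /finite_measure_of[n2 n2E].
exists (cadd (charge_of_finite_measure n1) (copp (charge_of_finite_measure n2))) => A.
by rewrite /cadd/= /copp/= -n1E -n2E.
Qed.

Lemma le_measure0 m A B : measurable A -> measurable B -> A `<=` B ->
  m B = 0%E -> m A = 0%E.
Proof.
move=> mA mB AB mB0; apply/eqP; rewrite eq_le measure_ge0 andbT -mB0.
by apply: le_measure; rewrite ?inE.
Qed.

Lemma fin_num_lty m A : (m setT < +oo)%E -> measurable A -> m A \is a fin_num.
Proof.
move=> moo mA; rewrite ge0_fin_numE//; apply: le_lt_trans moo.
by apply: le_measure; rewrite ?inE.
Qed.

End measure_comparison.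

(** * Hahn-Banach and the representation of functionals *)

Section hahn_banach.
Context (R : realType) (V : lmodType R).
Implicit Types (p q : V -> R) (x y a : V).

Definition sublinear p := (forall x y, p (x + y) <= p x + p y) /\
  (forall (c : R) x, 0 < c -> p (c *: x) <= c * p x).

Lemma sublinear0 p : sublinear p -> p 0 = 0.
Proof.
move=> [_ h]; have := h 2 0; have := h 2^-1 0; rewrite !scaler0; lra.
Qed.

Lemma sublinearZ p c x : sublinear p -> 0 <= c -> p (c *: x) = c * p x.
Proof.
move=> hp; rewrite le_eqVlt => /predU1P[<-|c0].
  by rewrite scale0r mul0r sublinear0.
apply/eqP; rewrite eq_le; apply/andP; split; first exact: hp.2.
have h : p (c^-1 *: (c *: x)) <= c^-1 * p (c *: x).
  by apply: hp.2; rewrite invr_gt0.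
by move: h; rewrite scalerA mulVf ?gt_eqF// scale1r -ler_pdivrMl// ?invrK// invr_gt0.
Qed.

Lemma sublinear_ge p x : sublinear p -> - p (- x) <= p x.
Proof. by move=> hp; have := hp.1 x (- x); rewrite subrr sublinear0//; lra. Qed.

(** The three infima below (over a chain, along a line, over a subspace) are sublinear for the same
    reason: two indices can be merged into one that does at least as well, and the lower bound
    -p(-x) keeps the infimum finite. *)
Lemma sublinear_inf (I : Type) (D : set I) (g : I -> V -> R) p :
  D !=set0 ->
  (forall i x, D i -> - p (- x) <= g i x) ->
  (forall i j x y, D i -> D j -> exists2 k, D k & g k (x + y) <= g i x + g j y) ->
  (forall i c x, 0 < c -> D i -> exists2 k, D k & g k (c *: x) <= c * g i x) ->
  let q x := inf [set g i x | i in D] in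
  sublinear q /\ forall i x, D i -> q x <= g i x.
Proof.
move=> [i0 Di0] lb hD hZ q.
have hl x : has_lbound [set g i x | i in D].
  by exists (- p (- x)) => _ [i Di <-]; exact: lb.
have qle i x : D i -> q x <= g i x by move=> Di; apply: ge_inf => //; exists i.
have leq r x : (forall i, D i -> r <= g i x) -> r <= q x.
  move=> h; apply: lb_le_inf; first by exists (g i0 x), i0.
  by move=> _ [i Di <-]; exact: h.
split; last by [].
split=> [x y|c x c0].
  rewrite -lerBlDr; apply: (leq _ x) => i Di.
  rewrite lerBlDr -lerBlDl; apply: (leq _ y) => j Dj.
  have [k Dk] := hD i j x y Di Dj.
  by have := qle k (x + y) Dk; lra.
rewrite -ler_pdivrMl//; apply: (leq _ x) => i Di.
rewrite ler_pdivrMl//; have [k Dk] := hZ i c x c0 Di.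
by apply: le_trans; exact: qle.
Qed.

(** Zorn's lemma gives a minimal sublinear functional below [p], and minimality forces linearity. *)
Lemma linear_le_sublinear p : sublinear p -> exists l : V -> R,
  [/\ forall x y, l (x + y) = l x + l y,
      forall c x, l (c *: x) = c * l x & forall x, l x <= p x].
Proof.
move=> hp.
pose T := {q : V -> R | sublinear q /\ forall x, q x <= p x}.
(* The order is reversed, so that a maximal element is a minimal functional. *)
pose r : rel T := fun u v => `[< forall x, sval v x <= sval u x >].
have lbT (u : T) x : - p (- x) <= sval u x.
  case: u => q [hq qp] /=; apply: le_trans (sublinear_ge x hq).
  by rewrite lerN2.
have [||| |[q [hq qp]] qmax] := @Zorn T r.
- by move=> u; apply/asboolP.
- move=> u v w /asboolP h1 /asboolP h2; apply/asboolP => x.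
  exact: le_trans (h2 x) (h1 x).
- move=> [u hu] [v hv] /asboolP/= h1 /asboolP/= h2; apply: eq_exist.
  by apply/funext => x; apply/eqP; rewrite eq_le h1 h2.
- move=> A tA; have [[u0 Au0]|A0] := pselect (A !=set0); last first.
    exists (exist _ p (conj hp (fun x => lexx (p x)))) => u Au.
    by exfalso; apply: A0; exists u.
  have [] := @sublinear_inf T A (fun u => sval u) p (ex_intro _ u0 Au0).
  + by move=> u x _; exact: lbT.
  + move=> u v x y Au Av.
    have [/asboolP uv|/asboolP vu] := tA u v Au Av.
      exists v => //; apply: le_trans ((svalP v).1.1 x y) _.
      by rewrite lerD2r.
    exists u => //; apply: le_trans ((svalP u).1.1 x y) _.
    by rewrite lerD2l.
  + by move=> u c x c0 Au; exists u => //; exact: (svalP u).1.2.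
  + set q := fun x => _; move=> hq qle.
    have qp x : q x <= p x by apply: le_trans (qle _ x Au0) ((svalP u0).2 x).
    exists (exist _ q (conj hq qp)) => u Au; apply/asboolP => x /=.
    exact: qle.
(* The functional z |-> inf over t >= 0 of q(z + t a) - t q(a) is sublinear and below [q], hence
   equal to [q] by minimality; t = 1 gives superadditivity. *)
have qadd x a : q x + q a <= q (x + a).
  have [] := @sublinear_inf R [set t | 0 <= t]
    (fun t z => q (z + t *: a) - t * q a) q (ex_intro _ 0 (lexx 0)).
  - move=> t z /= t0; have := hq.1 (z + t *: a) (- z).
    by rewrite addrAC subrr add0r (sublinearZ _ hq)//; lra.
  - move=> s t y z /= s0 t0; exists (s + t); first by rewrite /= addr_ge0.
    have := hq.1 (y + s *: a) (z + t *: a).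
    by rewrite addrACA -scalerDl mulrDl; lra.
  - move=> t c z c0 /= t0; exists (c * t); first by rewrite /= mulr_ge0// ltW.
    have := hq.2 c (z + t *: a) c0.
    by rewrite scalerDr scalerA mulrBr mulrA; lra.
  - set q' := fun x => _; move=> hq' q'le.
    have q'q z : q' z <= q z.
      by have := q'le 0 z (lexx 0); rewrite scale0r addr0 mul0r subr0.
    have q'p z : q' z <= p z by exact: le_trans (q'q z) (qp z).
    have /(congr1 sval)/= e := qmax (exist _ q' (conj hq' q'p)) (asboolT q'q).
    have : q' x <= q (x + 1 *: a) - 1 * q a by exact: q'le ler01.
    by rewrite scale1r mul1r e; lra.
have qD x y : q (x + y) = q x + q y.
  by apply/eqP; rewrite eq_le qadd hq.1.
have qN x : q (- x) = - q x.
  by have := qD x (- x); rewrite subrr sublinear0//; lra.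
exists q; split => // c x.
have [c0|c0] := leP 0 c; first exact: sublinearZ.
by rewrite -[c]opprK scaleNr qN sublinearZ ?mulNr// oppr_ge0 ltW.
Qed.

(** Instead of extending [f] one dimension at a time, [p] is replaced by the infimum over w of p(x -
    j w) + f w. It is still sublinear, and a linear functional below it is at most [f] at both w and
    -w, hence equal to [f]. *)
Theorem hahn_banach (W : lmodType R) (j : W -> V) (f : W -> R) p :
  sublinear p ->
  (forall u v, j (u + v) = j u + j v) -> (forall c u, j (c *: u) = c *: j u) ->
  (forall u v, f (u + v) = f u + f v) -> (forall c u, f (c *: u) = c * f u) ->
  (forall w, f w <= p (j w)) ->
  exists l : V -> R,
  [/\ forall x y, l (x + y) = l x + l y, forall c x, l (c *: x) = c * l x,
      forall x, l x <= p x & forall w, l (j w) = f w].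
Proof.
move=> hp jD jZ fD fZ fp.
have j0 : j 0 = 0 by have := jZ 0 0; rewrite !scale0r.
have f0 : f 0 = 0 by have := fZ 0 0; rewrite scale0r mul0r.
have jN w : j (- w) = - j w by rewrite -scaleN1r jZ scaleN1r.
have fN w : f (- w) = - f w by rewrite -scaleN1r fZ mulN1r.
have [] := @sublinear_inf W setT (fun w x => p (x - j w) + f w) p (ex_intro _ 0 I).
- move=> w x _; have := fp (- w); rewrite fN jN.
  have := hp.1 (x - j w) (- x); rewrite addrAC subrr add0r.
  lra.
- move=> v w x y _ _; exists (v + w) => //.
  have := hp.1 (x - j v) (y - j w).
  by rewrite addrACA -opprD -jD fD; lra.
- move=> w c x c0 _; exists (c *: w) => //.
  have := hp.2 c (x - j w) c0.
  by rewrite scalerBr -jZ fZ mulrDr; lra.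
set q := fun x => _; move=> hq qle.
have [l [lD lZ lq]] := linear_le_sublinear hq.
have lp x : l x <= p x.
  by apply: le_trans (lq x) _; have := qle 0 x I; rewrite j0 subr0 f0 addr0.
have lf w : l (j w) <= f w.
  apply: le_trans (lq _) _; have := qle w (j w) I.
  by rewrite subrr sublinear0// add0r.
exists l; split => // w; apply/eqP; rewrite eq_le lf /=.
have := lf (- w); rewrite fN jN -scaleN1r lZ; lra.
Qed.

End hahn_banach.

Section dominated_functional.
Context d (T : measurableType d) (R : realType).
Variable m : {measure set T -> \bar R}.

(** Domination by the integral of the positive part makes the extension positive (apply it to -g for
    g >= 0) and at the same time bounded by [m], from which countable additivity will follow. *)
Lemma hahn_banach_integral (W : lmodType R) (j : W -> T -> R) (f : W -> R) :
  (forall w, integ m (j w)) ->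
  (forall u v x, j (u + v) x = j u x + j v x) ->
  (forall c u x, j (c *: u) x = c * j u x) ->
  (forall u v, f (u + v) = f u + f v) -> (forall c u, f (c *: u) = c * f u) ->
  (forall w, f w <= \int[m]_x Num.max (j w x) 0) ->
  exists L : (T -> R) -> R,
  [/\ forall g h, integ m g -> integ m h -> L (fun x => g x + h x) = L g + L h,
      forall c g, integ m g -> L (fun x => c * g x) = c * L g,
      forall g, integ m g -> L g <= \int[m]_x Num.max (g x) 0 &
      forall w, L (j w) = f w].
Proof.
move=> ij jD jZ fD fZ fle.
have p1 : (1 <= 1 :> \bar R)%E by [].
pose V := LfunType m p1.
have iV (F : V) : integ m F by apply/Lfun1_integrable; exact: LfunP.
pose mk g (ig : integ m g) : V :=
  Lfun_Sub p1 ((Lfun1_integrable m g).2 ig).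
have imax g : integ m g -> integ m (fun x => Num.max (g x) 0).
  move=> ig; have mg := integ_meas ig.
  apply: (integ_le _ (integ_abs ig)).
    exact: measurable_maxr.
  by move=> x; rewrite /Num.max; case: ifP => // _; rewrite normr0.
pose p (F : V) := \int[m]_x Num.max (F x) 0.
have hp : sublinear p.
  split=> [F G|c F c0]; rewrite /p.
    rewrite -RintD; [|exact: imax|exact: imax].
    apply: Rint_le.
    - exact: imax.
    - by apply: integD; exact: imax.
    - move=> x; change (Num.max (F x + G x) 0 <= Num.max (F x) 0 + Num.max (G x) 0).
      rewrite /Num.max; case: (ltP (F x + G x) 0) => h1;
        case: (ltP (F x) 0) => h2; case: (ltP (G x) 0) => h3; lra.
  rewrite -RintZ; last exact: imax.
  apply: Rint_le.
  - exact: imax.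
  - by apply: integZ; exact: imax.
  - move=> x; change (Num.max (c * F x) 0 <= c * Num.max (F x) 0).
    by rewrite maxr_pMr ?mulr0//; exact: ltW.
have mkD u v : mk _ (ij (u + v)) = mk _ (ij u) + mk _ (ij v).
  by apply/LfuneqP => x; exact: jD.
have mkZ c u : mk _ (ij (c *: u)) = c *: mk _ (ij u).
  by apply/LfuneqP => x; exact: jZ.
have [l [lD lZ lp lf]] := @hahn_banach R V W (fun w => mk _ (ij w)) f p hp
  mkD mkZ fD fZ fle.
(* [l] lives on the space of integrable functions; 0 is a default elsewhere. *)
pose L (g : T -> R) : R :=
  if pselect (integ m g) is left ig then l (mk g ig) else 0.
have LE g (ig : integ m g) : L g = l (mk g ig).
  by rewrite /L; case: pselect => // ig'; congr (l (mk _ _)); exact: bool_irrelevance.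
exists L; split.
- move=> g h ig ih; rewrite (LE _ ig) (LE _ ih) (LE _ (integD ig ih)) -lD.
  by congr l; apply/LfuneqP.
- move=> c g ig; rewrite (LE _ ig) (LE _ (integZ c ig)) -lZ.
  by congr l; apply/LfuneqP.
- by move=> g ig; rewrite (LE _ ig); exact: lp.
- by move=> w; rewrite (LE _ (ij w)).
Qed.

End dominated_functional.

Section functional_measure.
Context d (T : measurableType d) (R : realType).
Variable m : {measure set T -> \bar R}.
Hypothesis moo : (m setT < +oo)%E.
Variable L : (T -> R) -> R.
Hypothesis LD : forall g h, integ m g -> integ m h ->
  L (fun x => g x + h x) = L g + L h.
Hypothesis LZ : forall c g, integ m g -> L (fun x => c * g x) = c * L g.
Hypothesis Lle : forall g, integ m g -> L g <= \int[m]_x Num.max (g x) 0.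
Import HBSimple HBNNSimple.

Let L0 : L (fun=> 0) = 0.
Proof.
have -> : (fun=> 0) = (fun x : T => 0 * (0 : R)) by apply/funext => x; rewrite mul0r.
by rewrite (LZ 0 (integ0 m)) mul0r.
Qed.

Let LB g h : integ m g -> integ m h -> L (fun x => g x - h x) = L g - L h.
Proof.
move=> ig ih; rewrite LD//; last exact: integN.
congr (_ + _); rewrite -mulN1r -LZ//; congr L.
by apply/funext => x; rewrite mulN1r.
Qed.

Let L_ge0 g : integ m g -> (forall x, 0 <= g x) -> 0 <= L g.
Proof.
move=> ig g0; have := Lle (integN ig).
rewrite (_ : (fun x => - g x) = (fun x => (-1) * g x)); last first.
  by apply/funext => x; rewrite mulN1r.
rewrite LZ// mulN1r (@eq_Rintegral _ _ _ m setT (fun=> 0)) ?Rint0; first by lra.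
by move=> x _; apply/max_idPr; rewrite ?mulN1r oppr_le0.
Qed.

Let Lle1 g : integ m g -> (forall x, 0 <= g x) -> L g <= \int[m]_x g x.
Proof.
move=> ig g0; apply: le_trans (Lle ig) _.
by under eq_Rintegral => x _ do rewrite (max_idPl (g0 x)).
Qed.

Let Labs g : integ m g -> `|L g| <= \int[m]_x `|g x|.
Proof.
move=> ig; have ia := integ_abs ig.
have h c : `|c| = 1 -> c * L g <= \int[m]_x `|g x|.
  move=> c1; rewrite -LZ//.
  have icg := integZ c ig.
  apply: le_trans (Lle icg) _; apply: Rint_le => //.
    apply: (integ_le _ (integ_abs icg)).
      by apply: measurable_maxr => //; exact: integ_meas icg.
    by move=> x; rewrite /Num.max; case: ifP => // _; rewrite normr0.
  move=> x; rewrite ge_max normr_ge0 andbT.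
  by rewrite (le_trans (ler_norm _))// normrM c1 mul1r.
have := h 1 (normr1 _); have := h (-1); rewrite normrN1 => /(_ erefl).
by rewrite ler_norml; lra.
Qed.

Let iind A : measurable A -> integ m (\1_A).
Proof. by move=> mA; exact: integ_indic. Qed.

Let nu (A : set T) : \bar R := if pselect (measurable A) then (L \1_A)%:E else 0%E.

Let nuE A : measurable A -> nu A = (L \1_A)%:E.
Proof. by rewrite /nu; case: pselect. Qed.

Let nu0 : nu set0 = 0%E.
Proof. by rewrite nuE// indic0 L0. Qed.

Let nu_ge0 A : (0 <= nu A)%E.
Proof.
rewrite /nu; case: pselect => // mA; rewrite lee_fin L_ge0//; exact: iind.
Qed.

Let fin A : measurable A -> m A \is a fin_num.
Proof.
exact: fin_num_lty.
Qed.

Let nule A : measurable A -> (nu A <= m A)%E.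
Proof.
move=> mA; rewrite nuE//; apply: (@le_trans _ _ (\int[m]_x \1_A x)%:E).
  by rewrite lee_fin; apply: Lle1 => //; exact: iind.
by rewrite Rint_indic// fineK// fin.
Qed.

Let sum_indic_le (F : nat -> set T) n x : (forall i, measurable (F i)) ->
  trivIset setT F -> measurable (\bigcup_i F i) ->
  \sum_(k < n) \1_(F k) x <= \1_(\bigcup_i F i) x :> R.
Proof.
move=> mF tF mUF; rewrite -lee_fin -sumEFin.
have -> : (\1_(\bigcup_n F n) x)%:E = \d_x (\bigcup_n F n) :> \bar R by [].
rewrite -(cvg_lim _ (@measure_semi_sigma_additive _ _ _ (\d_x) F mF tF mUF))//.
rewrite -(big_mkord xpredT (fun k => (\1_(F k) x)%:E)).
by apply: nneseries_lim_ge => k _.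
Qed.

Let nu_sigma : semi_sigma_additive nu.
Proof.
move=> F mF tF mUF; set U := \bigcup_n F n.
have nuS n : (\sum_(0 <= k < n) nu (F k))%E = (\sum_(k < n) L \1_(F k))%:E.
  by rewrite big_mkord -sumEFin; apply: eq_bigr => k _; rewrite nuE.
have LS n : L (fun x => \sum_(k < n) \1_(F k) x) = \sum_(k < n) L \1_(F k).
  elim: n => [|n IH].
    rewrite big_ord0; apply: etrans L0; congr L; apply/funext => x; exact: big_ord0.
  rewrite big_ord_recr/= -IH -LD//; last exact: iind.
    by congr L; apply/funext => x; rewrite big_ord_recr.
  by apply: integ_sum => k; exact: iind.
have iS n : integ m (fun x => \sum_(k < n) \1_(F k) x).
  by apply: integ_sum => k; exact: iind.
rewrite nuE//; under eq_fun do rewrite nuS.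
apply/cvg_EFin; first exact: nearW.
have mS n : \int[m]_x (\sum_(k < n) \1_(F k) x) = \sum_(k < n) fine (m (F k)).
  rewrite Rint_sum; last by move=> k; exact: iind.
  by apply: eq_bigr => k _; apply: EFin_inj; rewrite Rint_indic.
have mU : \int[m]_x \1_U x = fine (m U) by apply: EFin_inj; rewrite Rint_indic.
have cm : (fun n => \sum_(k < n) fine (m (F k))) @ \oo --> fine (m U).
  have := @measure_semi_sigma_additive _ _ _ m F mF tF mUF.
  rewrite -/U -(fineK (fin mUF)) => /fine_cvg; rewrite fineK ?fin//.
  rewrite (_ : fine \o _ = fun n => \sum_(k < n) fine (m (F k)))//.
  apply/funext => n /=; rewrite big_mkord (eq_bigr (fun k : 'I_n => (fine (m (F k)))%:E)).
    by rewrite sumEFin.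
  by move=> k _; rewrite fineK// fin.
(* The gap between L(1_U) and its partial sums lies between 0 and the corresponding gap for [m],
   which tends to 0. *)
apply: (@squeeze_cvgr _ _ _ _
   (fun n => L \1_U - (fine (m U) - \sum_(k < n) fine (m (F k)))) (fun=> L \1_U)).
- apply: nearW => n /=; rewrite -LS.
  have i1 : integ m (fun x => \1_U x - \sum_(k < n) \1_(F k) x).
    by apply: integB => //; exact: iind.
  have g0 x : 0 <= \1_U x - \sum_(k < n) \1_(F k) x :> R.
    by rewrite subr_ge0; exact: sum_indic_le.
  have := L_ge0 i1 g0; have := Lle1 i1 g0.
  rewrite LB//; last exact: iind.
  rewrite RintB//; last exact: iind.
  by rewrite mS mU; lra.
- rewrite -[X in _ --> X]subr0 -[X in _ --> _ - X](subrr (fine (m U))).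
  by apply: cvgB; [exact: cvg_cst|apply: cvgB => //; exact: cvg_cst].
- exact: cvg_cst.
Qed.

(** Since 0 <= L g <= int g dm for g >= 0, the set function A |-> L(1_A) inherits countable
    additivity from [m], and density of simple functions in L^1(m) identifies its integral with [L].
    Domination by [m] thus takes the place of a Riesz representation theorem. *)
Lemma functional_measure : exists n : {measure set T -> \bar R},
  (forall A, measurable A -> (n A <= m A)%E) /\
  forall g, integ m g -> integ n g /\ \int[n]_x g x = L g.
Proof.
pose nx := isMeasure.Build _ _ _ nu nu0 nu_ge0 nu_sigma.
pose n : {measure set T -> \bar R} := HB.pack nu nx.
have nle A : measurable A -> (n A <= m A)%E by exact: nule.
exists n; split => // g ig.
have noo : (n setT < +oo)%E by apply: le_lt_trans moo; exact: nle.
have nle_int f : measurable_fun setT f -> (forall x, 0 <= f x)%E ->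
    (\int[n]_x f x <= \int[m]_x f x)%E.
  by move=> mf f0; apply: ge0_le_measure_integral.
have inm f : integ m f -> integ n f.
  move=> /integrableP[mf h]; apply/integrableP; split => //.
  by apply: le_lt_trans h; apply: nle_int => //; exact: measurableT_comp.
have Rle f : integ m f -> (forall x, 0 <= f x) -> \int[n]_x f x <= \int[m]_x f x.
  move=> i0 f0; rewrite -lee_fin !RintE//; last exact: inm.
  by apply: nle_int => //; exact: measurable_int i0.
split; first exact: inm.
have [h [ih _ hcvg]] := approximation_sfun_integrable measurableT ig.
have LS I (r : seq I) (F : I -> T -> R) : (forall i, integ m (F i)) ->
    L (fun x => \sum_(i <- r) F i x) = \sum_(i <- r) L (F i).
  move=> iF; elim: r => [|i r IH].
    rewrite big_nil; apply: etrans L0; congr L; apply/funext => x; exact: big_nil.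
  rewrite big_cons -IH -LD//; last exact: integ_sum.
  by congr L; apply/funext => x; rewrite big_cons.
have nL k : \int[n]_x h k x = L (h k).
  pose c i : R := (finmap.enum_fset (fset_set (range (h k))))`_i.
  pose F i (x : T) : R := c i * \1_(h k @^-1` [set c i]) x.
  have hE : h k = (fun x => \sum_(i < size (finmap.enum_fset (fset_set (range (h k))))) F i x) :> (T -> R).
    by apply/funext => x; exact: fimfunEord.
  have mA i : measurable (h k @^-1` [set c i]).
    by rewrite -[X in measurable X]setTI; exact: (measurable_funP (h k)).
  have iF i : integ m (F i) by apply: integZ; exact: iind.
  rewrite hE LS// Rint_sum//; last by move=> i; exact: inm.
  apply: eq_bigr => i _; rewrite LZ; last exact: iind.
  rewrite RintZ; last by apply: inm; exact: iind.
  congr (_ * _); apply: EFin_inj; rewrite Rint_indic//.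
  by rewrite /n /= nuE.
have ihT k : integ m (h k) by exact: ih.
(* Both functionals agree on simple functions and are bounded by the L^1(m)-norm, hence the factor
   2. *)
have bnd k : `|\int[n]_x g x - L g| <= 2 * \int[m]_x `|g x - h k x|.
  have igh := integB ig (ihT k).
  have h1 : `|L (fun x => g x - h k x)| <= \int[m]_x `|g x - h k x| by exact: Labs.
  have h2 : `|\int[n]_x (g x - h k x)| <= \int[m]_x `|g x - h k x|.
    apply: le_trans (Rint_abs (inm _ igh)) _.
    by apply: Rle => //; exact: integ_abs.
  move: h1 h2; rewrite LB// RintB; [|exact: inm|exact: inm].
  rewrite nL => h1 h2.
  have -> : \int[n]_x g x - L g = (\int[n]_x g x - L (h k)) - (L g - L (h k)) by lra.
  by rewrite (le_trans (ler_normB _ _))//; lra.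
have cv : (fun k => 2 * \int[m]_x `|g x - h k x|) @ \oo --> (0 : R).
  rewrite -[X in _ --> X](mulr0 2); apply: cvgM; first exact: cvg_cst.
  by have /fine_cvg := hcvg.
apply/eqP; rewrite -subr_eq0 -normr_le0.
rewrite -(cvg_lim _ cv)//.
apply: limr_ge; first by apply/cvg_ex; exists 0.
by apply: nearW => k; exact: bnd.
Qed.

End functional_measure.

(** * Indicators of sublevel sets as limits of polynomials *)

Section threshold.
Context (R : realType).
Implicit Types (a z y : R).

Lemma expr_1B_ge a n : 0 <= a <= 1 -> 1 - n%:R * a <= (1 - a) ^+ n.
Proof.
move=> /andP[a0 a1]; elim: n => [|n IH]; first by rewrite mul0r subr0 expr0.
rewrite exprS; apply: le_trans (ler_wpM2l _ IH); last by rewrite subr_ge0.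
rewrite -natr1; have : 0 <= n%:R * a * a by rewrite !mulr_ge0.
by lra.
Qed.

Lemma expr_1D_ge a n : 0 <= a -> 1 + n%:R * a <= (1 + a) ^+ n.
Proof.
move=> a0; elim: n => [|n IH]; first by rewrite mul0r addr0 expr0.
rewrite exprS; apply: le_trans (ler_wpM2l _ IH); last by rewrite addr_ge0.
rewrite -natr1; have : 0 <= n%:R * a * a by rewrite !mulr_ge0.
by lra.
Qed.

Lemma expr_1B_le a n : 0 <= a <= 1 -> (1 - a) ^+ n <= (1 + n%:R * a)^-1.
Proof.
move=> /andP[a0 a1].
have p1 : 0 < 1 + n%:R * a by rewrite ltr_wpDr// mulr_ge0.
rewrite -[leRHS]mul1r ler_pdivlMr//.
apply: (@le_trans _ _ ((1 - a) ^+ n * (1 + a) ^+ n)).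
  by apply: ler_wpM2l; [rewrite exprn_ge0// subr_ge0|exact: expr_1D_ge].
rewrite -exprMn exprn_ile1//; last nra.
by rewrite mulr_ge0// ?subr_ge0// addr_ge0.
Qed.

Lemma cvg_natr_expr z : 0 <= z < 1 -> (fun n => n%:R * z ^+ n) @ \oo --> (0 : R).
Proof.
move=> /andP[z0 z1]; have [->|zn0] := eqVneq z 0.
  apply: (@cvg_trans _ ((fun=> 0 : R) @ \oo)); last exact: cvg_cst.
  apply: near_eq_cvg; near=> n; rewrite expr0n gtn_eqF ?mulr0//.
  by near: n; exists 1%N.
have zp : 0 < z by rewrite lt_neqAle eq_sym zn0.
(* Half of the geometric decay pays for the factor n: n w^n stays bounded by Bernoulli's inequality,
   and the other factor w^n tends to 0. *)
pose w := Num.sqrt z.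
have wp : 0 < w by rewrite sqrtr_gt0.
have w1 : w < 1 by rewrite -sqrtr1 ltr_sqrt.
have wz : w ^+ 2 = z by rewrite sqr_sqrtr.
pose h := w^-1 - 1.
have hp : 0 < h by rewrite subr_gt0 invf_gt1.
have key n : n%:R * w ^+ n <= h^-1.
  rewrite -[leRHS]mul1r ler_pdivlMr//.
  have := expr_1D_ge n (ltW hp); rewrite (_ : 1 + h = w^-1) => [e|]; last first.
    by rewrite /h addrC subrK.
  have wn : 0 < w ^+ n by exact: exprn_gt0.
  have : w ^+ n * (1 + n%:R * h) <= 1.
    apply: (@le_trans _ _ (w ^+ n * w^-1 ^+ n)); first by rewrite ler_pM2l.
    by rewrite exprVn mulfV// gt_eqF.
  by lra.
apply: (@squeeze_cvgr _ _ _ _ (fun=> 0) (fun n => h^-1 * w ^+ n)).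
- apply: nearW => n; rewrite mulr_ge0 ?exprn_ge0//=.
  rewrite -wz -exprM mulnC exprM expr2 mulrA ler_wpM2r//.
  by rewrite exprn_ge0// ltW.
- exact: cvg_cst.
- rewrite -[X in _ --> X](mulr0 h^-1); apply: cvgM; first exact: cvg_cst.
  by apply: cvg_expr; rewrite gtr0_norm.
Unshelve. all: by end_near. Qed.

(* The exponent n 2^n (rather than 2^n) forces the value 0 at y = 1/2. *)
Definition threshold n y := (1 - y ^+ n) ^+ (n * 2 ^ n).

Lemma threshold_ge0 n y : 0 <= y <= 1 -> 0 <= threshold n y <= 1.
Proof.
move=> /andP[y0 y1]; have yn : 0 <= y ^+ n <= 1 by rewrite exprn_ge0// exprn_ile1.
by rewrite exprn_ge0 ?exprn_ile1//; lra.
Qed.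

(** With a = y^n and N = n 2^n one has N a = n (2y)^n, which tends to 0 for y < 1/2 and is at least
    n otherwise; Bernoulli's inequalities 1 - N a <= (1 - a)^N <= 1/(1 + N a) conclude. Such
    polynomials occur in elementary proofs of the Stone-Weierstrass theorem. *)
Lemma cvg_threshold y : 0 <= y <= 1 ->
  threshold^~ y @ \oo --> ((y < 2^-1)%R%:R : R).
Proof.
move=> /andP[y0 y1]; have yn n : 0 <= y ^+ n <= 1 by rewrite exprn_ge0// exprn_ile1.
have Na n : (n * 2 ^ n)%:R * y ^+ n = n%:R * (2 * y) ^+ n.
  by rewrite natrM natrX exprMn mulrA.
case: ltP => y2 /=.
  apply: (@squeeze_cvgr _ _ _ _ (fun n => 1 - n%:R * (2 * y) ^+ n) (fun=> 1)).
  - apply: nearW => n /=; have /andP[_ ->] := @threshold_ge0 n y (introT andP (conj y0 y1)).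
    by rewrite andbT -Na; exact: expr_1B_ge.
  - rewrite -[X in _ --> X]subr0; apply: cvgB; first exact: cvg_cst.
    by apply: cvg_natr_expr; lra.
  - exact: cvg_cst.
apply: (@squeeze_cvgr _ _ _ _ (fun=> 0) (fun n => (1 + n%:R)^-1)).
- apply: nearW => n /=; have /andP[-> _] := @threshold_ge0 n y (introT andP (conj y0 y1)).
  apply: le_trans (expr_1B_le _ (yn n)) _.
  rewrite lef_pV2 ?posrE ?ltr_wpDr ?mulr_ge0//; last by case/andP: (yn n).
  rewrite lerD2l Na ler_peMr// exprn_ege1//.
  by lra.
- exact: cvg_cst.
- under eq_fun do rewrite nat1r. exact: cvg_harmonic.
Qed.

End threshold.

Section function_algebra.
Context d (T : measurableType d) (R : realType).
Variables m1 m2 : {measure set T -> \bar R}.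
Hypotheses (m1oo : (m1 setT < +oo)%E) (m2oo : (m2 setT < +oo)%E).
Variable A : set (T -> R).
Hypothesis Ameas : forall f, A f -> measurable_fun setT f.
Hypothesis Abnd : forall f, A f -> exists M, forall x, `|f x| <= M.
Hypothesis Acst : forall c, A (fun=> c).
Hypothesis AD : forall f g, A f -> A g -> A (fun x => f x + g x).
Hypothesis AM : forall f g, A f -> A g -> A (fun x => f x * g x).
Hypothesis Aint : forall f, A f -> \int[m1]_x f x = \int[m2]_x f x.

Let AX f n : A f -> A (fun x => f x ^+ n).
Proof.
move=> Af; elim: n => [|n IH]; first exact: (Acst 1).
by under eq_fun do rewrite exprS; exact: AM.
Qed.

Let Aprod (I : Type) (s : seq I) (f : I -> T -> R) : (forall i, A (f i)) ->
  A (fun x => \prod_(i <- s) f i x).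
Proof.
move=> Af; elim: s => [|i s IH].
  by under eq_fun do rewrite big_nil; exact: (Acst 1).
by under eq_fun do rewrite big_cons; exact: AM.
Qed.

(** The indicator of the set is a bounded pointwise limit of members of [A], namely of products of
    thresholds, and dominated convergence carries the equality of integrals to the limit. Several
    inequalities at once are allowed in order to reach orthants as well as rays. *)
Lemma bounded_algebra_sublevel (I : finType) (u : I -> T -> R) (c : I -> R) :
  (forall i, A (u i)) ->
  m1 [set x | forall i, u i x < c i] = m2 [set x | forall i, u i x < c i].
Proof.
move=> Au; set S := [set x | _].
have /choice[M HM] : forall i, exists M, forall x, `|u i x| <= M.
  by move=> i; exact: Abnd.
pose K i := `|M i| + `|c i| + 1.
have K0 i : 0 < K i by rewrite ltr_wpDl// addr_ge0.
(* Affine rescaling of u_i into [0, 1] that moves the level c_i to 1/2; K_i bounds |u_i - c_i|. *)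
pose y i x := 2^-1 + (u i x - c i) / (2 * K i).
have y01 i x : 0 <= y i x <= 1.
  have /ler_normlP[h1 h2] := HM i x.
  have h3 : M i <= `|M i| by exact: ler_norm.
  have /andP[h4 h5] : - `|c i| <= c i <= `|c i| by rewrite -ler_norml.
  have Ki := K0 i.
  have e : (u i x - c i) = ((u i x - c i) / (2 * K i)) * (2 * K i).
    by rewrite divfK// gt_eqF// mulr_gt0.
  have : - K i <= u i x - c i <= K i by rewrite /K; lra.
  by rewrite e /y; set t := _ / _; nra.
have yc i x : (y i x < 2^-1) = (u i x < c i).
  by rewrite /y gtrDl pmulr_llt0 ?subr_lt0// invr_gt0 mulr_gt0.
have Ay i : A (y i).
  apply: AD; first exact: Acst.
  apply: AM; last exact: Acst.
  by apply: AD => //; exact: (Acst (- c i)).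
pose f n x := \prod_(i : I) threshold n (y i x).
have Af n : A (f n).
  apply: Aprod => i; apply: AX.
  apply: AD; first exact: Acst.
  under eq_fun do rewrite -mulN1r.
  by apply: AM; [exact: Acst|exact: AX].
have f01 n x : 0 <= f n x <= 1.
  apply: (big_ind (fun r : R => 0 <= r <= 1)) => [|r t|i _]; first by rewrite ler01 lexx.
    by move=> /andP[r0 r1] /andP[t0 t1]; rewrite mulr_ge0//= mulr_ile1.
  exact: threshold_ge0.
have Sind x : \1_S x = \prod_(i : I) (u i x < c i)%R%:R :> R.
  rewrite indicE; have [/set_mem Sx|/negP xS] := boolP (x \in S).
    by rewrite big1// => i _; rewrite Sx.
  have /existsNP[i /negP ui] : ~ forall i, u i x < c i.
    by move=> h; apply: xS; apply/mem_set.
  by rewrite (bigD1 i)//= (negbTE ui) mul0r.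
have fcvg x : (fun n => f n x) @ \oo --> (\1_S x : R).
  rewrite Sind; rewrite /f; elim: (index_enum I) => [|i s IH].
    by under eq_fun do rewrite big_nil; rewrite big_nil; exact: cvg_cst.
  under eq_fun do rewrite big_cons; rewrite big_cons.
  by apply: cvgM => //; rewrite -yc; exact: cvg_threshold.
have mS : measurable S.
  rewrite (_ : S = \big[setI/setT]_(i : I) [set x | u i x < c i]).
    apply: bigsetI_measurable => i _.
    rewrite -[X in measurable X]setTI.
    exact: (Ameas (Au i) measurableT (measurable_itv `]-oo, c i[)).
  apply/seteqP; split => x; rewrite -bigcap_seq => h i; first by move=> _; exact: h.
  by apply: h; rewrite /= mem_index_enum.
have lim (m : {measure set T -> \bar R}) : (m setT < +oo)%E ->
    (\int[m]_x (f n x)%:E)%E @[n --> \oo] --> m S.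
  move=> moo; rewrite (_ : m S = (\int[m]_x (\1_S x)%:E)%E); last by rewrite integral_indic// setIT.
  have [|||||_ _ cv] := @dominated_convergence _ T R m setT measurableT
    (fun n x => (f n x)%:E) (EFin \o \1_S) (fun=> 1%E).
  - by move=> n; apply/measurable_EFinP; apply: Ameas.
  - exact/measurable_EFinP.
  - by apply: aeW => x _ /=; apply/cvg_EFin; [exact: nearW|exact: fcvg].
  - by apply: (@integ_bounded _ _ _ m (fun=> 1) 1) => // x; rewrite normr1.
  - apply: aeW => x n _ /=; rewrite lee_fin; have /andP[h1 h2] := f01 n x.
    by rewrite ger0_norm.
  - exact: cv.
have e n : (\int[m1]_x (f n x)%:E = \int[m2]_x (f n x)%:E)%E.
  have ib (m : {measure set T -> \bar R}) : (m setT < +oo)%E -> integ m (f n).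
    move=> moo; apply: (integ_bounded (c := 1) moo (Ameas (Af n))) => x.
    by have /andP[h1 h2] := f01 n x; rewrite ger0_norm.
  by rewrite -!RintE ?ib// Aint.
have := lim m1 m1oo; under eq_fun do rewrite e.
by move=> /cvg_lim <-//; have /cvg_lim <- := lim m2 m2oo.
Qed.

End function_algebra.

(** * Stieltjes moment problems *)

Section real_line.
Context (R : realType).
Implicit Types a b m : {measure set R -> \bar R}.

Lemma measurable_horner (q : {poly R}) : measurable_fun setT (horner q).
Proof.
exact: continuous_measurable_fun (@continuous_horner _ q).
Qed.

Lemma measurable_Rinv : measurable_fun setT (@GRing.inv R).
Proof.
have -> : [set: R] = [set 0] `|` ~` [set 0] by rewrite setUv.
apply/measurable_funU; first exact: measurable_set1.
  by apply: measurableC; exact: measurable_set1.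
split; first exact: measurable_fun_set1.
apply: open_continuous_measurable_fun.
  apply: closed_openC; apply: accessible_closed_set1.
  exact: hausdorff_accessible.
by move=> x; rewrite inE/= => /eqP; exact: inv_continuous.
Qed.

Lemma rays_measure_unique m1 m2 : (m1 setT < +oo)%E ->
  (forall x, m1 `]x, +oo[%classic = m2 `]x, +oo[%classic) ->
  forall A, measurable A -> m1 A = m2 A.
Proof.
move=> m1oo h A mA.
apply: (@measure_unique _ R _ (@RGenOInfty.G R) (fun n => `]- n%:R, +oo[%classic)) => //.
- exact: RGenOInfty.measurableE.
- move=> _ _ [x ->] [y ->]; exists (Num.max x y).
  by apply/seteqP; split => z /=; rewrite !in_itv/= !andbT gt_max;
    [move=> [-> ->]|move=> /andP[]].
- by move=> n; exists (- n%:R).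
- apply/seteqP; split => // x _; exists (Num.trunc `|x|).+1 => //=.
  rewrite in_itv/= andbT ltrNl.
  by rewrite (le_lt_trans _ (truncnS_gt _))// -normrN ler_norm.
- by move=> _ [x ->]; exact: h.
- move=> n; apply: le_lt_trans m1oo; apply: le_measure; rewrite ?inE//.
Qed.

Lemma halfline_Rint m (f g : R -> R) : on_halfline m ->
  measurable_fun setT f -> measurable_fun setT g ->
  (forall t, 0 <= t -> f t = g t) ->
  (integ m f -> integ m g) /\ \int[m]_x f x = \int[m]_x g x.
Proof.
move=> m0 mf mg fg; apply: (@ae_eq0_Rint _ _ _ m `]-oo, 0[%classic) => //.
by move=> x; rewrite /= in_itv/= => /negP; rewrite -leNgt; exact: fg.
Qed.

Definition finite_moments m := forall q : {poly R}, integ m (horner q).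

Definition same_moments m1 m2 :=
  forall q : {poly R}, \int[m1]_x q.[x] = \int[m2]_x q.[x].

Lemma finite_moments_lty m : finite_moments m -> (m setT < +oo)%E.
Proof.
move=> /(_ 1)/integrableP[_] /=.
under eq_integral do rewrite hornerC normr1.
by rewrite integral_cst// mul1e.
Qed.

Let u (t : R) := (1 + `|t|)^-1.

(** On [0, +oo) the function u(t) = 1/(1 + |t|) is bounded and strictly decreasing, so the
    polynomials in u form a bounded algebra, and the sets u < c are rays up to the null negative
    half-line. *)
Lemma inv1D_unique a b : on_halfline a -> on_halfline b ->
  (a setT < +oo)%E -> (b setT < +oo)%E ->
  (forall n, \int[a]_t (1 + `|t|)^-1 ^+ n = \int[b]_t (1 + `|t|)^-1 ^+ n) ->
  forall A, measurable A -> a A = b A.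
Proof.
move=> a0 b0 aoo boo h.
have mu : measurable_fun setT u.
  have m1 : measurable_fun setT (fun t : R => 1 + `|t|).
    by apply: measurable_funD => //; exact: normr_measurable.
  exact: (measurableT_comp measurable_Rinv m1).
have u0 t : 0 <= u t by rewrite invr_ge0 addr_ge0.
have u1 t : u t <= 1 by rewrite invf_le1 ?lerDl// ltr_wpDr.
have iX (m : {measure set R -> \bar R}) n : (m setT < +oo)%E -> integ m (fun t => u t ^+ n).
  move=> moo; apply: (@integ_bounded _ _ _ m _ 1 moo).
    exact: measurable_funX.
  by move=> t; rewrite ger0_norm ?exprn_ge0// exprn_ile1.
have horner_sum (q : {poly R}) : (fun t => q.[u t]) = (fun t => \sum_(i < size q) q`_i * u t ^+ i).
  by apply/funext => t; rewrite horner_coef.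
apply: rays_measure_unique => // x.
have sub (A : set R) : measurable A -> A `<=` `]-oo, 0[%classic ->
    a A = 0%E /\ b A = 0%E.
  move=> mA A0; split; apply/eqP; rewrite eq_le measure_ge0 andbT.
    by rewrite -a0; apply: le_measure; rewrite ?inE.
  by rewrite -b0; apply: le_measure; rewrite ?inE.
pose alg := [set f : R -> R | exists q : {poly R}, f = fun t => q.[u t]].
have key c : a [set t | u t < c] = b [set t | u t < c].
  have := @bounded_algebra_sublevel _ R R a b aoo boo alg _ _ _ _ _ _
    unit (fun=> u) (fun=> c).
  rewrite (_ : [set x | unit -> _] = [set t | u t < c]).
    apply.
    + by move=> _ [q ->]; exact: (measurableT_comp (measurable_horner q)).
    + move=> _ [q ->]; exists (\sum_(i < size q) `|q`_i|) => t.
      rewrite horner_coef (le_trans (ler_norm_sum _ _ _))//.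
      apply: ler_sum => i _; rewrite normrM ler_piMr//.
      by rewrite ger0_norm ?exprn_ge0// exprn_ile1.
    + by move=> c'; exists c'%:P; apply/funext => t; rewrite hornerC.
    + by move=> _ _ [p ->] [q ->]; exists (p + q); apply/funext => t; rewrite hornerD.
    + by move=> _ _ [p ->] [q ->]; exists (p * q); apply/funext => t; rewrite hornerM.
    + move=> _ [q ->]; rewrite horner_sum !Rint_sum.
      * by apply: eq_bigr => i _; rewrite !RintZ ?h//; exact: iX.
      * by move=> i; apply: integZ; exact: iX.
      * by move=> i; apply: integZ; exact: iX.
    + by move=> _; exists 'X; apply/funext => t; rewrite hornerX.
  by apply/seteqP; split => t /=; [exact|move=> ? _].
have split_null (S : set R) y : S = `]x, +oo[%classic `|` `]-oo, y[%classic -> y <= 0 ->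
    (forall m, on_halfline m -> m S = m `]x, +oo[%classic).
  move=> -> y0 m m0; apply: measureU0 => //.
  apply/eqP; rewrite eq_le measure_ge0 andbT -m0.
  apply: le_measure; rewrite ?inE// => z /=; rewrite !in_itv/= => /lt_le_trans; exact.
have ult t : (u t < u x) = (`|x| < `|t|).
  have up (z : R) : 0 < 1 + `|z| by rewrite ltr_wpDr.
  by rewrite /u ltf_pV2 ?posrE ?up// ltrD2l.
have [x0|x0] := leP 0 x.
  have SE : [set t | u t < u x] = `]x, +oo[%classic `|` `]-oo, -x[%classic.
    apply/seteqP; split => t /=; rewrite !in_itv/= andbT.
      rewrite ult (ger0_norm x0).
      by rewrite lter_normr ltrNr => /orP.
    rewrite ult (ger0_norm x0).
    by rewrite lter_normr ltrNr => xt; apply/orP.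
  by rewrite -!(split_null _ _ SE) ?oppr_le0.
(* For x < 0 the ray has full mass. As u <= 1, the condition u < 2 describes the whole line, and x/2
   > x makes the two pieces cover it. *)
have xle : [set t | u t < 2] = `]x, +oo[%classic `|` `]-oo, x / 2[%classic.
  apply/seteqP; split => t /=; rewrite !in_itv/= andbT => _.
    by case: (ltP x t) => h1; [left|right; lra].
  by rewrite (le_lt_trans (u1 t))// ltr1n.
by rewrite -!(split_null _ _ xle)//; lra.
Qed.

End real_line.

Section positive_roots.
Context (R : realType).

(* Replacing every root z by |z| does not increase |q| on [0, +oo[, since
   | t - |z| | <= |t - z|, whereas |x - z| <= 1 + |z| = | -1 - |z| |. *)
Lemma poly_abs_roots (q : {poly R}) : exists p : {poly R},
  (forall t, 0 <= t -> `|p.[t]| <= `|q.[t]|) /\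
  (forall x, `|x| <= 1 -> `|q.[x]| <= `|p.[-1]|).
Proof.
have [s sE] := closed_field_poly_normal (map_poly (real_complex R) q).
pose r (z : R[i]) := complex.Re `|z|.
have rE (z : R[i]) : `|z| = (r z)%:C%C by rewrite /r normc_def.
have r_ge0 z : 0 <= r z by rewrite -lecR -rE normr_ge0.
have normC (x : R) : `|x%:C%C| = `|x|%:C%C by rewrite normc_def/= expr0n/= addr0 sqrtr_sqr.
exists (`|lead_coef q| *: \prod_(z <- s) ('X - (r z)%:P)).
have qE x : `|q.[x]|%:C%C = `|lead_coef q|%:C%C * \prod_(z <- s) `|x%:C%C - z|.
  rewrite -normC -horner_map sE hornerZ normrM.
  rewrite lead_coef_map normC; congr (_ * _).
  rewrite horner_prod normr_prod; apply: eq_bigr => z _.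
  by rewrite hornerXsubC.
have pE x : `|(`|lead_coef q| *: \prod_(z <- s) ('X - (r z)%:P)).[x]| =
    `|lead_coef q| * \prod_(z <- s) `|x - r z|.
  rewrite hornerZ normrM normr_id horner_prod normr_prod; congr (_ * _).
  by apply: eq_bigr => z _; rewrite hornerXsubC.
have prodC (f : R[i] -> R) : (\prod_(z <- s) f z)%:C%C = \prod_(z <- s) (f z)%:C%C.
  exact: rmorph_prod.
split=> [t t0|x x1]; rewrite pE -lecR qE rmorphM/= prodC; apply: ler_wpM2l;
  rewrite ?lecR//; apply: ler_prod => z _.
- rewrite lecR normr_ge0 /= -normC rmorphB/= -rE.
  have {1}-> : t%:C%C = `|t%:C%C| by rewrite normC ger0_norm.
  exact: ler_dist_dist.
- rewrite normr_ge0/=.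
  have -> : `|-1 - r z| = 1 + r z by rewrite -opprD normrN ger0_norm// addr_ge0.
  rewrite rmorphD/= -rE (le_trans (ler_normB _ _))// lerD2r.
  by rewrite normC lecR.
Qed.

End positive_roots.

Section evaluation_bound.
Context (R : realType).
Variables a b g : {measure set R -> \bar R}.
Hypotheses (a0 : on_halfline a) (b0 : on_halfline b).
Hypotheses (am : finite_moments a) (bm : finite_moments b).
Hypothesis ab : same_moments a b.
Hypothesis gint : forall f : R -> R, (integ g f <-> integ a f /\ integ b f).
Hypothesis gE : forall f : R -> R, integ a f -> integ b f ->
  \int[g]_x f x = \int[a]_x f x + \int[b]_x f x.
Hypothesis gsum : forall A, g A = (a A + b A)%E.
Hypothesis neq : exists2 A, measurable A & a A <> b A.

Let u (t : R) := (1 + `|t|)^-1.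

Let mu : measurable_fun setT u.
Proof.
have m1 : measurable_fun setT (fun t : R => 1 + `|t|).
  by apply: measurable_funD => //; exact: normr_measurable.
exact: (measurableT_comp (@measurable_Rinv R) m1).
Qed.

Let u01 t : 0 <= u t <= 1.
Proof.
by rewrite invr_ge0 addr_ge0//= invf_le1 ?lerDl// ltr_wpDr.
Qed.

Let uX01 k t : 0 <= u t ^+ k <= 1.
Proof. by have /andP[h1 h2] := u01 t; rewrite exprn_ge0//= exprn_ile1. Qed.

Let mqu (q : {poly R}) k : measurable_fun setT (fun t => q.[t] * u t ^+ k).
Proof.
apply: measurable_funM; first exact: measurable_horner.
exact: measurable_funX.
Qed.

Let iqu m (q : {poly R}) k : finite_moments m -> integ m (fun t => q.[t] * u t ^+ k).
Proof.
move=> mm; apply: (integ_le (mqu q k) (integ_abs (mm q))) => t.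
have /andP[h1 h2] := uX01 k t.
by rewrite normrM (ger0_norm h1) ler_piMr.
Qed.

Let D (f : R -> R) := \int[a]_t f t - \int[b]_t f t.

Let D_eq (f1 f2 : R -> R) : measurable_fun setT f1 -> measurable_fun setT f2 ->
  (forall t, 0 <= t -> f1 t = f2 t) -> D f1 = D f2.
Proof.
move=> m1 m2 e; rewrite /D (halfline_Rint a0 m1 m2 e).2.
by rewrite (halfline_Rint b0 m1 m2 e).2.
Qed.

Let I n := D (fun t => u t ^+ n).

Let I_neq0 : exists n, I n != 0.
Proof.
have [A mA nab] := neq.
apply: contrapT => /forallNP h; apply: nab.
apply: (inv1D_unique a0 b0 (finite_moments_lty am) (finite_moments_lty bm)) => // n.
by apply/eqP; rewrite -subr_eq0; apply/negPn/negP; exact: h.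
Qed.

(** The difference D of [a] and [b] kills polynomials, while some power of u detects that [a] and
    [b] differ. With the least such power all lower terms of a division by t + 1 vanish. *)
Let n0 := ex_minn I_neq0.

Let n0_neq0 : I n0 != 0.
Proof. by rewrite /n0; case: ex_minnP. Qed.

Let lt_n0 n : (n < n0)%N -> I n = 0.
Proof.
rewrite /n0; case: ex_minnP => k _ h nk; apply/eqP/negPn/negP => /h.
by rewrite leqNgt nk.
Qed.

(** Division with remainder by t + 1: since (1 + t) u(t) = 1 on the half-line, the quotient meets
    one power of u less. *)
Let D_split (q : {poly R}) k : exists q1 : {poly R},
  D (fun t => q.[t] * u t ^+ k.+1) = q.[-1] * I k.+1 + D (fun t => q1.[t] * u t ^+ k).
Proof.
have /factor_theorem[q1 q1E] : root (q - (q.[-1])%:P) (-1).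
  by rewrite /root !hornerE subrr.
exists q1.
have qE t : q.[t] = q.[-1] + q1.[t] * (1 + t).
  have : (q - (q.[-1])%:P).[t] = (q1 * ('X - (-1)%:P)).[t] by rewrite q1E.
  rewrite !hornerE => h.
  have -> : 1 + t = t - -1 by rewrite opprK addrC.
  by rewrite -h addrC subrK.
have iu m k' : finite_moments m -> integ m (fun t => u t ^+ k').
  move=> mm; have := iqu 1 k' mm; under eq_fun do rewrite hornerC mul1r.
  exact.
rewrite (@D_eq _ (fun t => q.[-1] * u t ^+ k.+1 + q1.[t] * u t ^+ k)).
- rewrite /D !RintD//; [|by apply: integZ; exact: iu|exact: iqu
    |by apply: integZ; exact: iu|exact: iqu].
  by rewrite !RintZ; [rewrite /I /D; lra|exact: iu|exact: iu].
- exact: mqu.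
- apply: measurable_funD; last exact: mqu.
  by apply: measurable_funM => //; exact: measurable_funX.
- move=> t t0; rewrite {1}qE mulrDl; congr (_ + _).
  rewrite exprS mulrA; congr (_ * _).
  by rewrite -mulrA /u ger0_norm// mulfV ?mulr1// gt_eqF// ltr_wpDr.
Qed.

Let D_lt (q : {poly R}) k : (k < n0)%N -> D (fun t => q.[t] * u t ^+ k) = 0.
Proof.
elim: k q => [|k IH] q kn.
  rewrite (@D_eq _ (horner q) (mqu q 0) (measurable_horner q)).
    by rewrite /D ab subrr.
  by move=> t _; rewrite expr0 mulr1.
have [q1 ->] := D_split q k.
by rewrite IH ?(ltnW kn)// lt_n0// mulr0 addr0.
Qed.

Let n0_gt0 : (0 < n0)%N.
Proof.
rewrite lt0n; apply/eqP => n00; have := n0_neq0; rewrite n00 /I.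
have -> : D (fun t => u t ^+ 0) = D (horner 1).
  by congr D; apply/funext => t; rewrite hornerC.
by rewrite /D ab subrr eqxx.
Qed.

(** The extra factor t costs only a sign at -1; in absolute value it combines with one power of u
    into t/(1 + t). *)
Let D_n0 (q : {poly R}) : D (fun t => q.[t] * t * u t ^+ n0) = - q.[-1] * I n0.
Proof.
have h0 : D (fun t => q.[t] * t * u t ^+ n0) = D (fun t => (q * 'X).[t] * u t ^+ n0).
  by congr D; apply/funext => t; rewrite hornerMX.
have [q1 h1] := D_split (q * 'X) n0.-1; rewrite prednK// in h1.
by rewrite h0 h1 D_lt ?prednK// addr0 hornerMX mulrN1.
Qed.

(** The values of D bound q(-1) by an L^1-norm over all of [0, +oo), in which the weight |t|/(1 +
    |t|) vanishes at 0. A neighbourhood of 0 therefore contributes little, and its contribution can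
    later be absorbed. *)
Lemma evaluation_bound : exists2 C, 0 < C & forall (q : {poly R}) x, `|x| <= 1 ->
  `|q.[x]| <= C * \int[g]_t (`|q.[t]| * (`|t| / (1 + `|t|))).
Proof.
exists `|I n0|^-1; first by rewrite invr_gt0 normr_gt0.
have mk : measurable_fun setT (fun t : R => `|t| * u t).
  by apply: measurable_funM => //; exact: normr_measurable.
have k01 (t : R) : 0 <= `|t| * u t <= 1.
  rewrite mulr_ge0//=; last by case/andP: (u01 t).
  by rewrite /u ler_pdivrMr ?mul1r ?lerDr// ltr_wpDr.
have mqk (q : {poly R}) : measurable_fun setT (fun t : R => `|q.[t]| * (`|t| * u t)).
  apply: measurable_funM => //; apply: (measurableT_comp (@normr_measurable R setT)).
  exact: measurable_horner.
have iqk m (q : {poly R}) : finite_moments m -> integ m (fun t => `|q.[t]| * (`|t| * u t)).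
  move=> mm; apply: (integ_le (mqk q) (integ_abs (mm q))) => t.
  have /andP[h1 h2] := k01 t.
  by rewrite normrM normr_id (ger0_norm h1) ler_piMr.
have gm : finite_moments g by move=> q; apply/gint; split.
have main (q : {poly R}) : `|q.[-1]| <= `|I n0|^-1 * \int[g]_t (`|q.[t]| * (`|t| * u t)).
  rewrite ler_pdivlMl ?normr_gt0// mulrC -normrM -[X in X <= _]normrN -mulNr -D_n0.
  have le m : finite_moments m ->
      `|\int[m]_t (q.[t] * t * u t ^+ n0)| <= \int[m]_t (`|q.[t]| * (`|t| * u t)).
    move=> mm; have i1 : integ m (fun t => q.[t] * t * u t ^+ n0).
      by have := iqu (q * 'X) n0 mm; under eq_fun do rewrite hornerMX.
    apply: le_trans (Rint_abs i1) _; apply: Rint_le => //.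
    - exact: integ_abs.
    - exact: iqk.
    move=> t; rewrite !normrM -mulrA ler_wpM2l// ler_wpM2l//.
    have /andP[h1 h2] := u01 t.
    rewrite normrX (ger0_norm h1) -(prednK n0_gt0) exprS ler_piMr//.
    by rewrite exprn_ile1.
  apply: le_trans (ler_normB _ _) _.
  rewrite gE; [|exact: iqk|exact: iqk].
  by apply: lerD; exact: le.
(* From -1 to x: the polynomial with roots |z| is at least as large at -1 as [q] at x, and at most
   as large as [q] on the half-line. The cut-off [f] restricts the comparison to t >= 0. *)
move=> q x x1; have [p [pq qp]] := poly_abs_roots q.
apply: le_trans (qp x x1) _; apply: le_trans (main p) _.
rewrite ler_pM2l ?invr_gt0 ?normr_gt0//.
have g0 : on_halfline g by rewrite /on_halfline gsum a0 b0 adde0.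
pose f t := if 0 <= t then `|p.[t]| * (`|t| * u t) else 0.
have mf : measurable_fun setT f.
  apply: measurable_fun_ifT => //.
  exact: measurable_fun_ler.
have fE t : 0 <= t -> `|p.[t]| * (`|t| * u t) = f t by rewrite /f => ->.
have [i1 ->] := halfline_Rint g0 (mqk p) mf fE.
apply: Rint_le; [exact/i1/iqk|exact: iqk|move=> t].
have /andP[h1 h2] := k01 t.
rewrite /f; case: ifPn => t0; last by rewrite mulr_ge0.
by rewrite ler_wpM2r// pq.
Qed.

End evaluation_bound.

(** * Solutions of a Stieltjes problem away from the origin *)

Section separated_solution.
Context (R : realType).
Implicit Types a b m : {measure set R -> \bar R}.

Lemma ray_right m (x e : R) : (m setT < +oo)%E -> 0 < e ->
  exists2 r, 0 < r & forall s, s <= x + r ->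
    fine (m `]-oo, s]%classic) <= fine (m `]-oo, x]%classic) + e.
Proof.
move=> moo e0.
pose F n : set R := `]-oo, x + n.+1%:R^-1]%classic.
have mF n : measurable (F n) by exact: measurable_itv.
have fin y : m `]-oo, y]%classic \is a fin_num.
  rewrite ge0_fin_numE//; apply: le_lt_trans moo; apply: le_measure; rewrite ?inE//.
have capF : \bigcap_n F n = `]-oo, x]%classic.
  apply/seteqP; split => y /=; rewrite in_itv/=.
    move=> h; rewrite leNgt; apply/negP; rewrite -subr_gt0 => x0.
    have := h (Num.trunc (y - x)^-1) I; rewrite /F/= in_itv/= -lerBlDl leNgt => /negP; apply.
    by rewrite invf_plt ?posrE//; exact: truncnS_gt.
  by move=> x0 n _; rewrite /F/= in_itv/= (le_trans x0)// lerDl.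
have nd : nonincreasing_seq F.
  move=> i j ij; rewrite subsetEset => y /=; rewrite /F/= !in_itv/= => /le_trans; apply.
  by rewrite lerD2l lef_pV2 ?posrE// ler_nat.
have := @nonincreasing_cvg_mu _ _ R m F _ mF _ nd.
rewrite capF -ge0_fin_numE// => /(_ (fin _) (measurable_itv _)).
rewrite -(fineK (fin x)) => /fine_cvg.
have xe : fine (m `]-oo, x]%classic) < fine (m `]-oo, x]%classic) + e by rewrite ltrDl.
move=> /cvgr_lt/(_ _ xe)[N _ /(_ N (leqnn _))/= h].
exists N.+1%:R^-1 => // s sN; apply: le_trans (ltW h).
apply: fine_le => //; first exact: fin.
apply: le_measure; rewrite ?inE// => y /=; rewrite /F/= !in_itv/= => /le_trans; exact.
Qed.

Lemma ray_small m (e : R) : (m setT < +oo)%E -> m `]-oo, 0]%classic = 0%E -> 0 < e ->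
  exists2 r, 0 < r & forall s, s <= r -> fine (m `]-oo, s]%classic) <= e.
Proof.
move=> moo m0 e0; have [r r0 h] := ray_right 0 moo e0.
by exists r => // s; have := h s; rewrite m0 !add0r.
Qed.

(* The point mass eps at x is split off: q |-> int q da - eps q(x) is dominated
   by the integral of the positive part of q over ]delta, +oo[. *)
Lemma separated_solution a b :
  a `]-oo, 0]%classic = 0%E -> b `]-oo, 0]%classic = 0%E ->
  finite_moments a -> finite_moments b -> same_moments a b ->
  (exists2 A, measurable A & a A <> b A) ->
  exists delta eps : R, [/\ 0 < delta, 0 < eps & forall x, 0 < x <= delta ->
    exists n : {measure set R -> \bar R},
    [/\ n `]-oo, delta]%classic = 0%E, finite_moments n &
        forall q : {poly R}, eps * q.[x] + \int[n]_t q.[t] = \int[a]_t q.[t]]].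
Proof.
move=> a0 b0 am bm ab neq.
have hl m : m `]-oo, 0]%classic = 0%E -> on_halfline m.
  move=> m0; apply/eqP; rewrite eq_le measure_ge0 andbT -m0.
  by apply: le_measure; rewrite ?inE// => z /=; rewrite !in_itv/= => /ltW.
have [g [gsum _ gint gE]] := measure_sum a b.
have [C C0 evb] := evaluation_bound (hl _ a0) (hl _ b0) am bm ab gint gE gsum neq.
have gm : finite_moments g by move=> q; apply/gint; split.
have goo := finite_moments_lty gm.
have g0 : g `]-oo, 0]%classic = 0%E by rewrite gsum a0 b0 adde0.
pose G := fine (g setT).
have G0 : 0 <= G by exact: fine_ge0.
have e4 : 0 < (4 * C)^-1 by rewrite invr_gt0 mulr_gt0.
have [r r0 rle] := ray_small goo g0 e4.
(* Three demands on [delta]: at most [r], so that the mass of [g] on ]-oo, delta] is at most 1/(4C);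
   at most 1, for [evb]; and C delta G <= 1/2, for the absorption below. *)
pose delta := Num.min r (Num.min 1 (2 * C * (G + 1))^-1).
have CG : 0 < 2 * C * (G + 1) by rewrite !mulr_gt0// ltr_wpDl.
have d0 : 0 < delta by rewrite !lt_min r0 ltr01 invr_gt0.
have d1 : delta <= 1 by rewrite /delta !ge_min lexx orbT.
have dr : delta <= r by rewrite /delta ge_min lexx.
have dC : C * delta * G <= 2^-1.
  have h : delta * (2 * C * (G + 1)) <= 1.
    by rewrite -ler_pdivlMr// mul1r /delta !ge_min lexx !orbT.
  have : 0 <= delta * C by rewrite mulr_ge0// ltW.
  by clear -h; lra.
pose w (t : R) : R := (delta < t)%R%:R.
have mw : measurable_fun setT w.
  rewrite (_ : w = fun t => if delta < t then 1 else 0); last first.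
    by apply/funext => t; rewrite /w; case: ifP.
  by apply: measurable_fun_ifT => //; exact: measurable_fun_ltr.
have w0 t : 0 <= w t by [].
have [gd [gdE gdint gdR]] := weighted_pushforward_real g mw w0 (@measurable_id _ R setT).
have iw (f : R -> R) : integ g f -> integ g (fun t => w t * f t).
  move=> i; apply: (integ_le _ (integ_abs i)).
    by apply: measurable_funM => //; exact: integ_meas i.
  by move=> t; rewrite normrM /w; case: ltP => _; rewrite ?normr1 ?mul1r// normr0 mul0r.
(* Absorption: let S be the supremum of |q| on [0, delta]. As t/(1 + t) is at most [delta] there and
   at most 1 elsewhere, [evb] gives S <= S/2 + C J; S is finite, so S <= 2 C J and only the mass
   beyond [delta] remains. *)
have J (q : {poly R}) x : 0 <= x <= delta ->
    `|q.[x]| <= 2 * C * \int[g]_t (w t * `|q.[t]|).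
  pose E := [set `|q.[x]| | x in `[0, delta]%classic].
  pose B := \sum_(i < size q) `|q`_i|.
  have EB : ubound E B.
    move=> _ [y + <-]; rewrite /= in_itv/= => /andP[y0 yd].
    rewrite horner_coef (le_trans (ler_norm_sum _ _ _))//.
    apply: ler_sum => i _; rewrite normrM ler_piMr// normrX exprn_ile1//.
    by rewrite ger0_norm// (le_trans yd).
  have E0 : E !=set0 by exists `|q.[0]|, 0 => //=; rewrite in_itv/= lexx ltW.
  have hE : has_sup E by split => //; exists B.
  pose S := sup E.
  have leS y : 0 <= y <= delta -> `|q.[y]| <= S.
    by move=> yd; apply: ub_le_sup; [exists B|exists y => //=; rewrite in_itv].
  have S0 : 0 <= S by apply: le_trans (leS 0 _) => //; rewrite lexx ltW.
  set J := \int[g]_t _.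
  have iq : integ g (fun t => w t * `|q.[t]|) by apply: iw; exact: integ_abs (gm q).
  have Sle y : 0 <= y <= delta -> `|q.[y]| <= S / 2 + C * J.
    move=> /andP[y0 yd]; apply: le_trans (evb q y _) _.
      by rewrite ger0_norm// (le_trans yd).
    have -> : S / 2 + C * J = C * (S / (2 * C) + J).
      by rewrite mulrDr; congr (_ + _); field; rewrite gt_eqF.
    rewrite ler_pM2l//.
    pose f t := if 0 <= t then `|q.[t]| * (`|t| / (1 + `|t|)) else 0.
    have mk : measurable_fun setT (fun t : R => `|q.[t]| * (`|t| / (1 + `|t|))).
      apply: measurable_funM.
        apply: (measurableT_comp (@normr_measurable R setT)).
        exact: measurable_horner.
      apply: measurable_funM; first exact: normr_measurable.
      have m1 : measurable_fun setT (fun t : R => 1 + `|t|).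
        by apply: measurable_funD => //; exact: normr_measurable.
      exact: (measurableT_comp (@measurable_Rinv R) m1).
    have mf : measurable_fun setT f.
      by apply: measurable_fun_ifT => //; exact: measurable_fun_ler.
    have fE t : 0 <= t -> `|q.[t]| * (`|t| / (1 + `|t|)) = f t by rewrite /f => ->.
    rewrite (halfline_Rint (hl _ g0) mk mf fE).2.
    have fle t : `|f t| <= S * delta + w t * `|q.[t]|.
      have Sd : 0 <= S * delta by rewrite mulr_ge0// ltW.
      rewrite /f; case: ifPn => t0; last by rewrite normr0 addr_ge0// mulr_ge0.
      have p1 : 0 < 1 + `|t| by rewrite ltr_wpDr.
      have k0 : 0 <= `|t| / (1 + `|t|) by rewrite divr_ge0// ltW.
      rewrite ger0_norm ?mulr_ge0// /w; case: ltP => td /=.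
        rewrite mul1r ler_wpDl// ler_piMr// ler_pdivrMr// mul1r lerDr//.
      rewrite mul0r addr0; apply: ler_pM => //.
        by apply: leS; rewrite t0.
      rewrite ler_pdivrMr// (ger0_norm t0) mulrDr mulr1.
      by rewrite (le_trans td)// lerDl mulr_ge0// ltW.
    have ic : integ g (fun=> S * delta).
      by apply: (@integ_bounded _ _ _ g _ `|S * delta|).
    have ib := integD ic iq.
    apply: (@le_trans _ _ (\int[g]_t (S * delta + w t * `|q.[t]|))).
      apply: Rint_le => //; first exact: integ_le fle.
      by move=> t; apply: le_trans (fle t); exact: ler_norm.
    rewrite RintD// -/J lerD2r Rintegral_cst// -/G.
    rewrite -mulrA ler_wpM2l// invfM [2^-1 * _]mulrC ler_pdivlMl// mulrA.
    exact: dC.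
  move=> xd; apply: le_trans (leS x xd) _.
  have : S <= S / 2 + C * J.
    by apply: ge_sup => // _ [y + <-]; rewrite /= in_itv/= => yd; exact: Sle.
  by clear; lra.
exists delta, (8 * C)^-1; split => //; first by rewrite invr_gt0 mulr_gt0.
move=> x /andP[x0 xd].
have ijw (q : {poly R}) : integ gd (horner q).
  by apply/gdint; [exact: measurable_horner|exact: iw (gm q)].
pose f (q : {poly R}) := 2^-1 * \int[g]_t q.[t] - (8 * C)^-1 * q.[x].
(* The integral of q for [a] is half of that for [g]. The mass below [delta] and the point mass at x
   each cost at most J0/4, and half of int w q plus half of J0 is the integral of the positive part
   of q beyond [delta]. This dictates the constants 1/(4C) and 1/(8C). *)
have fle q : f q <= \int[gd]_t Num.max q.[t] 0.
  rewrite gdR; last by apply: measurable_maxr => //; exact: measurable_horner.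
  pose v (t : R) : R := (t <= delta)%R%:R.
  have vE t : v t = 1 - w t by rewrite /v /w leNgt; case: ltP; rewrite ?subrr ?subr0.
  have iv (h : R -> R) : integ g h -> integ g (fun t => v t * h t).
    move=> i; under eq_fun do rewrite vE mulrBl mul1r.
    by apply: integB => //; exact: iw.
  have ig1 : integ g (fun=> 1) by apply: (@integ_bounded _ _ _ g _ 1) => // t; rewrite normr1.
  pose J0 := \int[g]_t (w t * `|q.[t]|).
  have vG : \int[g]_t v t <= (4 * C)^-1.
    apply: le_trans (rle delta dr).
    rewrite -lee_fin -Rint_indic//.
    rewrite lee_fin le_eqVlt; apply/orP; left; apply/eqP; apply: eq_Rintegral => t _.
    by rewrite /v indicE mem_setE in_itv.
  have near : \int[g]_t (v t * q.[t]) <= (4 * C)^-1 * (2 * C * J0).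
    have J00 : 0 <= 2 * C * J0.
      by apply: le_trans (normr_ge0 q.[delta]) _; apply: J; rewrite lexx ltW.
    apply: (@le_trans _ _ (\int[g]_t ((2 * C * J0) * v t))).
      pose f1 t := if 0 <= t then v t * q.[t] else 0.
      have m1 : measurable_fun setT (fun t => v t * q.[t]) by exact: integ_meas (iv _ (gm q)).
      have mf1 : measurable_fun setT f1.
        by apply: measurable_fun_ifT => //; exact: measurable_fun_ler.
      have e1 t : 0 <= t -> v t * q.[t] = f1 t by rewrite /f1 => ->.
      have [i1 ->] := halfline_Rint (hl _ g0) m1 mf1 e1.
      apply: Rint_le.
      - by apply/i1/iv; exact: gm.
      - by apply: integZ; have := iv _ ig1; under eq_fun do rewrite mulr1.
      - move=> t; rewrite /f1 /v; case: (leP 0 t) => t0; last by rewrite mulr_ge0.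
        case: (leP t delta) => td; rewrite ?mul1r ?mulr1 ?mul0r ?mulr0//.
        by apply: le_trans (ler_norm _) _; apply: J; rewrite t0.
    rewrite RintZ; last by have := iv _ ig1; under eq_fun do rewrite mulr1.
    by rewrite mulrC ler_wpM2r.
  have split : \int[g]_t q.[t] = \int[g]_t (w t * q.[t]) + \int[g]_t (v t * q.[t]).
    rewrite -RintD; [|exact: iw (gm q)|exact: iv (gm q)].
    by apply: eq_Rintegral => t _; rewrite vE -mulrDl addrC subrK mul1r.
  have qx : - q.[x] <= 2 * C * J0.
    by apply: le_trans (J q x _); rewrite ?(ltW x0)// -normrN ler_norm.
  have maxE : \int[g]_t (w t * Num.max q.[t] 0) =
      2^-1 * (\int[g]_t (w t * q.[t]) + J0).
    have iwq := iw _ (gm q); have iwa := iw _ (integ_abs (gm q)).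
    rewrite -RintD// -RintZ; last exact: integD.
    apply: eq_Rintegral => t _; rewrite -mulrDr mulrCA; congr (_ * _).
    case: (leP 0 q.[t]) => q0.
      by rewrite ger0_norm//; clear; lra.
    by rewrite ltr0_norm// subrr mulr0.
  rewrite maxE /f split.
  have c1 : (4 * C)^-1 * (2 * C * J0) = 2^-1 * J0 by field; rewrite gt_eqF.
  have c2 : (8 * C)^-1 * (2 * C * J0) = 4^-1 * J0 by field; rewrite gt_eqF.
  have : (8 * C)^-1 * (- q.[x]) <= (8 * C)^-1 * (2 * C * J0).
    by rewrite ler_pM2l// invr_gt0 mulr_gt0.
  by rewrite c2; move: near; rewrite c1; clear; lra.
have [|||||L [LD LZ Lle LE]] := @hahn_banach_integral _ R R gd {poly R}
  (fun q => horner q) f ijw.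
- by move=> p q t; rewrite hornerD.
- by move=> c q t; rewrite hornerZ.
- move=> p q; rewrite /f hornerD.
  under eq_Rintegral do rewrite hornerD.
  by rewrite RintD; [ring|exact: gm|exact: gm].
- move=> c q; rewrite /f hornerZ.
  under eq_Rintegral do rewrite hornerZ.
  by rewrite RintZ; [ring|exact: gm].
- exact: fle.
have gdoo := finite_moments_lty ijw.
have [n [nle nint]] := functional_measure gdoo LD LZ Lle.
exists n; split.
- apply/eqP; rewrite eq_le measure_ge0 andbT.
  apply: le_trans (nle _ _) _; first exact: measurable_itv.
  have -> : gd `]-oo, delta]%classic = (\int[gd]_t (\1_(`]-oo, delta]%classic) t)%:E)%E.
    by rewrite integral_indic// setIT.
  rewrite gdE; [|exact/measurable_EFinP|by move=> t; rewrite lee_fin].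
  rewrite integral0_eq// => t _; rewrite -EFinM /w indicE mem_setE in_itv/=.
  by case: ltP => _; rewrite ?mulr0 ?mul0r.
- by move=> q; exact: (nint _ (ijw q)).1.
- move=> q; rewrite (nint _ (ijw q)).2 LE /f gE ?ab; [|exact: am|exact: bm].
  by rewrite /f; clear; lra.
Qed.
End separated_solution.

Section point_mass.
Context d (T : measurableType d) (R : realType).

Lemma point_mass (x : T) (e : R) : 0 <= e ->
  exists m : {measure set T -> \bar R},
    (forall A, measurable A -> m A = (e * \1_A x)%:E) /\
    forall f : T -> R, measurable_fun setT f -> integ m f /\ \int[m]_t f t = e * f x.
Proof.
move=> e0.
have [m [mE mi mR]] := weighted_pushforward_real (\d_x : {measure set T -> \bar R})
  (measurable_cst e) (fun _ => e0) (@measurable_id _ T setT).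
exists m; split.
  move=> A mA; rewrite -[m A]/(m A) -[A in m A]setIT -integral_indic//.
  rewrite mE; [|exact/measurable_EFinP|by move=> y; rewrite lee_fin].
  rewrite integral_dirac ?diracT ?mul1e//.
  by apply/measurable_EFinP; apply: measurable_funM.
move=> f mf; split; last first.
  rewrite mR// /Rintegral integral_dirac ?diracT ?mul1e//.
  by apply/measurable_EFinP; apply: measurable_funM.
apply/mi => //; apply/integrableP; split.
  by apply/measurable_EFinP; apply: measurable_funM.
rewrite integral_dirac ?diracT ?mul1e ?ltry//.
apply: measurableT_comp => //.
by apply/measurable_EFinP; apply: measurable_funM.
Qed.

End point_mass.

Section indeterminate.
Context (R : realType).
Implicit Types a b m : {measure set R -> \bar R}.

(** A solution with an atom split off at x might be [a] itself, but those built at two different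
    points have different atoms, so at least one of them differs from [a]. *)
Lemma separated_indeterminate_noatom a b :
  a `]-oo, 0]%classic = 0%E -> b `]-oo, 0]%classic = 0%E ->
  finite_moments a -> finite_moments b -> same_moments a b ->
  (exists2 A, measurable A & a A <> b A) ->
  exists (delta : R) m, [/\ 0 < delta, m `]-oo, delta]%classic = 0%E,
    finite_moments m, same_moments a m & exists2 A, measurable A & a A <> m A].
Proof.
move=> a0 b0 am bm ab neq.
have [delta [eps [d0 e0 h]]] := separated_solution a0 b0 am bm ab neq.
have sol x : 0 < x <= delta -> exists m, [/\ m `]-oo, x / 2]%classic = 0%E,
    finite_moments m, same_moments a m, m [set x] = eps%:E &
    forall y, y <= delta -> y != x -> m [set y] = 0%E].
  move=> xd; have /andP[x0 xd'] := xd; have [n [n0 nm nE]] := h x xd.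
  have [p [pE pR]] := point_mass x (ltW e0).
  have [m [mA _ mi mR]] := measure_sum p n.
  have pm : finite_moments p by move=> q; apply: (pR _ _).1; exact: measurable_horner.
  have n0' A : measurable A -> A `<=` `]-oo, delta]%classic -> n A = 0%E.
    by move=> mA' Ad; apply: le_measure0 Ad n0.
  exists m; split.
  - rewrite mA pE// n0'//; last first.
      by move=> z /=; rewrite !in_itv/=; lra.
    rewrite indicE mem_setE in_itv/= (_ : (x <= x / 2) = false) ?mulr0 ?adde0//.
    by apply/negP; lra.
  - by move=> q; apply/mi; split; [exact: pm|exact: nm].
  - move=> q; rewrite mR; [|exact: pm|exact: nm].
    by rewrite (pR _ (measurable_horner q)).2 nE.
  - rewrite mA pE// n0'//; last by move=> z -> /=; rewrite in_itv.
    by rewrite indicE mem_set// mulr1 adde0.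
  - move=> y yd yx; rewrite mA pE// n0'//; last by move=> z -> /=; rewrite in_itv.
    rewrite indicE memNset ?mulr0 ?adde0// => /= xy.
    by rewrite xy eqxx in yx.
have [|m1 [m10 m1m m1E m1x m1y]] := sol delta; first by rewrite d0 lexx.
have [|m2 [m20 m2m m2E m2x m2y]] := sol (delta / 2); first lra.
have [h1|h1] := pselect (exists2 A, measurable A & a A <> m1 A).
  by exists (delta / 2), m1; split => //; lra.
have [h2|h2] := pselect (exists2 A, measurable A & a A <> m2 A).
  by exists (delta / 2 / 2), m2; split => //; lra.
have e1 A : measurable A -> a A = m1 A.
  by move=> mA; apply: contrapT => neqA; apply: h1; exists A.
have e2 A : measurable A -> a A = m2 A.
  by move=> mA; apply: contrapT => neqA; apply: h2; exists A.
have := e1 [set delta] (measurable_set1 _); rewrite e2// m1x m2y//.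
  by move=> [] /esym/eqP; rewrite gt_eqF.
by rewrite gt_eqF//; lra.
Qed.

Lemma weighted_measure a (w : R -> R) : finite_moments a ->
  measurable_fun setT w -> (forall t, 0 <= w t) ->
  exists m, (forall A, measurable A -> m A = \int[a]_t ((w t)%:E * (\1_A t)%:E))%E /\
   forall f : R -> R, measurable_fun setT f ->
    (integ m f <-> integ a (fun t => w t * f t)) /\
    \int[m]_t f t = \int[a]_t (w t * f t).
Proof.
move=> am mw w0.
have [m [mE mi mR]] := weighted_pushforward_real a mw w0 (@measurable_id _ R setT).
exists m; split => [A mA|f mf]; last by split; [exact: mi|exact: mR].
rewrite -[A in m A]setIT -integral_indic//.
by rewrite mE; [|exact/measurable_EFinP|by move=> y; rewrite lee_fin].
Qed.

End indeterminate.

Section remove_atom.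
Context (R : realType).
Implicit Types a b m : {measure set R -> \bar R}.

Lemma halfline_integral0 m (f : R -> R) : on_halfline m -> measurable_fun setT f ->
  (forall t, 0 <= t -> f t = 0) -> (\int[m]_t (f t)%:E = 0)%E.
Proof.
move=> m0 mf f0; rewrite -(integral0 m setT).
apply: ae_eq_integral => //; first exact/measurable_EFinP.
exists `]-oo, 0[%classic; split => // t /= /not_implyP[_ h].
by rewrite in_itv/= ltNge; apply/negP => /f0 ft; apply: h; rewrite ft.
Qed.

Lemma finite_indic0 m A : (m setT < +oo)%E -> measurable A ->
  \int[m]_t (\1_A t : R) = 0 -> m A = 0%E.
Proof.
move=> moo mA; have := Rint_indic m mA => + h; rewrite h fineK ?fin_num_lty//.
Qed.

(* The solutions theta_x of the problem of t a with an atom at a small x make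
   the mass of theta_x / t exceed that of a, so a convex combination of
   theta_x / t and of b restricted to ]0, +oo[ has the right mass. *)
Lemma remove_atom a b :
  a `]-oo, 0]%classic = 0%E -> on_halfline b ->
  finite_moments a -> finite_moments b -> same_moments a b ->
  (exists2 A, measurable A & a A <> b A) ->
  exists m, [/\ m `]-oo, 0]%classic = 0%E, finite_moments m, same_moments a m &
    exists2 A, measurable A & a A <> m A].
Proof.
move=> a0 b0 am bm ab neq.
have [bz|bz] := eqVneq (b `]-oo, 0]%classic) 0%E; first by exists b.
have aoo := finite_moments_lty am; have boo := finite_moments_lty bm.
have ah : on_halfline a.
  by apply: le_measure0 a0 => // z /=; rewrite !in_itv/= => /ltW.
have mabs : measurable_fun setT (fun t : R => `|t|) by exact: normr_measurable.
have mX (q : {poly R}) : measurable_fun setT (fun t : R => `|t| * q.[t]).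
  by apply: measurable_funM => //; exact: measurable_horner.
have mmax (f : R -> R) (x c : R) : measurable_fun setT f ->
    measurable_fun setT (fun t : R => if x < t then f t else c).
  by move=> mf; apply: measurable_fun_ifT => //; exact: measurable_fun_ltr.
have [w [wP w0 mw]] : exists w : R -> R, [/\ w = (fun t => if 0 < t then 1 else 0),
    forall t, 0 <= w t & measurable_fun setT w].
  exists (fun t => if 0 < t then 1 else 0); split => //.
    by move=> t; case: ifP.
  exact: mmax.
have [bp [bpA bpR]] := weighted_measure bm mw w0.
have bpm : finite_moments bp.
  move=> q; apply/(bpR _ (measurable_horner q)).1.
  apply: (integ_le _ (integ_abs (bm q))).
    by apply: measurable_funM => //; exact: measurable_horner.
  by move=> t; rewrite normrM wP; case: ifP => _; rewrite ?normr1 ?mul1r// normr0 mul0r.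
have bp0 : bp `]-oo, 0]%classic = 0%E.
  rewrite bpA// integral0_eq// => t _; rewrite -EFinM wP indicE mem_setE in_itv/=.
  by case: ltP => _; rewrite ?mulr0 ?mul0r.
have bmass1 : \int[bp]_t (1 : R) = \int[b]_t w t.
  by rewrite (bpR _ (measurable_cst _)).2; apply: eq_Rintegral => t _; rewrite mulr1.
pose a_0 := \int[a]_t (1 : R); pose b_0 := \int[bp]_t (1 : R).
have mass1 m : finite_moments m -> integ m (fun=> 1).
  move=> mm; rewrite (_ : (fun=> 1) = horner (1 : {poly R}))//.
  by apply/funext => t; rewrite hornerC.
have a_00 : 0 <= a_0 by exact: Rint_ge0.
have ab1 : a_0 = \int[b]_t (1 : R).
  have := ab 1; under eq_Rintegral do rewrite hornerC.
  by under [X in _ = X]eq_Rintegral do rewrite hornerC.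
(* Dropping the atom of [b] at 0 loses mass and leaves the moments of positive order unchanged; this
   deficit has to be compensated by a surplus. *)
have b_0lt : b_0 < a_0.
  rewrite -subr_gt0 ab1 /b_0 bmass1.
  have iw : integ b w.
    have := (bpR _ (measurable_cst (1 : R))).1.1 (mass1 _ bpm).
    by under eq_fun do rewrite mulr1.
  rewrite -RintB//; last exact: mass1.
  rewrite (@eq_Rintegral _ _ _ b setT (\1_(`]-oo, 0]%classic))); last first.
    move=> t _; rewrite wP indicE mem_setE in_itv/=.
    by case: ltP => _; rewrite ?subrr ?subr0.
  rewrite -lte_fin Rint_indic// lte_fin fine_gt0// lt0e bz measure_ge0/=.
  by apply: le_lt_trans boo; apply: le_measure; rewrite ?inE.
have bpX (q : {poly R}) : \int[bp]_t (q * 'X).[t] = \int[b]_t (q * 'X).[t].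
  rewrite (bpR _ (measurable_horner _)).2.
  apply: (halfline_Rint b0 _ _ _).2.
  - by apply: measurable_funM => //; exact: measurable_horner.
  - exact: measurable_horner.
  move=> t t0; rewrite wP; case: ltP => t1; first by rewrite mul1r.
  by rewrite (_ : t = 0) ?hornerMX ?mulr0 ?mul0r//; apply/le_anti; rewrite t1.
have split_poly (q : {poly R}) : exists q1 : {poly R}, q = (q.[0])%:P + q1 * 'X.
  have /factor_theorem[q1 q1E] : root (q - (q.[0])%:P) 0.
    by rewrite /root !hornerE subrr.
  by exists q1; rewrite -[X in _ * X]subr0 -q1E addrC subrK.
have Rsplit m c (q1 : {poly R}) : finite_moments m ->
    \int[m]_t (c%:P + q1 * 'X).[t] = c * \int[m]_t (1 : R) + \int[m]_t (q1 * 'X).[t].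
  move=> mm; rewrite -RintZ; last exact: mass1.
  rewrite -RintD; [|by apply: integZ; exact: mass1|exact: mm].
  by apply: eq_Rintegral => t _; rewrite hornerD hornerC mulr1.
have abs0 (t : R) : 0 <= `|t| by [].
have [ta [taA taR]] := weighted_measure am mabs abs0.
have [tb [tbA tbR]] := weighted_measure bm mabs abs0.
have tint m (tm : {measure set R -> \bar R}) : finite_moments m -> on_halfline m ->
    (forall f : R -> R, measurable_fun setT f ->
      (integ tm f <-> integ m (fun t => `|t| * f t)) /\
      \int[tm]_t f t = \int[m]_t (`|t| * f t)) ->
    finite_moments tm /\ forall q : {poly R}, \int[tm]_t q.[t] = \int[m]_t (q * 'X).[t].
  move=> mm m0 mR; split => q.
    apply/(mR _ (measurable_horner q)).1.
    apply: (integ_le (mX q) (integ_abs (mm (q * 'X)))) => t.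
    by rewrite hornerMX !normrM normr_id mulrC.
  rewrite (mR _ (measurable_horner q)).2.
  apply: (halfline_Rint m0 _ _ _).2; [exact: mX|exact: measurable_horner|].
  by move=> t t0; rewrite hornerMX ger0_norm// mulrC.
have [tam taX] := tint a ta am ah taR.
have [tbm tbX] := tint b tb bm b0 tbR.
have t0E m (tm : {measure set R -> \bar R}) : on_halfline m ->
    (forall A, measurable A -> tm A = \int[m]_t ((`|t|)%:E * (\1_A t)%:E))%E ->
    tm `]-oo, 0]%classic = 0%E.
  move=> m0 tmA; rewrite tmA//.
  under eq_integral do rewrite -EFinM.
  apply: (halfline_integral0 m0); first exact: measurable_funM.
  move=> t t0; rewrite indicE mem_setE in_itv/=; case: leP => t1; last by rewrite mulr0.
  by rewrite (_ : t = 0) ?normr0 ?mul0r//; apply/le_anti; rewrite t1.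
have ta0 := t0E _ _ ah taA; have tb0 := t0E _ _ b0 tbA.
have tab : same_moments ta tb by move=> q; rewrite taX tbX ab.
(* The problem of t a is indeterminate as well: integrating 1/t over ]0, +oo[ against t a and t b
   returns the masses a_0 and b_0, which differ. *)
have tneq : exists2 A, measurable A & ta A <> tb A.
  apply: contrapT => nex.
  have e A : measurable A -> ta A = tb A.
    by move=> mA; apply: contrapT => neqA; apply: nex; exists A.
  pose f (t : R) := if 0 < t then t^-1 else 0.
  have mf : measurable_fun setT f by apply: mmax; exact: measurable_Rinv.
  have := eq_measure_Rintegral f e.
  rewrite (taR _ mf).2 (tbR _ mf).2.
  have fE t : `|t| * f t = w t.
    rewrite wP /f; case: ltP => t0; last by rewrite mulr0.
    by rewrite gtr0_norm// mulfV// gt_eqF.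
  under eq_Rintegral do rewrite fE.
  under [X in _ = X]eq_Rintegral do rewrite fE.
  rewrite -bmass1 -/b_0; apply/eqP; rewrite gt_eqF//.
  suff -> : \int[a]_t w t = a_0 by [].
  apply: (@ae_eq0_Rint _ _ _ a `]-oo, 0]%classic _ _ _ a0 mw (measurable_cst _) _).2 => // t.
  by rewrite /= in_itv/= => /negP; rewrite -ltNge wP => ->.
have [delta [eps [d0 e0 h]]] := separated_solution ta0 tb0 tam tbm tab tneq.
pose v (t : R) := if delta < t then t^-1 else 0.
have mv : measurable_fun setT v by apply: mmax; exact: measurable_Rinv.
have v0 t : 0 <= v t.
  by rewrite /v; case: ltP => // td; rewrite invr_ge0 ltW// (lt_trans d0).
have vle t : v t <= delta^-1.
  rewrite /v; case: ltP => td; last by rewrite invr_ge0 ltW.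
  by rewrite lef_pV2 ?posrE// ?ltW// (lt_trans d0).
(* An atom of mass eps at x <= X becomes eps/x >= a_0 + 1 after division by t, so the resulting mass
   exceeds a_0. *)
pose X := Num.min delta (eps / (a_0 + 1)).
have X0 : 0 < X by rewrite lt_min d0 divr_gt0// ltr_wpDl.
have sol x : 0 < x <= X -> exists (lam : R) m, [/\ 0 < lam < 1, m `]-oo, 0]%classic = 0%E,
    finite_moments m, same_moments a m &
    (forall y, y <= delta ->
      \int[m]_t (\1_[set y] t : R) =
      lam * (eps / x) * (y == x)%:R + (1 - lam) * \int[bp]_t (\1_[set y] t : R))].
  move=> /andP[x0 xX].
  have xd : x <= delta by apply: le_trans xX _; rewrite ge_min lexx.
  have xe : a_0 + 1 <= eps / x.
    rewrite ler_pdivlMr// mulrC -ler_pdivlMr ?ltr_wpDl//.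
    by apply: le_trans xX _; rewrite ge_min lexx orbT.
  have [|n [n0 nm nE]] := h x; first by rewrite x0.
  have nh : on_halfline n.
    by apply: le_measure0 n0 => // z /=; rewrite !in_itv/= => /ltW h1; rewrite (le_trans h1)// ltW.
  have [vn [vnA vnR]] := weighted_measure nm mv v0.
  have ivn f : integ n f -> integ n (fun t => v t * f t).
    move=> i; apply: (integ_le _ (integZ delta^-1 (integ_abs i))).
      by apply: measurable_funM => //; exact: integ_meas i.
    by move=> t; rewrite normrM (ger0_norm (v0 t)) ler_wpM2r.
  have vnm : finite_moments vn.
    by move=> q; apply/(vnR _ (measurable_horner q)).1/ivn.
  pose c := eps / x + \int[vn]_t (1 : R).
  have c0 : a_0 + 1 <= c by rewrite /c ler_wpDr// Rint_ge0.
  (* Since b_0 < a_0 < c, this weight in ]0, 1[ solves lam c + (1 - lam) b_0 = a_0. Moments of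
     positive order already agree for both ingredients, hence for each convex combination. *)
  pose lam := (a_0 - b_0) / (c - b_0).
  have ac : a_0 < c by apply: lt_le_trans c0; rewrite ltrDl.
  have cb : 0 < c - b_0 by rewrite subr_gt0 (lt_trans b_0lt).
  have lam0 : 0 < lam by rewrite divr_gt0// subr_gt0.
  have lam1 : lam < 1 by rewrite ltr_pdivrMr// mul1r ltrD2r.
  have lamE : lam * c + (1 - lam) * b_0 = a_0.
    by rewrite mulrBl mul1r addrCA -mulrBr /lam divfK ?gt_eqF// addrC subrK.
  have [p [pA pR]] := point_mass x (ltW (mulr_gt0 lam0 (divr_gt0 e0 x0))).
  have [m1 [m1A m1R]] := weighted_measure vnm (measurable_cst lam) (fun=> ltW lam0).
  have lam1' : 0 <= 1 - lam by rewrite subr_ge0 ltW.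
  have [m2 [m2A m2R]] := weighted_measure bpm (measurable_cst (1 - lam)) (fun=> lam1').
  have [m12 [m12A _ m12i m12R]] := measure_sum m1 m2.
  have [m [mA _ mi mR]] := measure_sum p m12.
  have intm (f : R -> R) : integ vn f -> integ bp f ->
      integ m f /\ \int[m]_t f t = lam * (eps / x) * f x + (lam * \int[vn]_t f t +
        (1 - lam) * \int[bp]_t f t).
    move=> i1 i2; have mf := integ_meas i1.
    have j1 : integ m1 f by apply/(m1R _ mf).1; exact: integZ.
    have j2 : integ m2 f by apply/(m2R _ mf).1; exact: integZ.
    have j12 : integ m12 f by apply/m12i.
    have [j0 e0'] := pR f mf.
    split; first by apply/mi.
    by rewrite mR// e0' m12R// (m1R _ mf).2 (m2R _ mf).2 !RintZ.
  exists lam, m; split.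
  - by rewrite lam0.
  - have iA m' : finite_moments m' -> integ m' (\1_(`]-oo, 0]%classic) : R -> R).
      by move=> m'm; apply: integ_indic => //; exact: finite_moments_lty.
    apply: finite_indic0 => //.
      apply: finite_moments_lty => q; exact: (intm _ (vnm q) (bpm q)).1.
    rewrite (intm _ (iA _ vnm) (iA _ bpm)).2.
    rewrite (vnR _ (measurable_indic (measurable_itv _))).2 (@eq_Rintegral _ _ _ n setT (fun=> 0)).
      rewrite Rint0 indicE mem_setE in_itv/= leNgt x0 mulr0 mulr0 !add0r.
      have -> : \int[bp]_t \1_(`]-oo, 0]%classic) t = 0 :> R.
        by apply: EFin_inj; rewrite Rint_indic// bp0.
      by rewrite mulr0.
    move=> t _; rewrite /v indicE mem_setE in_itv/=; case: ltP => td; last by rewrite mul0r.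
    by rewrite leNgt (lt_trans d0 td) mulr0.
  - by move=> q; exact: (intm _ (vnm q) (bpm q)).1.
  - move=> q; rewrite (intm _ (vnm q) (bpm q)).2.
    have [q1 qE] := split_poly q.
    rewrite qE !Rsplit// bpX -(ab (q1 * 'X)) -/a_0 -/b_0.
    have -> : \int[vn]_t (q1 * 'X).[t] = \int[n]_t q1.[t].
      rewrite (vnR _ (measurable_horner _)).2.
      apply: (@ae_eq0_Rint _ _ _ n `]-oo, delta]%classic _ _ _ n0 _ _ _).2 => //.
      + by apply: measurable_funM => //; exact: measurable_horner.
      + exact: measurable_horner.
      + move=> t; rewrite /= in_itv/= => /negP; rewrite -ltNge => td.
        by rewrite /v td hornerMX mulrCA mulVf ?mulr1// gt_eqF// (lt_trans d0).
    have := nE q1; rewrite taX => nE1.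
    rewrite !hornerE/= -nE1 -[in LHS]lamE /c.
    have -> : eps * q1.[x] = eps / x * (q1.[x] * x).
      by rewrite mulrCA -mulrA mulVf ?mulr1 1?mulrC// gt_eqF.
    by ring.
  - move=> y yd.
    have ind1 z : \1_[set y] z = (z == y)%:R :> R.
      by rewrite indicE; case: eqVneq => [->|/eqP zy]; [rewrite mem_set|rewrite memNset].
    have iy m' : finite_moments m' -> integ m' (\1_[set y] : R -> R).
      by move=> m'm; apply: integ_indic => //; exact: finite_moments_lty.
    rewrite (intm _ (iy _ vnm) (iy _ bpm)).2.
    rewrite (vnR _ (measurable_indic (measurable_set1 y))).2 (@eq_Rintegral _ _ _ n setT (fun=> 0)).
      rewrite Rint0 mulr0 add0r; congr (_ * _ + _).
      by rewrite ind1 eq_sym.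
    move=> t _; rewrite /v ind1; case: ltP => td; last by rewrite mul0r.
    by rewrite gt_eqF ?mulr0// (le_lt_trans yd).
have [|l1 [m1 [/andP[l10 l11] m10 m1m m1E m1y]]] := sol X; first by rewrite X0 lexx.
have [|l2 [m2 [/andP[l20 l21] m20 m2m m2E m2y]]] := sol (X / 2); first by clear -X0; lra.
have [h1|h1] := pselect (exists2 A, measurable A & a A <> m1 A); first by exists m1.
have [h2|h2] := pselect (exists2 A, measurable A & a A <> m2 A); first by exists m2.
exfalso.
have e12 A : measurable A -> m1 A = m2 A.
  move=> mA; have <- : a A = m1 A by apply: contrapT => neqA; apply: h1; exists A.
  by apply: contrapT => neqA; apply: h2; exists A.
have Xd : X <= delta by rewrite ge_min lexx.
(* If both solutions were [a], their masses at X and X/2 would give p1 = (l1 - l2) B1 and p2 = (l2 -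
   l1) B2 with p1, p2 > 0 and B1, B2 >= 0, which is impossible whatever the sign of l1 - l2. *)
have := m1y X Xd; rewrite (eq_measure_Rintegral _ e12) m2y// eqxx mulr1.
rewrite gt_eqF ?mulr0 ?add0r; last by clear -X0; lra.
have Xd2 : X / 2 <= delta by clear -X0 Xd; lra.
have := m1y (X / 2) Xd2; rewrite (eq_measure_Rintegral _ e12) m2y// eqxx mulr1.
rewrite lt_eqF ?mulr0 ?add0r; last by clear -X0; lra.
have p1 : 0 < l1 * (eps / X) by rewrite mulr_gt0// divr_gt0.
have p2 : 0 < l2 * (eps / (X / 2)) by rewrite mulr_gt0// divr_gt0// divr_gt0.
have B1 : 0 <= \int[bp]_t (\1_[set X] t : R) by exact: Rint_ge0.
have B2 : 0 <= \int[bp]_t (\1_[set X / 2] t : R) by exact: Rint_ge0.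
move: p1 p2 B1 B2; set p1 := l1 * _; set p2 := l2 * _.
set B1 := Rintegral _ _ _; set B2 := Rintegral _ _ _ => p10 p20 B10 B20 h3 h4.
have h5 : p2 = (l2 - l1) * B2 by clear -h3 h4; lra.
have h6 : p1 = (l1 - l2) * B1 by clear -h3 h4; lra.
have [l12|/ltW l12] := leP l1 l2.
  have : (l1 - l2) * B1 <= 0 by rewrite mulr_le0_ge0// subr_le0.
  by rewrite -h6 leNgt p10.
have : (l2 - l1) * B2 <= 0 by rewrite mulr_le0_ge0// subr_le0.
by rewrite -h5 leNgt p20.
Qed.

Lemma separated_indeterminate a b :
  a `]-oo, 0]%classic = 0%E -> on_halfline b ->
  finite_moments a -> finite_moments b -> same_moments a b ->
  (exists2 A, measurable A & a A <> b A) ->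
  exists (delta : R) m, [/\ 0 < delta, m `]-oo, delta]%classic = 0%E,
    finite_moments m, same_moments a m & exists2 A, measurable A & a A <> m A].
Proof.
move=> a0 b0 am bm ab neq; have [m [m0 mm mE mneq]] := remove_atom a0 b0 am bm ab neq.
exact: separated_indeterminate_noatom a0 m0 am mm mE mneq.
Qed.

End remove_atom.

(** * Harmonic polynomials *)

Section laplacian.
Context (R : realType) (d : nat).
Implicit Types p q h : mpoly d R.

Local Notation Xi i := (@mpolyX d R (mnm1 i)).
Local Notation homog k p := (p \is ishomog1 k mdeg).

Definition laplacian p : mpoly d R := \sum_(i < d) mderiv i (mderiv i p).

Definition sqnorm : mpoly d R := \sum_(i < d) Xi i ^+ 2.

Lemma laplacian_is_linear : linear laplacian.
Proof.
move=> c p q; rewrite /laplacian scaler_sumr -big_split/=.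
by apply: eq_bigr => i _; rewrite !linearP.
Qed.

HB.instance Definition _ :=
  GRing.isLinear.Build R (mpoly d R) (mpoly d R) _ laplacian laplacian_is_linear.

Lemma homogM k l p q : homog k p -> homog l q -> homog (k + l) (p * q).
Proof. by move=> hp hq; exact: dhomogM. Qed.

Lemma homog_X i : homog 1 (Xi i).
Proof. by rewrite dhomogX; apply/eqP; exact: mdeg1. Qed.

Lemma homog_sqnorm : homog 2 sqnorm.
Proof.
apply: rpred_sum => i _; rewrite expr2.
exact: (@homogM 1 1 _ _ (homog_X i) (homog_X i)).
Qed.

Lemma homog_deriv k i p : homog k p -> homog k.-1 (mderiv i p).
Proof.
move=> /dhomogP hp; rewrite (mpolyE p) big_seq linear_sum.
apply: rpred_sum => m mp; rewrite linearZ/= mderivX.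
have [->|mi] := eqVneq (m i) 0%N; first by rewrite scale0r scaler0 rpred0.
rewrite !rpredZ// dhomogX; apply/eqP; rewrite -[LHS]/(mdeg _).
have := congr1 mdeg (submK (etrans (lep1mP i m) mi)).
by rewrite mdegD mdeg1 (hp _ mp) => <-; rewrite addn1.
Qed.

Lemma homog_deriv0 i p : homog 0 p -> mderiv i p = 0.
Proof.
move=> /dhomogP hp; rewrite (mpolyE p) big_seq linear_sum big1// => m mp.
have /eqP := hp m mp; rewrite mdeg_eq0 => /eqP ->.
by rewrite linearZ/= mderivX mnm0E scale0r scaler0.
Qed.

Lemma homog_laplacian k p : homog k p -> homog k.-2 (laplacian p).
Proof. by move=> hp; apply: rpred_sum => i _; do 2 apply: homog_deriv. Qed.

Lemma homog_lt2_laplacian k p : (k < 2)%N -> homog k p -> laplacian p = 0.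
Proof.
move=> k2 hp; rewrite /laplacian big1// => i _; apply: homog_deriv0.
by have := homog_deriv i hp; case: k k2 {hp} => [|[|]].
Qed.

Lemma euler_identity k p : homog k p ->
  \sum_(i < d) Xi i * mderiv i p = k%:R *: p.
Proof.
move=> /dhomogP hp; rewrite {2}(mpolyE p) scaler_sumr.
transitivity (\sum_(i < d) \sum_(m <- msupp p) mcoeff m p *: ((m i)%:R *: mpolyX R m)).
  apply: eq_bigr => i _; rewrite {1}(mpolyE p) linear_sum mulr_sumr.
  apply: eq_bigr => m _; rewrite linearZ/= mderivX -!scalerAr.
  have [->|mi] := eqVneq (m i) 0%N; first by rewrite !scale0r.
  by rewrite -mpolyXD addmC (submK (etrans (lep1mP i m) mi)).
rewrite exchange_big/=; apply: eq_big_seq => m mp.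
rewrite -scaler_sumr -scaler_suml scalerA mulrC -scalerA; congr (_ *: _).
by rewrite -natr_sum -mdegE (hp m mp).
Qed.

(** The Laplacian of |x|^2 is 2d, and the cross term of the Leibniz rule is 4 sum x_i d_i p, which
    Euler's identity turns into 4k p. *)
Lemma laplacian_sqnormM k p : homog k p ->
  laplacian (sqnorm * p) = (2 * d + 4 * k)%:R *: p + sqnorm * laplacian p.
Proof.
move=> hp.
have dX i j : mderiv i (Xi j) = if i == j then 1 else 0.
  rewrite mderivX mnm1E (eq_sym i j); case: eqVneq => [->|ij]; last by rewrite scale0r.
  rewrite scale1r (_ : mnm_sub _ _ = mnm0) ?mpolyX0//.
  by apply/mnmP => l; rewrite mnmBE mnm0E subnn.
have dsq i : mderiv i sqnorm = 2%:R * Xi i.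
  rewrite /sqnorm linear_sum (bigD1 i)//= big1 ?addr0.
    by rewrite expr2 mderivM dX eqxx; ring.
  by move=> j ji; rewrite expr2 mderivM dX eq_sym (negbTE ji); ring.
have dd i : mderiv i (mderiv i (sqnorm * p)) =
    2%:R * p + 4%:R * (Xi i * mderiv i p) + sqnorm * mderiv i (mderiv i p).
  rewrite mderivM dsq mderivD !mderivM dX eqxx.
  have -> : mderiv i (2%:R : mpoly d R) = 0.
    by rewrite -(rmorph_nat (@mpolyC d R)) mderivC.
  by rewrite dsq; ring.
rewrite /laplacian; under eq_bigr do rewrite dd.
rewrite !big_split/= -!mulr_sumr (euler_identity hp) sumr_const card_ord.
rewrite natrD scalerDl; congr (_ + _ + _).
  by rewrite scaler_nat mulr_natl mulnC mulrnA.
by rewrite !scaler_nat mulr_natl mulnC mulrnA.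
Qed.

Lemma harmonic_homogZ k c h : harmonic_homog k h -> harmonic_homog k (c *: h).
Proof.
move=> [h1 h2]; split; first by rewrite rpredZ.
by rewrite -[LHS]/(laplacian (c *: h)) linearZ/= /laplacian h2 scaler0.
Qed.

Lemma homog_sqnormX j k p : homog k p -> homog (2 * j + k) (sqnorm ^+ j * p).
Proof.
move=> hp; apply: homogM => //; exact: dhomogMn homog_sqnorm.
Qed.

(** The constant stays implicit: being positive, it can be divided by when |x|^2m h is recovered
    from its m-th Laplacian. *)
Lemma laplacian_sqnormX j k h : (0 < d)%N -> harmonic_homog k h ->
  exists2 c : R, 0 < c & laplacian (sqnorm ^+ j.+1 * h) = c *: (sqnorm ^+ j * h).
Proof.
move=> d0 [hk h0]; elim: j => [|j [c c0 IH]].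
  exists (2 * d + 4 * k)%:R; first by rewrite ltr0n addn_gt0 muln_gt0 d0.
  rewrite expr1 expr0 mul1r (laplacian_sqnormM hk).
  by rewrite /laplacian h0 mulr0 addr0.
exists ((2 * d + 4 * (2 * j.+1 + k))%:R + c).
  by rewrite ltr_wpDl.
rewrite exprS -mulrA (laplacian_sqnormM (homog_sqnormX j.+1 hk)) IH.
by rewrite -scalerAr mulrA -exprS scalerDl.
Qed.

Lemma iter_laplacianZ j c p : iter j laplacian (c *: p) = c *: iter j laplacian p.
Proof. by elim: j => //= j ->; rewrite linearZ. Qed.

Lemma iter_laplacian_sqnormX j k h : (0 < d)%N -> harmonic_homog k h ->
  exists2 c : R, 0 < c & iter j laplacian (sqnorm ^+ j * h) = c *: h.
Proof.
move=> d0 hh; elim: j => [|j [c c0 IH]].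
  by exists 1; rewrite //= expr0 mul1r scale1r.
have [c' c'0 E] := laplacian_sqnormX j d0 hh.
exists (c' * c); first by rewrite mulr_gt0.
by rewrite iterSr E iter_laplacianZ IH scalerA.
Qed.

(* Almansi's expansion: subtracting a multiple of |x|^2m Delta^m p lowers the
   order m of the equation Delta^(m+1) p = 0 satisfied by p. *)
Lemma harmonic_ind (Q : mpoly d R -> Prop) : (0 < d)%N ->
  Q 0 -> (forall p q, Q p -> Q q -> Q (p + q)) ->
  (forall j k h, harmonic_homog k h -> Q (sqnorm ^+ j * h)) -> forall p, Q p.
Proof.
move=> d0 Q0 QD Qh.
have iterB j p q : iter j laplacian (p - q) = iter j laplacian p - iter j laplacian q.
  by elim: j => //= j ->; rewrite linearB.
have homog_iter j n p : homog n p -> homog (n - 2 * j) (iter j laplacian p).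
  move=> hp; elim: j => [|j IH]; first by rewrite muln0 subn0.
  rewrite iterS (_ : (n - 2 * j.+1)%N = (n - 2 * j).-2); last by lia.
  exact: homog_laplacian.
have main m n p : homog n p -> iter m laplacian p = 0 -> Q p.
  elim: m p => [|m IH] p hp; first by move=> /= ->.
  (* If n < 2m, the m-th Laplacian of [p] already vanishes by degree. As n - 2j is truncated, this
     is read off from a degree below 2 before the last Laplacian. *)
  move=> hm; have [nm|mn] := ltnP n (2 * m).
    apply: IH => //; case: m nm {hm} => [|m] nm; first by lia.
    rewrite iterS; have [nm'|nm'] := ltnP n (2 * m); last first.
      by apply: homog_lt2_laplacian (homog_iter m n p hp); lia.
    have := homog_iter m n p hp; rewrite (_ : (n - 2 * m)%N = 0%N); last by lia.
    by apply: homog_lt2_laplacian.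
  pose u := iter m laplacian p.
  have hu : harmonic_homog (n - 2 * m) u.
    by split; [exact: homog_iter|exact: hm].
  have [c c0 E] := iter_laplacian_sqnormX m d0 hu.
  have hv : harmonic_homog (n - 2 * m) (c^-1 *: u) by exact: harmonic_homogZ.
  rewrite -(subrK (sqnorm ^+ m * (c^-1 *: u)) p); apply: QD; last exact: Qh hv.
  apply: IH.
    rewrite rpredB//; have := homog_sqnormX m hv.1.
    by rewrite subnKC.
  by rewrite iterB -scalerAr iter_laplacianZ E scalerA mulVf ?gt_eqF// scale1r subrr.
have monoZ c m : Q (c *: mpolyX R m).
  have hX : homog (mdeg m) (c *: mpolyX R m) by rewrite rpredZ// dhomogX.
  (* A generous order: n + 1 Laplacians certainly annihilate a monomial of degree n. *)
  apply: (main (mdeg m).+1 _ _ hX).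
  rewrite iterS; apply: homog_lt2_laplacian (homog_iter (mdeg m) _ _ hX).
  by lia.
by elim/mpolyind => // c m p _ _ Qp; exact: QD.
Qed.
End laplacian.

(** * Charges and their radial components *)

Section charge_integral_lemmas.
Context d (T : measurableType d) (R : realType).
Implicit Types (s : {charge set T -> \bar R}) (f g : T -> R).

Definition cpos s : {measure set T -> \bar R} := jordan_pos (hahn_pairP s).
Definition cneg s : {measure set T -> \bar R} := jordan_neg (hahn_pairP s).

Lemma cpos_lty s : (cpos s setT < +oo)%E.
Proof.
rewrite -ge0_fin_numE ?measure_ge0//.
exact: (fin_num_measure (jordan_pos (hahn_pairP s)) _ measurableT).
Qed.

Lemma cneg_lty s : (cneg s setT < +oo)%E.
Proof.
rewrite -ge0_fin_numE ?measure_ge0//.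
exact: (fin_num_measure (jordan_neg (hahn_pairP s)) _ measurableT).
Qed.

Lemma charge_jordan s A : measurable A -> s A = (cpos s A - cneg s A)%E.
Proof. by move=> mA; rewrite (jordan_decomp (hahn_pairP s) mA) /cadd/= /cscale mulN1e. Qed.

(** By minimality of the Jordan decomposition: the positive part of [s] at A is the value of [s] on
    the intersection of A with a Hahn set, hence at most m1(A), and likewise for the negative part.
    So integrability passes to the Jordan parts, and any representation as a difference computes the
    integral. *)
Lemma charge_integral_measures s (m1 m2 : {measure set T -> \bar R}) :
  (m1 setT < +oo)%E -> (m2 setT < +oo)%E ->
  (forall A, measurable A -> s A = (m1 A - m2 A)%E) ->
  forall f, integ m1 f -> integ m2 f ->
  [/\ integ (cpos s) f, integ (cneg s) f &
      charge_integral s f = \int[m1]_x f x - \int[m2]_x f x].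
Proof.
move=> m1oo m2oo sE f i1 i2.
have fin (m : {measure set T -> \bar R}) A :
    (m setT < +oo)%E -> measurable A -> m A \is a fin_num by exact: fin_num_lty.
have [[mP _] [mN _] _ _] := hahn_pairP s.
have posle A : measurable A -> (cpos s A <= m1 A)%E.
  move=> mA; have -> : cpos s A = s (A `&` (hahn_pair s).1).
    transitivity (jordan_pos (hahn_pairP s) A) => //.
    by rewrite jordan_posE cjordan_posE /crestr0 mem_set.
  have mAP : measurable (A `&` (hahn_pair s).1) by exact: measurableI.
  rewrite sE//; apply: (@le_trans _ _ (m1 (A `&` (hahn_pair s).1))).
    by rewrite leeBlDr ?fin// leeDl.
  by apply: le_measure; rewrite ?inE// => x [].
have negle A : measurable A -> (cneg s A <= m2 A)%E.
  move=> mA; have -> : cneg s A = (- s (A `&` (hahn_pair s).2))%E.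
    transitivity (jordan_neg (hahn_pairP s) A) => //.
    by rewrite jordan_negE cjordan_negE /crestr0 mem_set.
  have mAP : measurable (A `&` (hahn_pair s).2) by exact: measurableI.
  rewrite sE// oppeB ?fin_num_adde_defl ?fin//; last by rewrite fin_numN fin.
  apply: (@le_trans _ _ (m2 (A `&` (hahn_pair s).2))).
    by rewrite addeC leeBlDr ?fin// leeDl.
  by apply: le_measure; rewrite ?inE// => x [].
have ip : integ (cpos s) f by exact: le_measure_integ posle i1.
have in_ : integ (cneg s) f by exact: le_measure_integ negle i2.
split=> //.
(* The two differences are compared through the sums s+ + m2 = s- + m1, which are measures. *)
have [a [aE _ _ aR]] := measure_sum (cpos s) m2.
have [b [bE _ _ bR]] := measure_sum (cneg s) m1.
have ab A : measurable A -> a A = b A.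
  move=> mA; rewrite aE bE; have := charge_jordan s mA; rewrite sE//.
  have := fin _ _ (cpos_lty s) mA; have := fin _ _ (cneg_lty s) mA.
  have := fin _ _ m1oo mA; have := fin _ _ m2oo mA.
  move: (m1 A) (m2 A) (cpos s A) (cneg s A) => [x||] [y||] [z||] [w||]//.
  by move=> _ _ _ _ [h]; congr EFin; move: h; lra.
have := eq_measure_Rintegral f ab; rewrite aR// bR// /charge_integral.
by rewrite -/(cpos s) -/(cneg s); lra.
Qed.

Lemma eq_charge_integral s1 s2 f : (forall A, measurable A -> s1 A = s2 A) ->
  integ (cpos s1) f -> integ (cneg s1) f ->
  charge_integral s2 f = charge_integral s1 f.
Proof.
move=> e ip iN; have [|_ _ ->] := @charge_integral_measures s2 (cpos s1) (cneg s1)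
  (cpos_lty s1) (cneg_lty s1) _ f ip iN.
  by move=> A mA; rewrite -e// charge_jordan.
by [].
Qed.

Lemma integ_total_variation s f :
  integ (charge_total_variation s) f <-> integ (cpos s) f /\ integ (cneg s) f.
Proof.
have [n [nE _ ni _]] := measure_sum (cpos s) (cneg s).
have e A : charge_total_variation s A = n A by rewrite nE.
split => [h|h]; last by apply: (eq_measure_integ (m1 := n)); [by []|exact/ni].
by apply/ni; apply: eq_measure_integ h => A _; exact: e.
Qed.

End charge_integral_lemmas.

Lemma meval_map_rmorphism (n : nat) (A B : comNzRingType) (f : {rmorphism A -> B})
    (v : 'I_n -> A) (p : mpoly n A) :
  meval (fun i => f (v i)) (map_mpoly f p) = f (meval v p).
Proof.
elim/mpolyind: p => [|c m p _ _ IH]; first by rewrite !raddf0.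
rewrite !raddfD/= IH map_mpolyZ !mevalZ map_mpolyX !mevalX rmorphM rmorph_prod/=.
by congr (_ * _ + _); apply: eq_bigr => i _; rewrite rmorphXn.
Qed.

Section complex_polynomials.
Context (R : realType) (d : nat).
Implicit Types (f : mpoly d R[i]) (p : mpoly d R).

Definition mpoly_re f : mpoly d R :=
  \sum_(m <- msupp f) complex.Re (mcoeff m f) *: mpolyX R m.
Definition mpoly_im f : mpoly d R :=
  \sum_(m <- msupp f) complex.Im (mcoeff m f) *: mpolyX R m.

Lemma cpevalE f x : cpeval f x = (peval (mpoly_re f) x +i* peval (mpoly_im f) x)%C.
Proof.
have key (c : R[i]) (r : R) : (c * r%:C = (complex.Re c * r +i* (complex.Im c * r)))%C.
  by case: c => a b; apply/eqP; rewrite eq_complex/= !mulr0 subr0 add0r !eqxx.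
rewrite /cpeval mevalE /peval /mpoly_re /mpoly_im !linear_sum/=.
under [in X in (X +i* _)%C]eq_bigr do rewrite mevalZ mevalX.
under [in X in (_ +i* X)%C]eq_bigr do rewrite mevalZ mevalX.
elim/big_rec3: _ => [|m a b c _ ->]//.
have -> : (\prod_i (tnth x i)%:C%C ^+ m i) = (\prod_(i < d) tnth x i ^+ m i)%:C%C.
  by rewrite rmorph_prod; apply: eq_bigr => i _; rewrite rmorphXn.
by rewrite key.
Qed.

Definition mpolyC_of p : mpoly d R[i] := map_mpoly (real_complex R) p.

Lemma cpeval_of_real p x : cpeval (mpolyC_of p) x = (peval p x)%:C%C.
Proof. exact: meval_map_rmorphism. Qed.

End complex_polynomials.

Section real_reduction.
Context (R : realType) (d : nat).
Implicit Types (s t : {charge set (d.-tuple R) -> \bar R}).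

Lemma moment_measureP s : moment_measure s <->
  forall p : mpoly d R, integ (cpos s) (peval p) /\ integ (cneg s) (peval p).
Proof.
split=> [h p|h f].
  have [h1 _] := h (mpolyC_of p); apply/integ_total_variation.
  by move: h1; under eq_fun do rewrite cpeval_of_real.
have eR : (fun x => (complex.Re (cpeval f x))%:E) = EFin \o peval (mpoly_re f).
  by apply/funext => x; rewrite /= cpevalE.
have eI : (fun x => (complex.Im (cpeval f x))%:E) = EFin \o peval (mpoly_im f).
  by apply/funext => x; rewrite /= cpevalE.
by split; [rewrite eR|rewrite eI]; apply/integ_total_variation; exact: h.
Qed.

Lemma same_cmomentsP s t :
  (forall f : mpoly d R[i], ccharge_integral s (cpeval f) = ccharge_integral t (cpeval f)) <->
  forall p : mpoly d R, charge_integral s (peval p) = charge_integral t (peval p).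
Proof.
split=> [h p|h f].
  have e : peval p = (fun x => complex.Re (cpeval (mpolyC_of p) x)).
    by apply/funext => x; rewrite cpeval_of_real.
  by have := h (mpolyC_of p); rewrite /ccharge_integral => -[+ _]; rewrite -e.
have e : cpeval f = (fun x => (peval (mpoly_re f) x +i* peval (mpoly_im f) x)%C).
  by apply/funext => x; exact: cpevalE.
by rewrite /ccharge_integral e/=; congr (_ +i* _)%C; exact: h.
Qed.

Lemma continuous_real_complex : continuous (real_complex R : R -> R[i]^o).
Proof.
move=> x; apply/cvgrPdist_lt => /= e e0.
have [er ei] : 0 < complex.Re e /\ e = (complex.Re e)%:C%C.
  by move: e0; case: e => a b; rewrite ltcE/= => /andP[/eqP -> ->].
near=> y; rewrite -rmorphB/= normc_def/= expr0n/= addr0 sqrtr_sqr ei ltcR.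
near: y; exact: (@cvgr_dist_lt _ _ _ _ _ _ x _ _ er).
Unshelve. all: by end_near. Qed.

Lemma component_measure_real s (p : mpoly d R) (n : {measure set R -> \bar R}) (h : R -> R)
    (q : {poly R}) :
  component_measure s p n -> {within `[0, +oo[, continuous h} ->
  (forall r, 0 <= r -> `|h r| <= q.[r]) ->
  \int[n]_(r in `[0, +oo[) h r = charge_integral s (fun x => h (enorm x) * peval p x).
Proof.
move=> [_ _ H] ch hq.
have := H (fun r => (h r)%:C%C); rewrite /cintegral /ccharge_integral.
have c1 : {within `[0, +oo[, continuous (fun r => (h r)%:C%C : R[i]^o)}.
  apply: (@within_continuous_comp R R R[i]^o _ h (real_complex R)); last exact: ch.
  by move=> y _; exact: continuous_real_complex.
have pb : polynomially_bounded (fun r => (h r)%:C%C).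
  exists q => r r0; rewrite normc_def/= expr0n/= addr0 sqrtr_sqr lecR.
  exact: hq.
move=> /(_ c1 pb) [-> _]; congr charge_integral; apply/funext => x.
by rewrite /= mul0r subr0.
Qed.

End real_reduction.

(** * Radial components as positive measures on the half-line *)

Section test_functions.
Context (R : realType).
Implicit Types m : {measure set R -> \bar R}.

(** Functions admissible both for pseudo-positivity (non-negative, compact support) and for
    component measures (bounded by a constant polynomial). *)
Definition test_function (h : R -> R) := [/\ continuous h, forall r, 0 <= h r <= 1 &
  compact (closure [set r | 0 <= r /\ h r != 0])].

Let max_continuous (f g : R -> R) : continuous f -> continuous g ->
  continuous (fun t => Num.max (f t) (g t)).
Proof.
move=> cf cg t; rewrite (funext (fun t => maxr_absE (f t) (g t))).
apply: cvgM; last exact: cvg_cst.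
apply: cvgD; first by apply: cvgD; [exact: cf|exact: cg].
by apply: cvg_norm; apply: cvgB; [exact: cf|exact: cg].
Qed.

Let min_continuous (f g : R -> R) : continuous f -> continuous g ->
  continuous (fun t => Num.min (f t) (g t)).
Proof.
move=> cf cg t; rewrite (funext (fun t => minr_absE (f t) (g t))).
apply: cvgM; last exact: cvg_cst.
apply: cvgB; first by apply: cvgD; [exact: cf|exact: cg].
by apply: cvg_norm; apply: cvgB; [exact: cf|exact: cg].
Qed.

(** A trapezoid whose ramps have width 1/(n + 1) and lie to the right of [a] and of [b]: the limit
    is 0 at [a] and 1 at [b], in accordance with the half-open intervals of the Stieltjes
    construction. *)
Let trap (a b : R) (n : nat) (t : R) : R :=
  Num.max 0 (Num.min 1 (Num.min (n.+1%:R * (t - a)) (1 - n.+1%:R * (t - b)))).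

Let trap_test a b n : test_function (trap a b n).
Proof.
have caff (u v : R) : continuous (fun t : R => u + v * t).
  move=> t; apply: cvgD; first exact: cvg_cst.
  by apply: cvgM; [exact: cvg_cst|exact: cvg_id].
split.
- have -> : trap a b n = (fun t => Num.max 0 (Num.min 1 (Num.min
      (- (n.+1%:R * a) + n.+1%:R * t) (1 + n.+1%:R * b + - n.+1%:R * t)))).
    apply/funext => t; rewrite /trap; congr (Num.max _ (Num.min _ (Num.min _ _))); ring.
  apply: max_continuous; first by move=> t; exact: cvg_cst.
  apply: min_continuous; first by move=> t; exact: cvg_cst.
  by apply: min_continuous; exact: caff.
- by move=> t; rewrite /trap le_max lexx/= ge_max ler01 ge_min lexx.
- apply: (@subclosed_compact _ _ `[a, b + 1]%classic).
  + exact: closed_closure.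
  + exact: segment_compact.
  + have cl : closed `[a, b + 1]%classic by exact: interval_closed.
    rewrite ((closure_id `[a, b + 1]%classic).1 cl); apply: closure_subset.
    move=> t /= [_ h]; rewrite in_itv/=; apply/andP; split; rewrite leNgt; apply/negP => ht;
      move: h; rewrite /trap => /negP; apply; apply/eqP/max_idPl.
      rewrite !ge_min; apply/orP; right; apply/orP; left.
      by rewrite pmulr_rle0// subr_le0 ltW.
    rewrite !ge_min; apply/orP; right; apply/orP; right.
    rewrite subr_le0; apply: (@le_trans _ _ (1 * (t - b))); first by lra.
    by apply: ler_wpM2r; [lra|rewrite ler1n].
Qed.

Let cvg_trap a b t : (fun n => trap a b n t) @ \oo --> (\1_(`]a, b]%classic) t : R).
Proof.
rewrite indicE mem_setE in_itv/=.
have big (x : R) : 0 < x -> \forall n \near \oo, 1 <= n.+1%:R * x.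
  move=> x0; exists (Num.trunc x^-1) => // n /= xn.
  rewrite -ler_pdivrMr// mul1r (le_trans (ltW (truncnS_gt _)))// ler_nat ltnS.
  exact: xn.
have [ta|ta] := leP t a.
  apply: (@cvg_trans _ ((fun=> 0 : R) @ \oo)); last exact: cvg_cst.
  apply: near_eq_cvg; apply: nearW => n /=; apply/esym/max_idPl.
  rewrite !ge_min; apply/orP; right; apply/orP; left.
  by rewrite pmulr_rle0// subr_le0.
have [tb|tb] := leP t b.
  apply: (@cvg_trans _ ((fun=> 1 : R) @ \oo)); last exact: cvg_cst.
  apply: near_eq_cvg; have := big (t - a); rewrite subr_gt0 => /(_ ta).
  apply: filterS => n h; rewrite /trap (min_idPl _); first by rewrite (max_idPr _).
  rewrite le_min h/=; rewrite lerBrDr gerDl pmulr_rle0// subr_le0//.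
apply: (@cvg_trans _ ((fun=> 0 : R) @ \oo)); last exact: cvg_cst.
apply: near_eq_cvg; have := big (t - b); rewrite subr_gt0 => /(_ tb).
apply: filterS => n h; apply/esym/max_idPl.
by rewrite !ge_min; apply/orP; right; apply/orP; right; rewrite subr_le0.
Qed.

Lemma test_function_meas h : test_function h -> measurable_fun setT h.
Proof. by move=> [ch _ _]; exact: continuous_measurable_fun. Qed.

Lemma test_function_integ m h : (m setT < +oo)%E -> test_function h -> integ m h.
Proof.
move=> moo th; apply: (integ_bounded (c := 1) moo (test_function_meas th)) => x.
by have [_ /(_ x)/andP[h0 h1] _] := th; rewrite ger0_norm.
Qed.

Lemma le_ocitv_test m1 m2 : (m1 setT < +oo)%E -> (m2 setT < +oo)%E ->
  (forall h, test_function h -> \int[m2]_t h t <= \int[m1]_t h t) ->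
  forall a b : R, (m2 `]a, b]%classic <= m1 `]a, b]%classic)%E.
Proof.
move=> m1oo m2oo H a b.
have lim m : (m setT < +oo)%E ->
    (\int[m]_x (trap a b n x)%:E)%E @[n --> \oo] --> m `]a, b]%classic.
  move=> moo; rewrite (_ : m _ = (\int[m]_x (\1_(`]a, b]%classic) x)%:E)%E); last first.
    by rewrite integral_indic// setIT.
  have [|||||_ _ cv] := @dominated_convergence _ R R m setT measurableT
    (fun n x => (trap a b n x)%:E) (EFin \o \1_(`]a, b]%classic)) (fun=> 1%E).
  - by move=> n; apply/measurable_EFinP; exact: test_function_meas.
  - exact/measurable_EFinP.
  - by apply: aeW => x _ /=; apply/cvg_EFin; [exact: nearW|exact: cvg_trap].
  - by apply: (@integ_bounded _ _ _ m (fun=> 1) 1) => // x; rewrite normr1.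
  - apply: aeW => x n _ /=; rewrite lee_fin.
    by have [_ /(_ x)/andP[h0 h1] _] := trap_test a b n; rewrite ger0_norm.
  - exact: cv.
rewrite -(cvg_lim _ (lim m1 m1oo))// -(cvg_lim _ (lim m2 m2oo))//.
apply: lee_lim.
- by apply/cvg_ex; eexists; exact: lim m2oo.
- by apply/cvg_ex; eexists; exact: lim m1oo.
- apply: nearW => n; rewrite -!RintE; [|exact: test_function_integ|exact: test_function_integ].
  by rewrite lee_fin; exact: H.
Qed.

End test_functions.

Section measure_difference.
Context (R : realType).
Implicit Types m : {measure set R -> \bar R}.

Lemma ocitv_measure_unique m1 m2 : (m1 setT < +oo)%E ->
  (forall a b : R, m1 `]a, b]%classic = m2 `]a, b]%classic) ->
  forall A, measurable A -> m1 A = m2 A.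
Proof.
move=> m1oo h A mA.
apply: (@measure_unique _ R _ (@ocitv R) (fun n => `]- n%:R, n%:R]%classic)) => //.
- exact: ocitvI.
- by move=> n; exact: is_ocitv.
- apply/seteqP; split => // x _; exists (Num.trunc `|x|).+1 => //=.
  have := truncnS_gt `|x|; rewrite ltr_norml in_itv/= => /andP[-> /ltW ->].
  by [].
- by move=> _ [[a b] _ <-] /=; exact: h.
- by move=> n; apply: le_lt_trans m1oo; apply: le_measure; rewrite ?inE.
Qed.

(* R carries both its own measurable structure and the one of measurableTypeR;
   they are convertible but not unifiable. *)
Lemma measure_of_typeR (m0 : {measure set (measurableTypeR R) -> \bar R}) :
  exists m, forall A : set R, measurable A -> m A = m0 A.
Proof.
have mid : @measurable_fun _ _ (measurableTypeR R) R setT id.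
  by move=> _ A mA; rewrite setTI.
have [m mE] := @weighted_pushforward _ _ (measurableTypeR R) R R m0 (fun=> 1) id
  (measurable_cst _) (fun _ => ler01) mid.
exists m => A mA; have := mE (EFin \o \1_A).
rewrite integral_indic// setIT => ->; [|exact/measurable_EFinP|by move=> y; rewrite lee_fin].
under eq_integral do rewrite mul1e.
by rewrite integral_indic// setIT.
Qed.

(** The difference is known to be non-negative on half-open intervals only. Its distribution
    function is then non-decreasing and right-continuous, and the Lebesgue-Stieltjes measure of this
    function is the difference on all Borel sets. *)
Lemma measure_difference m1 m2 : (m1 setT < +oo)%E -> (m2 setT < +oo)%E ->
  (forall a b : R, (m2 `]a, b]%classic <= m1 `]a, b]%classic)%E) ->
  exists m, forall A, measurable A -> m1 A = (m2 A + m A)%E.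
Proof.
move=> m1oo m2oo le12.
have fin m A : (m setT < +oo)%E -> measurable A -> m A \is a fin_num.
  exact: fin_num_lty.
have diff m (a b : R) : (m setT < +oo)%E -> a <= b ->
    m `]-oo, b]%classic = (m `]-oo, a]%classic + m `]a, b]%classic)%E.
  move=> moo ab; rewrite -measureU//.
    congr (m _); apply/seteqP; split => x /=; rewrite !in_itv/=.
      by move=> xb; case: (leP x a) => xa; [left|right].
    by case=> [xa|/andP[]//]; exact: le_trans ab.
  apply/seteqP; split => x //=; rewrite !in_itv/= => -[xa /andP[+ _]].
  by rewrite ltNge xa.
pose F m (x : R) := fine (m `]-oo, x]%classic).
pose f x := F m1 x - F m2 x.
have Fdiff m (a b : R) : (m setT < +oo)%E -> a <= b ->
    F m b - F m a = fine (m `]a, b]%classic).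
  move=> moo ab; rewrite /F (diff m a b)// fineD ?fin//.
  by rewrite addrAC subrr add0r.
have fnd : nondecreasing f.
  move=> a b ab; rewrite /f -subr_ge0.
  have -> : F m1 b - F m2 b - (F m1 a - F m2 a) = (F m1 b - F m1 a) - (F m2 b - F m2 a).
    by ring.
  by rewrite !Fdiff// subr_ge0 fine_le ?fin.
have Frc m : (m setT < +oo)%E -> right_continuous (F m).
  move=> moo x; apply/cvgrPdist_le => /= e e0.
  have [r r0 h] := ray_right x moo e0.
  near=> y.
  have xy : x <= y by near: y; exact: nbhs_right_ge.
  have yr : y <= x + r by near: y; apply: nbhs_right_le; rewrite ltrDl.
  rewrite distrC ger0_norm ?Fdiff// ?fine_ge0//.
  by rewrite -Fdiff// lerBlDl; exact: h.
have frc : right_continuous f.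
  by move=> x; apply: cvgB; exact: Frc.
pose cx := isCumulative.Build R _ R f fnd frc.
pose fc : cumulative R R := HB.pack f cx.
pose m0 : {measure set (measurableTypeR R) -> \bar R} := lebesgue_stieltjes_measure fc.
have [m mE0] := measure_of_typeR m0.
exists m => A mA.
have [n [nE _ _ _]] := measure_sum m2 m.
rewrite -nE; apply: (ocitv_measure_unique m1oo) => // a b.
rewrite nE; have [ab|ba] := leP a b; last first.
  by rewrite set_itv_ge ?measure0 ?adde0// bnd_simp -leNgt ltW.
have -> : m `]a, b]%classic = (f b - f a)%:E.
  rewrite mE0//; transitivity (lebesgue_stieltjes_measure fc `]a, b]%classic) => //.
  apply: (etrans (measurable_mu_extE (wlength fc) (is_ocitv a b))).
  exact: wlength_itv_bnd.
have -> : f b - f a = fine (m1 `]a, b]%classic) - fine (m2 `]a, b]%classic).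
  by rewrite -!Fdiff// /f; ring.
by rewrite EFinB !fineK ?fin// addeCA subee ?fin// adde0.
Unshelve. all: by end_near. Qed.
End measure_difference.

Lemma max0_sub (R : realDomainType) (t : R) : t = Num.max t 0 - Num.max (- t) 0.
Proof.
case: (leP 0 t) => h; first by rewrite (max_idPr _) ?subr0// oppr_le0.
by rewrite (max_idPl _) ?oppr_ge0 ?ltW// opprK add0r.
Qed.

Section radial_measures.
Context (R : realType) (d : nat).
Implicit Types (s : {charge set (d.-tuple R) -> \bar R}) (p : mpoly d R).

Lemma measurable_peval p : measurable_fun setT (@peval R d p).
Proof.
elim/mpolyind: p => [|c m p _ _ IH].
  rewrite (_ : peval 0 = fun=> 0) //; apply/funext => x; exact: meval0.
rewrite (_ : peval _ = fun x => c * \prod_(i < d) tnth x i ^+ m i + peval p x); last first.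
  by apply/funext => x; rewrite /peval mevalD mevalZ mevalX.
apply: measurable_funD => //; apply: measurable_funM => //.
apply: measurable_prod => i _; apply: measurable_funX; exact: measurable_tnth.
Qed.

Lemma enorm_ge0 (x : d.-tuple R) : 0 <= enorm x.
Proof. exact: sqrtr_ge0. Qed.

Lemma halfline_integral (n : {measure set R -> \bar R}) (f : R -> \bar R) :
  on_halfline n -> measurable_fun setT f ->
  (\int[n]_(r in `[0%R, +oo[) f r = \int[n]_r f r)%E.
Proof.
move=> n0 mf; rewrite integral_mkcond; apply: ae_eq_integral => //.
  by apply/(measurable_restrictT _ _).1 => //; exact: measurable_funTS.
exists `]-oo, 0[%classic; split => // t /= /not_implyP[_ h].
rewrite in_itv/= ltNge; apply/negP => t0; apply: h.
by rewrite patchE mem_set// /= in_itv/= t0.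
Qed.

(** Four images under the norm, of the Jordan parts of [s] weighted by the positive and negative
    parts of [p]: equal signs are collected in [m1], opposite signs in [m2]. *)
Lemma radial_measures s p : exists m1 m2 : {measure set R -> \bar R},
  [/\ on_halfline m1, on_halfline m2 &
  forall g : R -> R, measurable_fun setT g ->
    integ (cpos s) (fun x => g (enorm x) * peval p x) ->
    integ (cneg s) (fun x => g (enorm x) * peval p x) ->
    [/\ integ m1 g, integ m2 g &
    charge_integral s (fun x => g (enorm x) * peval p x) =
      \int[m1]_r g r - \int[m2]_r g r]].
Proof.
pose pp x := Num.max (peval p x) 0; pose pn x := Num.max (- peval p x) 0.
have mpp : measurable_fun setT pp.
  by apply: measurable_maxr => //; exact: measurable_peval.
have mpn : measurable_fun setT pn.
  apply: measurable_maxr => //; apply: measurableT_comp => //; exact: measurable_peval.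
have pp0 x : 0 <= pp x by rewrite le_max lexx orbT.
have pn0 x : 0 <= pn x by rewrite le_max lexx orbT.
have pE x : peval p x = pp x - pn x by exact: max0_sub.
have pp_le x : pp x <= `|peval p x| by rewrite ge_max ler_norm normr_ge0.
have pn_le x : pn x <= `|peval p x| by rewrite ge_max -normrN ler_norm normr_ge0.
have me := @measurable_enorm R d.
have [pp1 [pp1E pp1i pp1R]] := weighted_pushforward_real (cpos s) mpp pp0 me.
have [pn1 [pn1E pn1i pn1R]] := weighted_pushforward_real (cpos s) mpn pn0 me.
have [np1 [np1E np1i np1R]] := weighted_pushforward_real (cneg s) mpp pp0 me.
have [nn1 [nn1E nn1i nn1R]] := weighted_pushforward_real (cneg s) mpn pn0 me.
have [m1 [m1A _ m1i m1R]] := measure_sum pp1 nn1.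
have [m2 [m2A _ m2i m2R]] := measure_sum pn1 np1.
have hl (q : {measure set R -> \bar R}) (c : {measure set (d.-tuple R) -> \bar R}) (w : d.-tuple R -> R) :
    (forall g : R -> \bar R, measurable_fun setT g -> (forall y, 0 <= g y)%E ->
     (\int[q]_y g y = \int[c]_x ((w x)%:E * g (enorm x)))%E) -> on_halfline q.
  move=> H; rewrite /on_halfline -[LHS]/(q `]-oo, 0[%classic).
  rewrite (_ : q _ = (\int[q]_r (\1_(`]-oo, 0[%classic) r)%:E)%E); last first.
    by rewrite integral_indic// setIT.
  rewrite H; [|exact/measurable_EFinP|by move=> y; rewrite lee_fin].
  rewrite integral0_eq// => x _.
  by rewrite indicE mem_setE in_itv/= ltNge enorm_ge0 mule0.
exists m1, m2; split.
- by rewrite /on_halfline m1A (hl _ _ _ pp1E) (hl _ _ _ nn1E) adde0.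
- by rewrite /on_halfline m2A (hl _ _ _ pn1E) (hl _ _ _ np1E) adde0.
move=> g mg ip iN.
have mge : measurable_fun setT (fun x : d.-tuple R => g (enorm x)).
  exact: (measurableT_comp mg me).
have iw (c : {measure set (d.-tuple R) -> \bar R}) (w : d.-tuple R -> R) : measurable_fun setT w ->
    (forall x, 0 <= w x) -> (forall x, w x <= `|peval p x|) ->
    integ c (fun x => g (enorm x) * peval p x) ->
    integ c (fun x => w x * g (enorm x)).
  move=> mw w0 wp i; apply: (integ_le _ (integ_abs i)).
    exact: measurable_funM.
  by move=> x; rewrite !normrM mulrC ler_wpM2l// ger0_norm.
have j1 := iw _ _ mpp pp0 pp_le ip; have j2 := iw _ _ mpn pn0 pn_le ip.
have j3 := iw _ _ mpp pp0 pp_le iN; have j4 := iw _ _ mpn pn0 pn_le iN.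
have k1 := (pp1i g mg).2 j1; have k2 := (pn1i g mg).2 j2.
have k3 := (np1i g mg).2 j3; have k4 := (nn1i g mg).2 j4.
split; [by apply/m1i|by apply/m2i|].
rewrite m1R// m2R// pp1R// pn1R// np1R// nn1R// /charge_integral.
have e (c : {measure set (d.-tuple R) -> \bar R}) :
    integ c (fun x => pp x * g (enorm x)) -> integ c (fun x => pn x * g (enorm x)) ->
    \int[c]_x (g (enorm x) * peval p x) =
    \int[c]_x (pp x * g (enorm x)) - \int[c]_x (pn x * g (enorm x)).
  move=> i1 i2; rewrite -RintB//; apply: eq_Rintegral => x _.
  by rewrite pE mulrC mulrBl.
by rewrite -/(cpos s) -/(cneg s) !e//; ring.
Qed.

End radial_measures.

Section components.
Context (R : realType) (d : nat).
Implicit Types (s : {charge set (d.-tuple R) -> \bar R}) (p : mpoly d R).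
Implicit Types n : {measure set R -> \bar R}.

(** A component measure tested against measurable instead of continuous functions, so that
    indicators of Borel sets and cut-offs at the boundary of a ball are allowed. *)
Definition radial_measure s p n := [/\ on_halfline n, (n setT < +oo)%E &
  forall g : R -> R, measurable_fun setT g ->
    integ (cpos s) (fun x => g (enorm x) * peval p x) ->
    integ (cneg s) (fun x => g (enorm x) * peval p x) ->
    integ n g /\ charge_integral s (fun x => g (enorm x) * peval p x) = \int[n]_r g r].

Lemma integ_bounded_radial (c : {measure set (d.-tuple R) -> \bar R}) p (g : R -> R) C :
  integ c (peval p) -> measurable_fun setT g -> (forall r, 0 <= r -> `|g r| <= C) ->
  integ c (fun x => g (enorm x) * peval p x).
Proof.
move=> i mg gC; apply: (integ_le _ (integZ C (integ_abs i))).
  apply: measurable_funM; last exact: measurable_peval.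
  exact: (measurableT_comp mg (@measurable_enorm R d)).
by move=> x; rewrite normrM ler_wpM2r// gC// enorm_ge0.
Qed.

Let cst1 s p : moment_measure s -> forall m1 m2 : {measure set R -> \bar R},
  (forall g : R -> R, measurable_fun setT g ->
    integ (cpos s) (fun x => g (enorm x) * peval p x) ->
    integ (cneg s) (fun x => g (enorm x) * peval p x) ->
    [/\ integ m1 g, integ m2 g &
    charge_integral s (fun x => g (enorm x) * peval p x) =
      \int[m1]_r g r - \int[m2]_r g r]) ->
  (m1 setT < +oo)%E /\ (m2 setT < +oo)%E.
Proof.
move=> /moment_measureP/(_ p)[ip iN] m1 m2 H.
have b1 (r : R) : 0 <= r -> `|(1 : R)| <= 1 by rewrite normr1.
have [h1 h2 _] := H (fun=> 1) (measurable_cst _)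
  (integ_bounded_radial ip (measurable_cst _) b1)
  (integ_bounded_radial iN (measurable_cst _) b1).
have fin (m : {measure set R -> \bar R}) : integ m (fun=> 1) -> (m setT < +oo)%E.
  move=> /integrableP[_] /=; under eq_integral do rewrite normr1.
  by rewrite integral_cst// mul1e.
by split; exact: fin.
Qed.

Let test_bound (h : R -> R) : test_function h -> forall r, 0 <= r -> `|h r| <= 1.
Proof. by move=> [_ h01 _] r _; have /andP[h0 h1] := h01 r; rewrite ger0_norm. Qed.

(** Non-negativity on test functions gives m2 <= m1 on half-open intervals, and the component is the
    difference measure. *)
Lemma radial_measure_exists s p : moment_measure s ->
  (forall h, test_function h -> 0 <= charge_integral s (fun x => h (enorm x) * peval p x)) ->
  exists n, radial_measure s p n.
Proof.
move=> sm H; have [m1 [m2 [m10 m20 mE]]] := radial_measures s p.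
have [m1oo m2oo] := cst1 sm mE.
have [n nE] : exists n, forall A, measurable A -> m1 A = (m2 A + n A)%E.
  apply: measure_difference => //; apply: le_ocitv_test => // h th.
  have [ip iN] := (moment_measureP s).1 sm p.
  have mh := test_function_meas th.
  have [_ _ e] := mE h mh (integ_bounded_radial ip mh (test_bound th))
    (integ_bounded_radial iN mh (test_bound th)).
  by rewrite -subr_ge0 -e; exact: H.
have nle A : measurable A -> (n A <= m1 A)%E by move=> mA; rewrite nE// leeDr.
exists n; split.
- by apply/eqP; rewrite eq_le measure_ge0 andbT -m10; exact: nle.
- by apply: le_lt_trans m1oo; exact: nle.
move=> g mg ip iN; have [i1 i2 e] := mE g mg ip iN.
have i3 : integ n g by exact: le_measure_integ nle i1.
split=> //; have [q [qE _ _ qR]] := measure_sum m2 n.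
have e1 A : measurable A -> m1 A = q A by move=> mA; rewrite qE nE.
by rewrite e (eq_measure_Rintegral g e1) qR// addrAC subrr add0r.
Qed.

(** Test functions identify m1 with m2 + n on half-open intervals, hence as measures, and integrals
    of measurable functions follow. *)
Lemma component_radial_measure s p n : moment_measure s -> component_measure s p n ->
  radial_measure s p n.
Proof.
move=> sm cn; have [n0 nfin _] := cn.
have [m1 [m2 [m10 m20 mE]]] := radial_measures s p.
have [m1oo m2oo] := cst1 sm mE.
have noo : (n setT < +oo)%E.
  have := nfin 0%N; under eq_integral do rewrite expr0.
  rewrite (halfline_integral n0); last exact: measurable_cst.
  by rewrite integral_cst// mul1e.
have [q [qE _ qi qR]] := measure_sum m2 n.
have qoo : (q setT < +oo)%E by rewrite qE lte_add_pinfty.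
have test h : test_function h -> \int[m1]_t h t = \int[q]_t h t.
  move=> th; have [ip iN] := (moment_measureP s).1 sm p.
  have mh := test_function_meas th.
  have [_ _ e] := mE h mh (integ_bounded_radial ip mh (test_bound th))
    (integ_bounded_radial iN mh (test_bound th)).
  rewrite qR; [|exact: test_function_integ|exact: test_function_integ].
  have := @component_measure_real R d s p n h 1%:P cn.
  have [ch _ _] := th.
  move=> /(_ (continuous_subspaceT ch)).
  have hb r : 0 <= r -> `|h r| <= (1%:P : {poly R}).[r].
    by move=> r0; rewrite hornerC; exact: test_bound th r r0.
  move=> /(_ hb); rewrite e /Rintegral (halfline_integral n0); last exact/measurable_EFinP.
  by rewrite -/(Rintegral n setT h) => ->; ring.
have e1 A : measurable A -> m1 A = q A.
  apply: ocitv_measure_unique => // a b; apply/eqP; rewrite eq_le.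
  by apply/andP; split; apply: le_ocitv_test => // h th; rewrite test.
split=> // g mg ip iN; have [i1 i2 e] := mE g mg ip iN.
have i3 : integ n g.
  apply: le_measure_integ i1 => A mA; rewrite e1// qE leeDr//.
by split=> //; rewrite e (eq_measure_Rintegral g e1) qR//; ring.
Qed.

End components.

(** * Determinacy implies uniqueness *)

Section determinacy.
Context (R : realType) (d : nat).
Implicit Types (s t : {charge set (d.-tuple R) -> \bar R}) (p : mpoly d R).
Implicit Types n : {measure set R -> \bar R}.

Lemma peval_sqnorm (x : d.-tuple R) : peval (sqnorm R d) x = enorm x ^+ 2.
Proof.
rewrite /peval linear_sum/= /enorm sqr_sqrtr; last by apply: sumr_ge0 => i _; exact: sqr_ge0.
by apply: eq_bigr => i _; rewrite rmorphXn/= mevalXU.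
Qed.

Lemma peval_sqnormX j p (x : d.-tuple R) :
  peval (sqnorm R d ^+ j * p) x = (enorm x ^+ 2) ^+ j * peval p x.
Proof. by rewrite /peval rmorphM rmorphXn/=; congr (_ ^+ _ * _); exact: peval_sqnorm. Qed.

Lemma measurable_psi : measurable_fun setT (@psi R).
Proof. exact: measurable_funX. Qed.

Lemma radial_moment s p n j : moment_measure s -> radial_measure s p n ->
  integ n (fun r => (r ^+ 2) ^+ j) /\
  \int[n]_r (r ^+ 2) ^+ j = charge_integral s (peval (sqnorm R d ^+ j * p)).
Proof.
move=> /moment_measureP sm [_ _ nE].
have e : peval (sqnorm R d ^+ j * p) = (fun x => (enorm x ^+ 2) ^+ j * peval p x).
  by apply/funext => x; exact: peval_sqnormX.
have [ip iN] := sm (sqnorm R d ^+ j * p); rewrite e in ip iN.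
have mg : measurable_fun setT (fun r : R => (r ^+ 2) ^+ j).
  by apply: measurable_funX; exact: measurable_funX.
by have [i <-] := nE (fun r => (r ^+ 2) ^+ j) mg ip iN; rewrite e.
Qed.

Lemma pushforward_psi_moment n (n' : set R -> \bar R) j :
  n' = pushforward n (@psi R) ->
  (\int[n']_(t in `[0%R, +oo[) (t ^+ j)%:E = \int[n]_r ((r ^+ 2) ^+ j)%:E)%E.
Proof.
move=> ->; rewrite ge0_integral_pushforward//.
- rewrite (_ : (@psi R) @^-1` _ = setT)//.
  by apply/seteqP; split => // r _ /=; rewrite in_itv/= andbT sqr_ge0.
- exact: measurable_psi.
- by apply/measurable_EFinP; exact: measurable_funX.
- by move=> y; rewrite inE/= in_itv/= andbT => y0; rewrite lee_fin exprn_ge0.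
Qed.

(** [stieltjes_determined] quantifies over structured measures, whereas [pushforward] enters as a
    bare set function; n' is a structured copy of it on measurable sets. *)
Lemma pushforward_psi_measure n : exists n' : {measure set R -> \bar R},
  [/\ forall A, measurable A -> n' A = pushforward n (@psi R) A, on_halfline n' &
  forall j, (\int[n']_(t in `[0%R, +oo[) (t ^+ j)%:E = \int[n]_r ((r ^+ 2) ^+ j)%:E)%E].
Proof.
have [n' nE] := @weighted_pushforward _ _ R R R n (fun=> 1) (@psi R)
  (measurable_cst _) (fun _ => ler01) measurable_psi.
have n'E A : measurable A -> n' A = pushforward n (@psi R) A.
  move=> mA; have := nE (EFin \o \1_A).
  rewrite integral_indic// setIT => ->; [|exact/measurable_EFinP|by move=> y; rewrite lee_fin].
  under eq_integral do rewrite mul1e.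
  transitivity (\int[n]_x (\1_(@psi R @^-1` A) x)%:E)%E => //.
  rewrite integral_indic ?setIT// -[X in measurable X]setTI.
  exact: measurable_psi.
have n'0 : on_halfline n'.
  rewrite /on_halfline n'E// /pushforward (_ : _ @^-1` _ = set0) ?measure0//.
  by apply/seteqP; split => // r /=; rewrite in_itv/= ltNge sqr_ge0.
exists n'; split=> // j.
have mj : measurable_fun setT (fun t : R => (t ^+ j)%:E).
  by apply/measurable_EFinP; exact: measurable_funX.
(* The transport formula asks for a function that is non-negative on the whole line; |t|^j agrees
   with t^j where n' has its mass. *)
have mj' : measurable_fun setT (fun t : R => (`|t| ^+ j)%:E).
  by apply/measurable_EFinP; apply: measurable_funX; exact: normr_measurable.
transitivity (\int[n']_(t in `[0%R, +oo[) (`|t| ^+ j)%:E)%E.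
  by apply: eq_integral => t; rewrite inE/= in_itv/= andbT => t0; rewrite ger0_norm.
rewrite halfline_integral// nE//; apply: eq_integral => r _.
by rewrite mul1e ger0_norm// /psi sqr_ge0.
Qed.

(** The square root inverts [psi] on the half-line that carries both measures. *)
Lemma pushforward_psi_inj n1 n2 : on_halfline n1 -> on_halfline n2 ->
  (forall A, measurable A -> pushforward n1 (@psi R) A = pushforward n2 (@psi R) A) ->
  forall A, measurable A -> n1 A = n2 A.
Proof.
move=> n10 n20 h A mA.
have key n : on_halfline n -> n A = pushforward n (@psi R) (@Num.sqrt R @^-1` A).
  move=> n0; rewrite /pushforward.
  have mB : measurable (@Num.sqrt R @^-1` A).
    rewrite -[X in measurable X]setTI.
    exact: (continuous_measurable_fun (@sqrt_continuous R)).
  have mB' : measurable (@psi R @^-1` (@Num.sqrt R @^-1` A)).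
    by rewrite -[X in measurable X]setTI; exact: measurable_psi.
  transitivity (\int[n]_x (\1_A x)%:E)%E; first by rewrite integral_indic// setIT.
  transitivity (\int[n]_x (\1_(@psi R @^-1` (@Num.sqrt R @^-1` A)) x)%:E)%E; last first.
    by rewrite integral_indic// setIT.
  apply: ae_eq_integral => //; [exact/measurable_EFinP|exact/measurable_EFinP|].
  exists `]-oo, 0[%classic; split => // r /= /not_implyP[_ hr].
  rewrite in_itv/= ltNge; apply/negP => r0; apply: hr; congr EFin.
  rewrite !indicE; congr (_%:R); congr nat_of_bool.
  by apply/idP/idP; rewrite !inE /preimage/= sqrtr_sqr ger0_norm.
rewrite (key n1)// (key n2)// h//.
rewrite -[X in measurable X]setTI.
exact: (continuous_measurable_fun (@sqrt_continuous R)).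
Qed.

(** The Stieltjes moment of order j of the image of a component is the integral of the polynomial
    |x|^2j p, which is the same for [s] and [t]. *)
Lemma determined_radial s t p n1 n2 : moment_measure s -> moment_measure t ->
  (forall q, charge_integral t (peval q) = charge_integral s (peval q)) ->
  radial_measure s p n1 -> radial_measure t p n2 ->
  stieltjes_determined (pushforward n1 (@psi R)) ->
  forall A, measurable A -> n2 A = n1 A.
Proof.
move=> sm tm st r1 r2 det.
have [n' [n'E n'0 n'j]] := pushforward_psi_measure n2.
have [n10 _ _] := r1; have [n20 _ _] := r2.
apply: pushforward_psi_inj => // A mA; rewrite -n'E//; apply: det => //.
move=> j; rewrite n'j (pushforward_psi_moment _ (erefl _)).
have [i1 e1] := radial_moment j sm r1; have [i2 e2] := radial_moment j tm r2.
by rewrite -!RintE// e1 e2 st.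
Qed.

End determinacy.

(** * Measures on R^d determined by polynomials on balls *)

Section tuple_measures.
Context (R : realType) (d : nat).
Implicit Types m : {measure set (d.-tuple R) -> \bar R}.

Definition orthant (c : 'I_d -> R) : set (d.-tuple R) := [set x | forall i, tnth x i < c i].

Lemma measurable_orthant c : measurable (orthant c).
Proof.
rewrite (_ : orthant c = \bigcap_(i in [set: 'I_d]) [set x | tnth x i < c i]); last first.
  by apply/seteqP; split => x /= h i; [move=> _; exact: h|exact: (h i I)].
apply: fin_bigcap_measurable => [|i _]; first exact: finite_finset.
rewrite (_ : [set _ | _] = setT `&` (@tnth d R ^~ i) @^-1` `]-oo, (c i)[%classic).
  by apply: (@measurable_tnth _ R d i) => //; exact: measurable_itv.
by rewrite setTI; apply/seteqP; split => x /=; rewrite in_itv.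
Qed.

Lemma tnth_le_enorm (x : d.-tuple R) i : `|tnth x i| <= enorm x.
Proof.
rewrite -sqrtr_sqr ler_wsqrtr// (bigD1 i)//= lerDl sumr_ge0// => j _.
exact: sqr_ge0.
Qed.

Let orthants := [set A | exists c, A = orthant c].

Let cover : \bigcup_n orthant (fun=> n%:R) = setT.
Proof.
apply/seteqP; split => // x _; exists (Num.trunc (enorm x)).+1 => // i.
by apply: (le_lt_trans _ (truncnS_gt (enorm x))); rewrite (le_trans (ler_norm _))// tnth_le_enorm.
Qed.

Lemma measurable_orthantsE : @measurable _ (d.-tuple R) = <<s orthants >>.
Proof.
apply/seteqP; split; last first.
  apply: smallest_sub; first exact: sigma_algebra_measurable.
  by move=> _ [c ->]; exact: measurable_orthant.
pose T := g_sigma_algebraType orthants.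
have mi i : @measurable_fun _ _ T R setT (@tnth d R ^~ i).
  have H := @measurability _ _ T R setT (@tnth d R ^~ i) _ (RGenInftyO.measurableE R).
  apply: H => _ [_ [c ->] <-].
  (* A half-space bounding coordinate i is a countable union of orthants whose remaining bounds n
     grow. *)
  rewrite (_ : _ `&` _ = \bigcup_n orthant (fun j => if j == i then Num.min c n%:R else n%:R)).
    apply: bigcupT_measurable => n; apply: sub_sigma_algebra.
    by exists (fun j => if j == i then Num.min c n%:R else n%:R).
  apply/seteqP; split => [x [_]|x [n _ /(_ i)]]/=; last first.
    by rewrite eqxx lt_min in_itv/= => /andP[].
  have : (\bigcup_n orthant (fun=> n%:R)) x by rewrite cover.
  move=> [n _ xn]; rewrite in_itv/= => xc; exists n => // j.
  by case: eqP => [->|_]; rewrite ?lt_min ?xc/=; exact: xn.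
have mid : @measurable_fun _ _ T (d.-tuple R) setT id.
  by apply/measurable_fun_tnthP => i; exact: mi.
by move=> A mA; have := mid measurableT A mA; rewrite setTI.
Qed.

Lemma orthant_measure_unique m1 m2 : (m1 setT < +oo)%E ->
  (forall c, m1 (orthant c) = m2 (orthant c)) ->
  forall A, measurable A -> m1 A = m2 A.
Proof.
move=> m1oo h A mA.
apply: (@measure_unique _ R _ orthants (fun n => orthant (fun=> n%:R))) => //.
- exact: measurable_orthantsE.
- move=> _ _ [c ->] [c' ->]; exists (fun i => Num.min (c i) (c' i)).
  apply/seteqP; split => x; first by move=> [h1 h2] i; rewrite lt_min h1 h2.
  by move=> h0; split=> i; have := h0 i; rewrite lt_min => /andP[].
- by move=> n; exists (fun=> n%:R).
- by move=> _ [c ->].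
- move=> n; apply: le_lt_trans m1oo; apply: le_measure; rewrite ?inE//.
  exact: measurable_orthant.
Qed.

Definition cball (rho : R) : set (d.-tuple R) := [set x | enorm x <= rho].

Lemma measurable_cball rho : measurable (cball rho).
Proof.
rewrite (_ : cball rho = setT `&` @enorm R d @^-1` `]-oo, rho]%classic).
  by apply: measurable_enorm => //; exact: measurable_itv.
by rewrite setTI; apply/seteqP; split => x /=; rewrite in_itv.
Qed.

Lemma peval_bounded rho (p : mpoly d R) :
  exists C, forall x, enorm x <= rho -> `|peval p x| <= C.
Proof.
elim/mpolyind: p => [|c m p _ _ [C IH]].
  by exists 0 => x _; rewrite /peval meval0 normr0.
exists (`|c| * \prod_(i < d) rho ^+ m i + C) => x xr.
rewrite /peval mevalD mevalZ mevalX; apply: (le_trans (ler_normD _ _)).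
apply: lerD (IH _ xr); rewrite normrM ler_wpM2l// normr_prod.
apply: ler_prod => i _; rewrite normr_ge0/= normrX.
have r0 : 0 <= rho := le_trans (enorm_ge0 x) xr.
by apply: lerXn2r; rewrite ?nnegrE//; exact: le_trans (tnth_le_enorm x i) xr.
Qed.

Lemma cball_moments_unique m1 m2 rho : (m1 setT < +oo)%E -> (m2 setT < +oo)%E ->
  (forall p, \int[m1]_x (\1_(cball rho) x * peval p x) =
             \int[m2]_x (\1_(cball rho) x * peval p x)) ->
  forall A, measurable A -> m1 (A `&` cball rho) = m2 (A `&` cball rho).
Proof.
move=> m1oo m2oo H.
have mB := measurable_cball rho.
pose w (x : d.-tuple R) : R := \1_(cball rho) x.
have w0 x : 0 <= w x by rewrite /w indicE.
have mw : measurable_fun setT w by exact: measurable_indic.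
have restr m : (m setT < +oo)%E -> exists n : {measure set (d.-tuple R) -> \bar R},
    [/\ (n setT < +oo)%E, forall A, measurable A -> n A = m (A `&` cball rho) &
    forall g : d.-tuple R -> R, measurable_fun setT g -> \int[n]_y g y = \int[m]_x (w x * g x)].
  move=> moo; have [n [nE _ nR]] := weighted_pushforward_real m mw w0 (@measurable_id _ _ setT).
  have nA A : measurable A -> n A = m (A `&` cball rho).
    move=> mA; have := nE (EFin \o \1_A).
    rewrite integral_indic// setIT => ->; [|exact/measurable_EFinP|by move=> y; rewrite lee_fin].
    transitivity (\int[m]_x (\1_(A `&` cball rho) x)%:E)%E; last first.
      by rewrite integral_indic ?setIT//; exact: measurableI.
    by apply: eq_integral => x _; rewrite /= -EFinM mulrC indicI.
  exists n; split=> //; rewrite nA// setTI; apply: le_lt_trans moo.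
  by apply: le_measure; rewrite ?inE.
have [n1 [n1oo n1A n1R]] := restr m1 m1oo; have [n2 [n2oo n2A n2R]] := restr m2 m2oo.
(* Polynomials are unbounded off the ball. Replacing p(x) there by p(0) makes them bounded and still
   gives an algebra, since evaluation at 0 is a ring morphism. *)
pose cl p (x : d.-tuple R) := if enorm x <= rho then peval p x else meval (fun=> 0) p.
have mcl p : measurable_fun setT (cl p).
  apply: measurable_fun_ifT => //; last exact: measurable_peval.
  by apply: measurable_fun_ler => //; exact: measurable_enorm.
suff h A : measurable A -> n1 A = n2 A by move=> A mA; rewrite -n1A// -n2A// h.
apply: orthant_measure_unique => // c.
have e (n m : {measure set (d.-tuple R) -> \bar R}) :
    (forall A, measurable A -> n A = m (A `&` cball rho)) ->
    n (orthant c) = n [set x | forall i, cl (mpolyX R (mnm1 i)) x < c i].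
  move=> nA; have mo := measurable_orthant c; rewrite nA// nA//.
    congr (m _); apply/seteqP; split => x [h xr]; split => // i; have := h i.
      by rewrite /cl xr /peval mevalXU.
    by rewrite /cl xr /peval mevalXU.
  rewrite (_ : [set _ | _] = \bigcap_(i in [set: 'I_d])
      (setT `&` cl (mpolyX R (mnm1 i)) @^-1` `]-oo, (c i)[%classic)).
    apply: fin_bigcap_measurable => [|i _]; first exact: finite_finset.
    by apply: mcl => //; exact: measurable_itv.
  apply/seteqP; split => x /= h i.
    by move=> _; split => //=; rewrite in_itv/=; exact: h.
  by have [_ /=] := h i I; rewrite in_itv.
rewrite (e _ _ n1A) (e _ _ n2A).
apply: (@bounded_algebra_sublevel _ _ R n1 n2 n1oo n2oo
  [set f | exists p, f = cl p]).
- by move=> _ [p ->].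
- move=> _ [p ->]; have [C hC] := peval_bounded rho p.
  exists (Num.max C `|meval (fun=> 0) p|) => x; rewrite /cl le_max.
  by case: ifP => [/hC ->//|_]; rewrite lexx orbT.
- by move=> k; exists (mpolyC d k); apply/funext => x; rewrite /cl /peval !mevalC if_same.
- move=> _ _ [p ->] [q ->]; exists (p + q); apply/funext => x.
  by rewrite /cl /peval; case: ifP => _; rewrite mevalD.
- move=> _ _ [p ->] [q ->]; exists (p * q); apply/funext => x.
  by rewrite /cl /peval; case: ifP => _; rewrite mevalM.
- move=> _ [p ->]; rewrite n1R// n2R//.
  have e0 (m : {measure set (d.-tuple R) -> \bar R}) :
      \int[m]_x (w x * cl p x) = \int[m]_x (\1_(cball rho) x * peval p x).
    apply: eq_Rintegral => x _; rewrite /w /cl indicE.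
    case: ifP => // xr; rewrite (_ : x \in cball rho = false) ?mul0r//.
    by apply/negbTE/negP; rewrite inE /cball/= xr.
  by rewrite !e0.
- by move=> i; exists (mpolyX R (mnm1 i)).
Qed.

Lemma cball_measure_unique m1 m2 : (forall n A, measurable A ->
    m1 (A `&` cball n%:R) = m2 (A `&` cball n%:R)) ->
  forall A, measurable A -> m1 A = m2 A.
Proof.
move=> h A mA.
have e : A = \bigcup_n (A `&` cball n%:R).
  apply/seteqP; split => [x Ax|x [n _ []]//].
  exists (Num.trunc (enorm x)).+1 => //; split => //=; rewrite /cball/=.
  exact: ltW (truncnS_gt _).
have lim m : m (A `&` cball n%:R) @[n --> \oo] --> m A.
  rewrite {2}e; apply: nondecreasing_cvg_mu.
  - by move=> i; apply: measurableI => //; exact: measurable_cball.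
  - by rewrite -e.
  - move=> i j ij; apply/subsetPset; apply: setIS => x /=; rewrite /cball/= => /le_trans; apply.
    by rewrite ler_nat.
rewrite -(cvg_lim _ (lim m1))// -(cvg_lim _ (lim m2))//.
by under eq_fun do rewrite h//.
Qed.

End tuple_measures.

Section charge_linearity.
Context d (T : measurableType d) (R : realType) (s : {charge set T -> \bar R}).
Implicit Types f g : T -> R.

Definition cinteg f := integ (cpos s) f /\ integ (cneg s) f.

Lemma cintegD f g : cinteg f -> cinteg g -> cinteg (fun x => f x + g x).
Proof. by move=> [? ?] [? ?]; split; exact: integD. Qed.

Lemma cintegZ c f : cinteg f -> cinteg (fun x => c * f x).
Proof. by move=> [? ?]; split; exact: integZ. Qed.

Lemma charge_integralD f g : cinteg f -> cinteg g ->
  charge_integral s (fun x => f x + g x) = charge_integral s f + charge_integral s g.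
Proof.
move=> [f1 f2] [g1 g2]; rewrite /charge_integral -/(cpos s) -/(cneg s).
by rewrite !RintD//; ring.
Qed.

Lemma charge_integralZ c f : cinteg f ->
  charge_integral s (fun x => c * f x) = c * charge_integral s f.
Proof.
move=> [f1 f2]; rewrite /charge_integral -/(cpos s) -/(cneg s).
by rewrite !RintZ//; ring.
Qed.

Lemma charge_integral_sum I (r : seq I) (F : I -> T -> R) : (forall i, cinteg (F i)) ->
  cinteg (fun x => \sum_(i <- r) F i x) /\
  charge_integral s (fun x => \sum_(i <- r) F i x) = \sum_(i <- r) charge_integral s (F i).
Proof.
move=> h; split; first by split; apply: integ_sum => i; have [] := h i.
rewrite /charge_integral -/(cpos s) -/(cneg s) sumrB.
by rewrite !Rint_sum// => i; have [] := h i.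
Qed.

End charge_linearity.

Section charge_determinacy.
Context (R : realType) (d : nat).
Implicit Types (s t : {charge set (d.-tuple R) -> \bar R}) (p : mpoly d R).

Lemma cinteg_cball s p rho : moment_measure s -> cinteg s (fun x => \1_(cball rho) x * peval p x).
Proof.
move=> /moment_measureP/(_ p)[ip iN].
have key (m : {measure set (d.-tuple R) -> \bar R}) : integ m (peval p) ->
    integ m (fun x => \1_(cball rho) x * peval p x).
  move=> i; apply: (integ_le _ (integ_abs i)).
    apply: measurable_funM; last exact: measurable_peval.
    by apply: measurable_indic; exact: measurable_cball.
  by move=> x; rewrite normrM indicE; case: (_ \in _); rewrite ?normr1 ?normr0 ?mul1r ?mul0r.
by split; exact: key.
Qed.

Lemma cball_charge_unique s t : moment_measure s -> moment_measure t ->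
  (forall n p, charge_integral s (fun x => \1_(cball n%:R) x * peval p x) =
               charge_integral t (fun x => \1_(cball n%:R) x * peval p x)) ->
  forall A, measurable A -> s A = t A.
Proof.
move=> sm tm H.
(* Equality of the charges is rearranged into s+ + t- = s- + t+, an equality of finite measures. *)
have [a [aE _ _ aR]] := measure_sum (cpos s) (cneg t).
have [b [bE _ _ bR]] := measure_sum (cneg s) (cpos t).
have aoo : (a setT < +oo)%E by rewrite aE lte_add_pinfty// ?cpos_lty ?cneg_lty.
have boo : (b setT < +oo)%E by rewrite bE lte_add_pinfty// ?cpos_lty ?cneg_lty.
have ab : forall A, measurable A -> a A = b A.
  apply: cball_measure_unique => n; apply: cball_moments_unique => // p.
  have [s1 s2] := cinteg_cball p n%:R sm; have [t1 t2] := cinteg_cball p n%:R tm.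
  rewrite aR// bR//; have := H n p; rewrite /charge_integral -/(cpos s) -/(cneg s).
  by rewrite -/(cpos t) -/(cneg t) => h; lra.
move=> A mA; have := ab A mA; rewrite aE bE !charge_jordan//.
have := fin_num_lty (cpos_lty s) mA; have := fin_num_lty (cneg_lty s) mA.
have := fin_num_lty (cpos_lty t) mA; have := fin_num_lty (cneg_lty t) mA.
move=> /fineK <- /fineK <- /fineK <- /fineK <-.
by rewrite -!EFinB -!EFinD => -[h]; congr EFin; lra.
Qed.

End charge_determinacy.

Section determined_unique.
Context (R : realType) (d : nat).
Variables (a : nat -> nat) (Y : forall k, 'I_(a k) -> mpoly d R).
Arguments Y : clear implicits.
Hypothesis d0 : (0 < d)%N.
Hypothesis Yspan : forall k p, harmonic_homog k p ->
  exists c : 'I_(a k) -> R, p = \sum_(l < a k) c l *: Y k l.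
Implicit Types (s t : {charge set (d.-tuple R) -> \bar R}).

Lemma pseudo_positive_radial s : moment_measure s -> pseudo_positive Y s ->
  forall k l, exists n, radial_measure s (Y k l) n.
Proof.
move=> sm sp k l; apply: radial_measure_exists => // h [ch h01 hc].
apply: sp => //; first exact: continuous_subspaceT.
by move=> r _; have /andP[] := h01 r.
Qed.

(** Equal components give equal integrals of g(|x|) Y_kl for every bounded measurable [g], not only
    for polynomials. Cutting r^2j off at [rho] reaches all polynomials restricted to a ball, and
    these do determine the charge. *)
Lemma determined_unique s (sc : forall k, 'I_(a k) -> {measure set R -> \bar R}) :
  moment_measure s -> (forall k l, radial_measure s (Y k l) (sc k l)) ->
  (forall k l, stieltjes_determined (pushforward (sc k l) (@psi R))) ->
  forall t, solution_set Y s t -> forall A, measurable A -> t A = s A.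
Proof.
move=> sm sr det t [tm tp /same_cmomentsP te].
apply: cball_charge_unique => // n; set rho : R := n%:R; apply: harmonic_ind => //.
- have e : (fun x => \1_(cball rho) x * peval 0 x) = (fun=> 0) :> (d.-tuple R -> R).
    by apply/funext => x; rewrite /peval meval0 mulr0.
  by rewrite e /charge_integral !Rint0.
- move=> p q pE qE.
  have e : (fun x => \1_(cball rho) x * peval (p + q) x) =
      (fun x => \1_(cball rho) x * peval p x + \1_(cball rho) x * peval q x).
    by apply/funext => x; rewrite /peval mevalD mulrDr.
  by rewrite e !charge_integralD ?pE ?qE//; exact: cinteg_cball.
move=> j k h /Yspan[c ->].
pose g (r : R) := if r <= rho then (r ^+ 2) ^+ j else 0.
have mg : measurable_fun setT g.
  apply: measurable_fun_ifT => //; first exact: measurable_fun_ler.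
  by apply: measurable_funX; exact: measurable_funX.
have gC r : 0 <= r -> `|g r| <= (rho ^+ 2) ^+ j.
  move=> r0; rewrite /g; case: ifP => rr; last by rewrite normr0 !exprn_ge0.
  by rewrite ger0_norm ?exprn_ge0// !lerXn2r ?nnegrE ?exprn_ge0// (le_trans r0).
have e : (fun x => \1_(cball rho) x * peval (sqnorm R d ^+ j * \sum_(l < a k) c l *: Y k l) x) =
    (fun x => \sum_(l < a k) c l * (g (enorm x) * peval (Y k l) x)).
  apply/funext => x; rewrite peval_sqnormX /peval linear_sum/= !mulr_sumr.
  apply: eq_bigr => l _; rewrite mevalZ /g indicE.
  case: ifP => xr; last first.
    rewrite (_ : x \in cball rho = false) ?mul0r ?mulr0//.
    by apply/negbTE/negP; rewrite inE /cball/= xr.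
  by rewrite mem_set// mul1r mulrCA.
have ci u : moment_measure u -> forall l, cinteg u (fun x => g (enorm x) * peval (Y k l) x).
  move=> um l; have [i1 i2] := (moment_measureP u).1 um (Y k l).
  by split; exact: (integ_bounded_radial _ mg gC).
rewrite e; have ci' u um l := cintegZ (c l) (ci u um l).
rewrite (charge_integral_sum _ (ci' t tm)).2 (charge_integral_sum _ (ci' s sm)).2.
apply: eq_bigr => l _; rewrite !charge_integralZ; [|exact: ci|exact: ci].
have [n' tr] := pseudo_positive_radial tm tp l.
have eq := determined_radial sm tm te (sr k l) tr (det k l).
have [_ _ /(_ g mg)] := sr k l; have [s1 s2] := ci s sm l.
move=> /(_ s1 s2)[_ ->].
have [_ _ /(_ g mg)] := tr; have [t1 t2] := ci t tm l.
move=> /(_ t1 t2)[_ ->].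
by rewrite (eq_measure_Rintegral g eq).
Qed.

End determined_unique.

(** * Gaussian and surface integrals *)

Section gaussian_moments.
Context (R : realType).
Local Notation leb := (@lebesgue_measure R).
Implicit Types f : R -> R.

Lemma lebesgue_scale (r : R) : 0 < r -> forall f : measurableTypeR R -> \bar R,
  measurable_fun setT f -> (forall x, 0 <= f x)%E ->
  (\int[leb]_x f x = \int[leb]_x (r%:E * f (r * x)%R))%E.
Proof.
move=> r0 f mf f0.
have mr : measurable_fun setT (fun x : measurableTypeR R => r * x : measurableTypeR R).
  have H : measurable_fun setT ( *%R r) by apply: continuous_measurable_fun; exact: mulrl_continuous.
  exact: H.
have [n nE] := @weighted_pushforward _ _ (measurableTypeR R) (measurableTypeR R) R leb
  (fun=> r) (fun x => r * x) (measurable_cst _) (fun _ => ltW r0) mr.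
rewrite -nE//; apply: eq_measure_integral => A mA _.
apply: lebesgue_measure_unique => // _ [[a b] _ <-]/=.
have e : n `]a, b]%classic = (\int[n]_x (\1_(`]a, b]%classic) x)%:E)%E.
  by rewrite integral_indic ?setIT//; exact: measurable_itv.
have mab : @measurable _ (measurableTypeR R) `]a, b]%classic by exact: measurable_itv.
apply/esym; rewrite [LHS]e nE; last 2 first.
- exact/measurable_EFinP/measurable_indic.
- by move=> y; rewrite lee_fin indicE.
rewrite ge0_integralZl//; last first.
- by rewrite lee_fin ltW.
- by apply/measurable_EFinP; exact: (measurableT_comp (@measurable_indic _ (measurableTypeR R) R setT _ mab) mr).
have -> : (\int[leb]_x (\1_(`]a, b]%classic) (r * x)%R)%:E =
    \int[leb]_x (\1_(`]a / r, b / r]%classic) x)%:E)%E.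
  apply: eq_integral => x _; congr EFin; rewrite !indicE !mem_setE !in_itv/=.
  by rewrite ltr_pdivrMr// ler_pdivlMr// mulrC.
rewrite integral_indic ?setIT//.
have h (u v : R) : leb `]u, v]%classic = if u < v then (v - u)%:E else 0%E.
  by rewrite lebesgue_measure_itv/= lte_fin.
apply: (etrans (congr1 (fun z => r%:E * z)%E (h (a / r) (b / r)))).
apply: (etrans _ (esym (h a b))).
have -> : (a / r < b / r) = (a < b) by rewrite ltr_pM2r ?invr_gt0.
case: ifP => _; last by rewrite mule0.
by rewrite -EFinM; congr EFin; field; lra.
Qed.

Lemma integ_gauss_half : integ leb (fun x => gauss_fun (x / 2)).
Proof.
have mg : measurable_fun setT (fun x : measurableTypeR R => (gauss_fun x)%:E).
  by apply/measurable_EFinP; exact: measurable_gauss_fun.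
have mg2 : measurable_fun setT (fun x : measurableTypeR R => (gauss_fun (x / 2))%:E).
  apply/measurable_EFinP; apply: (measurableT_comp (@measurable_gauss_fun R)).
  by apply: measurable_funM => //; exact: measurable_id.
apply/integrableP; split => //=.
under eq_integral do rewrite ger0_norm ?gauss_fun_ge0//.
have h0 : 0 < (2^-1 : R) by rewrite invr_gt0.
(* Rescaling equates the finite Gaussian integral with half of the integral of gauss(x/2), which
   excludes the value +oo for the latter. *)
have := lebesgue_scale h0 mg (fun x => (gauss_fun_ge0 x : (0 <= (gauss_fun x)%:E)%E)).
rewrite integralT_gauss ge0_integralZl//; last 2 first.
- by under eq_fun do rewrite mulrC.
- by move=> x _; rewrite lee_fin gauss_fun_ge0.
under eq_integral do rewrite mulrC.
case: (integral _ _ _) => [r _|h|_]; [exact: ltry| |by []].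
by rewrite gt0_muley ?lte_fin// in h.
Qed.

Lemma gauss_decay n : exists C, forall x : R, `|x| ^+ n * gauss_fun x <= C * gauss_fun (x / 2).
Proof.
(* With u = x/2, the term u^(2n+2)/(n+1)! of the exponential series bounds |u|^n by (n+1)! exp(u^2)
   for |u| > 1, and the summand 1 handles |u| <= 1. Since exp(-4u^2) <= exp(-2u^2), a factor
   exp(-u^2) is left over. *)
exists (2 ^+ n * (1 + n.+1`!%:R)) => x; set u := x / 2.
have -> : x = 2 * u by rewrite /u; field.
rewrite normrM normr_nat exprMn -!mulrA ler_wpM2l ?exprn_ge0//.
have u0 : 0 <= u ^+ 2 := sqr_ge0 u.
have e1 : 1 <= expR (u ^+ 2) by rewrite -expR0 ler_expR.
have e2 : `|u| ^+ n <= (1 + n.+1`!%:R) * expR (u ^+ 2).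
  rewrite mulrDl mul1r; have [u1|u1] := leP `|u| 1.
    apply: (@le_trans _ _ 1); first by rewrite exprn_ile1.
    by rewrite (le_trans e1)// lerDl mulr_ge0// expR_ge0.
  apply: (@le_trans _ _ (n.+1`!%:R * expR (u ^+ 2))); last by rewrite lerDr expR_ge0.
  rewrite mulrC -ler_pdivrMr ?ltr0n ?fact_gt0//.
  apply: (le_trans _ (expR_ge1Dxn n u0)).
  apply: (@le_trans _ _ ((u ^+ 2) ^+ n.+1 / n.+1`!%:R)); last by rewrite lerDr.
  rewrite ler_pM2r ?invr_gt0 ?ltr0n ?fact_gt0//.
  rewrite (_ : (u ^+ 2) ^+ n.+1 = `|u| ^+ (2 * n.+1)); last by rewrite exprM -normrX ger0_norm.
  by apply: ler_weXn2l; [exact: ltW|lia].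
have e3 : gauss_fun (2 * u) <= expR (- u ^+ 2) * expR (- u ^+ 2).
  by rewrite -expRD ler_expR exprMn; lra.
apply: (le_trans (ler_wpM2r (gauss_fun_ge0 _) e2)).
apply: (le_trans (ler_wpM2l _ e3)); first by rewrite mulr_ge0 ?expR_ge0.
by rewrite -!mulrA ler_wpM2l// mulrA -expRD subrr expR0 mul1r.

Qed.

Lemma integ_gauss_moment n : integ leb (fun x => x ^+ n * gauss_fun x).
Proof.
have [C hC] := gauss_decay n.
apply: (integ_le _ (integZ C integ_gauss_half)).
  by apply: measurable_funM; [exact: measurable_funX|exact: measurable_gauss_fun].
move=> x; rewrite normrM normrX (ger0_norm (gauss_fun_ge0 _)); exact: hC.
Qed.

Definition gauss_moment n := \int[leb]_x (x ^+ n * gauss_fun x).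

(** The fundamental theorem of calculus on [-M, M] leaves boundary terms of size C/M, and dominated
    convergence lets M tend to infinity. *)
Lemma Rint_derivative (F f : R -> R) C : (forall x : R, is_derive x (1 : R) F (f x)) -> continuous f ->
  integ leb f -> (forall x, `|x| * `|F x| <= C) -> \int[leb]_x f x = 0.
Proof.
move=> dF cf fi FC.
have cF x : F @ x --> F x.
  by apply: differentiable_continuous; apply/derivable1_diffP; have [] := dF x.
pose M n : R := n.+1%:R.
have M0 n : 0 < M n by rewrite ltr0n.
have step n : (\int[leb]_(x in `[(- M n)%R, M n]) (f x)%:E = (F (M n) - F (- M n))%:E)%E.
  rewrite (@continuous_FTC2 _ f F).
  - by rewrite EFinB.
  - by rewrite gtrN.
  - exact: continuous_subspaceT.
  - split; first by move=> x _; have [] := dF x.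
    + exact: cvg_at_right_filter.
    + exact: cvg_at_left_filter.
  - by move=> x _; rewrite derive1E; have [_ ->] := dF x.
have lim0 : (F (M n) - F (- M n))%:E @[n --> \oo] --> 0%E.
  apply: cvg_EFin; first exact: nearW.
  rewrite -[X in _ --> X](subrr (0:R)).
  have F0 (e : R) : `|e| = 1 -> F (e * M n) @[n --> \oo] --> 0.
    move=> e1; apply/norm_cvg0P.
    apply: (@squeeze_cvgr _ _ _ _ (fun=> 0) (fun n => C * n.+1%:R^-1)).
    - apply: nearW => n; rewrite normr_ge0/= ler_pdivlMr//.
      by have := FC (e * M n); rewrite normrM e1 mul1r (gtr0_norm (M0 n)) mulrC.
    - exact: cvg_cst.
    - rewrite -(mulr0 C); apply: cvgM; first exact: cvg_cst.
      exact: cvg_harmonic.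
  apply: cvgB.
    by have := F0 1 (normr1 _); under eq_fun do rewrite mul1r.
  by have := F0 (-1) (normrN1 _); under eq_fun do rewrite mulN1r.
have limf : (\int[leb]_x (\1_(`[(- M n)%R, M n]%classic) x * f x)%:E)%E @[n --> \oo] -->
    (\int[leb]_x (f x)%:E)%E.
  have mf := integ_meas fi.
  have [|||||_ _ cv] := @dominated_convergence _ (measurableTypeR R) R leb setT measurableT
    (fun n x => (\1_(`[(- M n)%R, M n]%classic) x * f x)%:E) (EFin \o f) (fun x => `|f x|%:E).
  - move=> n; apply/measurable_EFinP; apply: measurable_funM => //.
  - exact/measurable_EFinP.
  - apply: aeW => x _ /=; apply: cvg_EFin; first exact: nearW.
    apply: (@cvg_trans _ ((fun=> f x) @ \oo)); last exact: cvg_cst.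
    apply: near_eq_cvg; exists (Num.trunc `|x|) => // n /= xn.
    rewrite indicE mem_setE in_itv/= -ler_norml (_ : `|x| <= M n) ?mul1r//.
    by rewrite (le_trans (ltW (truncnS_gt _)))// ler_nat ltnS.
  - exact: integ_abs.
  - apply: aeW => x n _ /=; rewrite lee_fin normrM indicE.
    by case: (_ \in _); rewrite ?normr1 ?mul1r// normr0 mul0r.
  - exact: cv.
have e n : (\int[leb]_x (\1_(`[(- M n)%R, M n]%classic) x * f x)%:E = (F (M n) - F (- M n))%:E)%E.
  rewrite -step [RHS]integral_mkcond; apply: eq_integral => x _.
  by rewrite patchE indicE; case: ifP => _; rewrite ?mul1r// mul0r.
rewrite (funext e) in limf.
by have := cvg_unique _ limf lim0; rewrite /Rintegral => ->.
Qed.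

(** The integral of the derivative of x^n exp(-x^2) vanishes. At n = 0 the factor n cancels the
    default value of n.-1. *)
Lemma gauss_moment_rec n : 2 * gauss_moment n.+1 = n%:R * gauss_moment n.-1.
Proof.
have i1 := integ_gauss_moment n.+1; have i2 := integ_gauss_moment n.-1.
apply/eqP; rewrite eq_sym -subr_eq0; apply/eqP.
rewrite /gauss_moment -(RintZ _ i2) -(RintZ _ i1) -RintB; [|exact: integZ|exact: integZ].
have [C hC] := gauss_decay n.+1.
apply: (@Rint_derivative (fun x => x ^+ n * gauss_fun x) _ `|C|).
- move=> x.
  have d1 : is_derive x (1 : R) (fun x : R => x ^+ n) (n%:R * x ^+ n.-1).
    by apply: DeriveDef; [exact: exprn_derivable|rewrite exp_derive /GRing.scale/= mulr1].
  have d2 : is_derive x (1 : R) (@gauss_fun R) (- 2 * x * gauss_fun x).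
    have := @is_derive1_comp R expR (fun x : R => - x ^+ 2) x (gauss_fun x) (- (2 * x)).
    move=> H; rewrite (_ : - 2 * x * _ = gauss_fun x * - (2 * x)); last by ring.
    apply: H.
    have d : is_derive x (1 : R) (fun x : R => x ^+ 2) (2 * x).
      by apply: DeriveDef; [exact: exprn_derivable|rewrite exp_derive /GRing.scale/= mulr1].
    exact: is_deriveN d.
  apply: is_derive_eq; rewrite /GRing.scale/=; case: n {i1 i2 hC d1} => [|n].
    by rewrite !mul0r expr0 expr1 mulr0 addr0 mul1r sub0r; ring.
  by rewrite /= !exprS; ring.
- have c m (c : R) : continuous (fun x : R => c * (x ^+ m * gauss_fun x)).
    move=> x; apply: cvgM; first exact: cvg_cst.
    by apply: cvgM; [exact: exprn_continuous|exact: continuous_gauss_fun].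
  by move=> x; apply: cvgB; exact: c.
- by apply: integB; exact: integZ.
- move=> x; rewrite normrM mulrA normrX -exprS (ger0_norm (gauss_fun_ge0 _)).
  apply: (le_trans (hC x)); apply: (@le_trans _ _ (`|C| * gauss_fun (x / 2))).
    by rewrite ler_wpM2r ?gauss_fun_ge0// ler_norm.
  by rewrite ler_piMr ?normr_ge0// gauss_fun_le1.
Qed.

End gaussian_moments.

Section product_integrals.
Context d1 d2 (T1 : measurableType d1) (T2 : measurableType d2) (R : realType).
Variables (m1 : {sigma_finite_measure set T1 -> \bar R})
  (m2 : {sigma_finite_measure set T2 -> \bar R}).

Lemma product_integ (f : T1 -> R) (g : T2 -> R) : integ m1 f -> integ m2 g ->
  (m1 \x m2)%E.-integrable setT (fun z => (f z.1 * g z.2)%:E) /\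
  (\int[(m1 \x m2)%E]_z (f z.1 * g z.2)%:E = (\int[m1]_x f x * \int[m2]_y g y)%:E)%E.
Proof.
move=> fi gi; have mf := integ_meas fi; have mg := integ_meas gi.
have mfg : measurable_fun setT (fun z : T1 * T2 => (f z.1 * g z.2)%:E).
  by apply/measurable_EFinP; apply: measurable_funM; exact: measurableT_comp.
have h : (m1 \x m2)%E.-integrable setT (fun z => (f z.1 * g z.2)%:E).
  apply/integrable12ltyP => //.
  have e x : (\int[m2]_y `|(f (x, y).1 * g (x, y).2)%:E| =
      (`|f x| * \int[m2]_y `|g y|)%:E)%E.
    rewrite -RintZ ?RintE//; last 2 first.
    - exact/integZ/integ_abs.
    - exact: integ_abs.
    by apply: eq_integral => y _; rewrite abse_EFin normrM.
  under eq_integral do rewrite e mulrC.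
  rewrite -RintE ?ltry//; exact/integZ/integ_abs.
split=> //; rewrite -integral12_prod_meas1// /fubini_F.
have e x : (\int[m2]_y (f (x, y).1 * g (x, y).2)%:E = (\int[m2]_y g y * f x)%:E)%E.
  by rewrite mulrC -RintZ ?RintE//; exact: integZ.
under eq_integral do rewrite e.
by rewrite -RintE; [rewrite RintZ// mulrC|exact: integZ].
Qed.

End product_integrals.

Section lebesgue_tuple_integrals.
Context (R : realType).
Local Notation leb := (@lebesgue_measure R).
Local Notation lebt n := (@lebesgue_tuple R n).

Lemma lebesgue_tuple_cons n (f : n.+1.-tuple R -> \bar R) :
  measurable_fun setT f -> (forall x, 0 <= f x)%E ->
  (\int[lebt n.+1]_x f x = \int[leb]_r \int[lebt n]_t f (cons_pair (r, t)))%E.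
Proof.
move=> mf f0; have mc := @measurable_cons_pair R n.
rewrite -[LHS]/(\int[pushforward (leb \x lebt n)%E (@cons_pair R n)]_x f x)%E.
rewrite ge0_integral_pushforward// preimage_setT fubini_tonelli1//.
  exact: (measurableT_comp mf mc).
by move=> z; exact: f0.
Qed.

Lemma lebesgue_tuple_product n (h : 'I_n -> R -> R) : (forall i, integ leb (h i)) ->
  integ (lebt n) (fun x => \prod_(i < n) h i (tnth x i)) /\
  \int[lebt n]_x (\prod_(i < n) h i (tnth x i)) = \prod_(i < n) \int[leb]_r h i r.
Proof.
elim: n h => [|n IH] h hi.
  have e : (fun x : 0.-tuple R => \prod_(i < 0) h i (tnth x i)) = fun=> 1.
    by apply/funext => x; rewrite big_ord0.
  rewrite e big_ord0; split.
    by apply: (@integ_bounded _ _ _ _ _ 1) => //= [|x]; rewrite ?normr1// diracE in_setT ltry.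
  by rewrite /Rintegral integral_dirac// diracT mul1e.
have [iH eH] := IH (fun i => h (lift ord0 i)) (fun i => hi _).
have [iP eP] := product_integ (hi ord0) iH.
have ec (z : measurableTypeR R * n.-tuple R) :
    \prod_(i < n.+1) h i (tnth (cons_pair z) i) =
    h ord0 z.1 * \prod_(i < n) h (lift ord0 i) (tnth z.2 i).
  rewrite big_ord_recl; congr (h _ _ * _).
  by apply: eq_bigr => i _; rewrite tnthS.
have mf : measurable_fun setT (fun x : n.+1.-tuple R => (\prod_(i < n.+1) h i (tnth x i))%:E).
  apply/measurable_EFinP; apply: measurable_prod => i _.
  exact: (measurableT_comp (integ_meas (hi i)) (@measurable_tnth _ R n.+1 i)).
have mc := @measurable_cons_pair R n.
have ic : (leb \x lebt n)%E.-integrable (@cons_pair R n @^-1` setT)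
    ((fun x : n.+1.-tuple R => (\prod_(i < n.+1) h i (tnth x i))%:E) \o @cons_pair R n).
  by rewrite preimage_setT; move: iP; under eq_fun do rewrite -ec.
split; first exact: (integrable_pushforward mc mf ic measurableT).
rewrite /Rintegral.
rewrite -[X in fine X]/(\int[pushforward (leb \x lebt n)%E (@cons_pair R n)]_x
  (\prod_(i < n.+1) h i (tnth x i))%:E)%E.
rewrite (integral_pushforward mc mf ic measurableT) preimage_setT.
rewrite big_ord_recl -eH -[RHS]/(fine _%:E) -eP; congr fine.
by apply: eq_integral => z _ /=; rewrite ec.
Qed.

Definition scale_tuple n (r : R) (x : n.-tuple R) : n.-tuple R :=
  [tuple r * tnth x i | i < n].

Lemma measurable_scale_tuple n r : measurable_fun setT (@scale_tuple n r).
Proof.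
apply/measurable_fun_tnthP => i.
rewrite (_ : _ \o _ = fun x => r * tnth x i); last first.
  by apply/funext => x /=; rewrite tnth_mktuple.
by apply: measurable_funM => //; exact: measurable_tnth.
Qed.

Lemma scale_cons_pair n r (z : measurableTypeR R * n.-tuple R) :
  scale_tuple r (cons_pair z) = cons_pair (r * z.1, scale_tuple r z.2).
Proof.
apply: eq_from_tnth => i; rewrite tnth_mktuple.
case: (unliftP ord0 i) => [j ->|->]; first by rewrite !tnthS tnth_mktuple.
by rewrite !tnth0.
Qed.

Lemma lebesgue_tuple_scale n (r : R) : 0 < r -> forall f : n.-tuple R -> \bar R,
  measurable_fun setT f -> (forall x, 0 <= f x)%E ->
  (\int[lebt n]_x f x = (r ^+ n)%:E * \int[lebt n]_x f (scale_tuple r x))%E.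
Proof.
move=> r0; elim: n => [|n IH] f mf f0.
  rewrite expr0 mul1e; apply: eq_integral => x _; congr f.
  by apply: eq_from_tnth => -[].
have mfs : measurable_fun setT (fun x => f (scale_tuple r x)).
  exact: (measurableT_comp mf (@measurable_scale_tuple n.+1 r)).
have mfc := measurableT_comp mf (@measurable_cons_pair R n).
have mfsc := measurableT_comp mfs (@measurable_cons_pair R n).
rewrite !lebesgue_tuple_cons//.
have mpair (x : R) : measurable_fun setT (fun t : n.-tuple R => f (cons_pair (x, t))).
  exact: (measurableT_comp mfc (pair1_measurable x)).
rewrite (lebesgue_scale r0); last 2 first.
- exact: (@measurable_fun_fubini_tonelli_F _ _ _ _ R (lebt n) _ mfc (fun z => f0 (cons_pair z))).
- by move=> x; apply: integral_ge0.
have e (x : R) : (r%:E * \int[lebt n]_t f (cons_pair ((r * x)%R, t)) =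
    (r ^+ n.+1)%:E * \int[lebt n]_t f (scale_tuple r (cons_pair (x, t))))%E.
  rewrite (IH _ (mpair (r * x)))// muleA -EFinM -exprS.
  by congr (_ * _)%E; apply: eq_integral => t _; rewrite scale_cons_pair.
under eq_integral do rewrite e.
rewrite ge0_integralZl// ?lee_fin ?exprn_ge0 ?(ltW r0)//.
- exact: (@measurable_fun_fubini_tonelli_F _ _ _ _ R (lebt n) _ mfsc (fun z => f0 _)).
- by move=> x _; apply: integral_ge0.
Qed.

End lebesgue_tuple_integrals.

Section gaussian_orthogonality.
Context (R : realType) (d : nat).
Local Notation leb := (@lebesgue_measure R).
Local Notation lebd := (@lebesgue_tuple R d).
Local Notation Xi i := (@mpolyX d R (mnm1 i)).
Implicit Types p q : mpoly d R.

Definition gauss_weight (x : d.-tuple R) : R := expR (- enorm x ^+ 2).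

Definition gauss_mean p : R := \int[lebd]_x (peval p x * gauss_weight x).

Let meanX_prod (m : multinom d) :
  integ lebd (fun x => peval (mpolyX R m) x * gauss_weight x) /\
  gauss_mean (mpolyX R m) = \prod_(i < d) gauss_moment R (m i).
Proof.
have [h1 h2] := lebesgue_tuple_product (fun i : 'I_d => integ_gauss_moment R (m i)).
have e (x : d.-tuple R) : peval (mpolyX R m) x * gauss_weight x =
    \prod_(i < d) (tnth x i ^+ m i * gauss_fun (tnth x i)).
  rewrite big_split/= /peval mevalX; congr (_ * _).
  rewrite /gauss_weight /enorm sqr_sqrtr; last by apply: sumr_ge0 => i _; exact: sqr_ge0.
  by rewrite -sumrN expR_sum.
by rewrite /gauss_mean (funext e).
Qed.

Lemma integ_gauss_mean p : integ lebd (fun x => peval p x * gauss_weight x).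
Proof.
elim/mpolyind: p => [|c m p _ _ IH].
  rewrite (_ : (fun _ => _) = fun=> 0); first exact: integ0.
  by apply/funext => x; rewrite /peval meval0 mul0r.
rewrite (_ : (fun _ => _) = fun x => c * (peval (mpolyX R m) x * gauss_weight x) +
  peval p x * gauss_weight x).
  by apply: integD => //; apply: integZ; have [] := meanX_prod m.
by apply/funext => x; rewrite /peval mevalD mevalZ mulrDl mulrA.
Qed.

Lemma gauss_meanD p q : gauss_mean (p + q) = gauss_mean p + gauss_mean q.
Proof.
rewrite /gauss_mean -RintD; [|exact: integ_gauss_mean|exact: integ_gauss_mean].
by apply: eq_Rintegral => x _; rewrite /peval mevalD mulrDl.
Qed.

Lemma gauss_meanZ c p : gauss_mean (c *: p) = c * gauss_mean p.
Proof.
rewrite /gauss_mean -RintZ; last exact: integ_gauss_mean.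
by apply: eq_Rintegral => x _; rewrite /peval mevalZ mulrA.
Qed.

Lemma gauss_mean0 : gauss_mean 0 = 0.
Proof. by rewrite -(scale0r 0) gauss_meanZ mul0r. Qed.

Lemma gauss_mean_sum I (s : seq I) (F : I -> mpoly d R) :
  gauss_mean (\sum_(i <- s) F i) = \sum_(i <- s) gauss_mean (F i).
Proof. exact: (big_morph gauss_mean gauss_meanD gauss_mean0). Qed.

(** Integration by parts in x_i, reduced by linearity to monomials, whose Gaussian integral is a
    product of one-dimensional moments. *)
Lemma gauss_meanX i p : 2 * gauss_mean (Xi i * p) = gauss_mean (mderiv i p).
Proof.
elim/mpolyind: p => [|c m p _ _ IH]; first by rewrite mulr0 linear0 gauss_mean0 mulr0.
rewrite mulrDr linearD !gauss_meanD mulrDr IH; congr (_ + _).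
rewrite -scalerAr linearZ/= !gauss_meanZ mulrCA; congr (_ * _).
have eL : gauss_mean (Xi i * mpolyX R m) =
    gauss_moment R (m i).+1 * \prod_(j < d | j != i) gauss_moment R (m j).
  rewrite -mpolyXD; have [_ ->] := meanX_prod (mnm_add (mnm1 i) m).
  rewrite (bigD1 i)//; congr (gauss_moment R _ * _); first by rewrite mnmDE mnm1E eqxx add1n.
  by apply: eq_bigr => j ji; rewrite mnmDE mnm1E eq_sym (negbTE ji).
have eR : gauss_mean (mpolyX R (mnm_sub m (mnm1 i))) =
    gauss_moment R (m i).-1 * \prod_(j < d | j != i) gauss_moment R (m j).
  have [_ ->] := meanX_prod (mnm_sub m (mnm1 i)).
  rewrite (bigD1 i)//; congr (gauss_moment R _ * _); first by rewrite mnmBE mnm1E eqxx subn1.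
  by apply: eq_bigr => j ji; rewrite mnmBE mnm1E eq_sym (negbTE ji) subn0.
by rewrite mderivX gauss_meanZ eL eR mulrA gauss_moment_rec mulrA.
Qed.

(** By Euler's identity and integration by parts, 2k E(pq) is the sum of the E(d_i p d_i q), as the
    Laplacian of [p] drops out. The sum is symmetric in p and q, so k E(pq) = l E(pq). *)
Lemma harmonic_gauss_orthogonal k l p q : harmonic_homog k p -> harmonic_homog l q ->
  k != l -> gauss_mean (p * q) = 0.
Proof.
move=> hp hq kl.
have key n u v : harmonic_homog n u -> 2 * (n%:R * gauss_mean (u * v)) =
    \sum_(i < d) gauss_mean (mderiv i u * mderiv i v).
  move=> [hu lu].
  rewrite -gauss_meanZ scalerAl -(euler_identity hu) mulr_suml gauss_mean_sum mulr_sumr.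
  transitivity (\sum_(i < d) (gauss_mean (mderiv i (mderiv i u) * v) +
      gauss_mean (mderiv i u * mderiv i v))).
    by apply: eq_bigr => i _; rewrite -mulrA gauss_meanX mderivM gauss_meanD.
  rewrite big_split/= -gauss_mean_sum -mulr_suml lu mul0r gauss_mean0 add0r.
  by [].
have e1 := key _ _ q hp; have e2 := key _ _ p hq.
have : k%:R * gauss_mean (p * q) = l%:R * gauss_mean (p * q).
  apply: (@mulfI _ 2); first by rewrite pnatr_eq0.
  rewrite e1 [in RHS](mulrC p) e2; apply: eq_bigr => i _; by rewrite mulrC.
move/eqP; rewrite -subr_eq0 -mulrBl mulf_eq0 subr_eq0 eqr_nat (negbTE kl)/=.
by move/eqP.
Qed.

End gaussian_orthogonality.

(** * From Gaussian to spherical orthogonality *)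

Section surface_integrals.
Context (R : realType) (d : nat).
Local Notation lebd := (@lebesgue_tuple R d).
Local Notation surf := (@surface_measure R d).
Local Notation pball := (@punctured_ball R d).
Implicit Types (p q : mpoly d R) (x : d.-tuple R).

Lemma enorm_scale (r : R) x : 0 <= r -> enorm (scale_tuple r x) = r * enorm x.
Proof.
move=> r0; rewrite /enorm -{2}(ger0_norm r0) -sqrtr_sqr -sqrtrM ?sqr_ge0// mulr_sumr.
by congr Num.sqrt; apply: eq_bigr => i _; rewrite tnth_mktuple exprMn.
Qed.

Lemma radial_projE x : radial_proj x = scale_tuple (enorm x)^-1 x.
Proof. by []. Qed.

Lemma enorm_radial_proj x : 0 < enorm x -> enorm (radial_proj x) = 1.
Proof. by move=> x0; rewrite radial_projE enorm_scale ?invr_ge0 ?ltW// mulVf ?gt_eqF. Qed.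

Lemma radial_proj_scale (r : R) x : 0 < r -> radial_proj (scale_tuple r x) = radial_proj x.
Proof.
move=> r0; rewrite !radial_projE enorm_scale ?ltW//; apply: eq_from_tnth => i.
by rewrite !tnth_mktuple invfM mulrACA mulVf ?mul1r// gt_eqF.
Qed.

Lemma scale_radial_proj x : 0 < enorm x -> scale_tuple (enorm x) (radial_proj x) = x.
Proof.
move=> x0; apply: eq_from_tnth => i; rewrite !tnth_mktuple mulrA mulfV ?mul1r//.
by rewrite gt_eqF.
Qed.

Lemma lebesgue_cball_lty rho : (lebd (cball rho) < +oo)%E.
Proof.
have i1 : integ (@lebesgue_measure R) (\1_(`[- rho, rho]%classic)).
  apply/integrableP; split.
    by apply/measurable_EFinP; apply: measurable_indic; exact: measurable_itv.
  under eq_integral do rewrite /= ger0_norm ?indicE//.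
  rewrite -[X in (X < _)%E]/(\int[lebesgue_measure]_x (\1_(`[(- rho)%R, rho]%classic) x)%:E)%E.
  rewrite integral_indic//= setIT lebesgue_measure_itv/=.
  by case: ifP => _; rewrite ?ltry.
have [/integrableP[_ h] _] := @lebesgue_tuple_product R d (fun=> \1_(`[- rho, rho]%classic)) (fun=> i1).
apply: le_lt_trans h; have mB := @measurable_cball R d rho.
rewrite -(setIT (cball rho)) -(integral_indic _ measurableT mB).
apply: ge0_le_integral => //.
- by apply/measurable_EFinP; exact: measurable_indic.
- apply: measurableT_comp => //; apply/measurable_EFinP; apply: measurable_prod => i _.
  apply: (measurableT_comp _ (@measurable_tnth _ R d i)).
  by apply: measurable_indic; exact: measurable_itv.
move=> x _; rewrite abse_EFin lee_fin indicE; case: (boolP (x \in _)) => [|_]; last exact: normr_ge0.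
rewrite inE /cball/= => xr; rewrite big1 ?normr1// => i _.
by rewrite indicE mem_setE in_itv/= -ler_norml (le_trans (tnth_le_enorm x i)).
Qed.

(** Seen as the radial projection of d times Lebesgue measure on the punctured ball, the surface
    measure falls under the general transport formula, and sphere integrals become Lebesgue
    integrals. *)
Lemma surface_measureE : exists n : {measure set (d.-tuple R) -> \bar R},
  [/\ forall A, measurable A -> surf A = n A,
    forall f, measurable_fun setT f -> (forall x, 0 <= f x)%E ->
      (\int[n]_x f x = \int[lebd]_x ((d%:R * \1_pball x)%:E * f (radial_proj x)))%E,
    forall f : d.-tuple R -> R, measurable_fun setT f ->
      (integ n f <-> integ lebd (fun x => d%:R * \1_pball x * f (radial_proj x))) &
    forall f : d.-tuple R -> R, measurable_fun setT f ->
      \int[n]_x f x = \int[lebd]_x (d%:R * \1_pball x * f (radial_proj x))].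
Proof.
have mw : measurable_fun setT (fun x => d%:R * \1_pball x : R).
  by apply: measurable_funM => //; apply: measurable_indic; exact: measurable_punctured_ball.
have w0 x : 0 <= d%:R * \1_pball x :> R by rewrite mulr_ge0// indicE.
have [n [nE ni nR]] := weighted_pushforward_real lebd mw w0 (@measurable_radial_proj R d).
exists n; split=> // A mA; rewrite /surface_measure.
have mA' : measurable (@radial_proj R d @^-1` A).
  by rewrite -[X in measurable X]setTI; exact: measurable_radial_proj.
have := nE (EFin \o \1_A).
rewrite integral_indic// setIT => ->; [|exact/measurable_EFinP|by move=> y; rewrite lee_fin].
have mAB := measurableI _ _ mA' (@measurable_punctured_ball R d).
transitivity (\int[lebd]_x (d%:R%:E * (\1_(@radial_proj R d @^-1` A `&` pball) x)%:E))%E.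
  rewrite ge0_integralZl ?integral_indic ?setIT//; exact/measurable_EFinP.
apply: eq_integral => x _; rewrite /= -!EFinM indicI/= -mulrA; congr (_ * _)%:E.
by rewrite mulrC.
Qed.

Lemma surface_integral (f : d.-tuple R -> R) : measurable_fun setT f ->
  (integ surf f <-> integ lebd (fun x => d%:R * \1_pball x * f (radial_proj x))) /\
  \int[surf]_x f x = \int[lebd]_x (d%:R * \1_pball x * f (radial_proj x)).
Proof.
move=> mf; have [n [nE _ ni nR]] := surface_measureE; split.
  rewrite -ni//; split; apply: eq_measure_integ => A mA; first exact: nE.
  exact/esym/nE.
by rewrite -nR//; exact: eq_measure_Rintegral.
Qed.

Lemma surface_lty : (surf setT < +oo)%E.
Proof.
rewrite /surface_measure lte_mul_pinfty ?lee_fin//.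
apply: le_lt_trans (lebesgue_cball_lty 1); apply: le_measure; rewrite ?inE.
- by rewrite preimage_setT setTI; exact: measurable_punctured_ball.
- exact: measurable_cball.
- by move=> x [_ /andP[]].
Qed.

Lemma eq_surface_integral (f g : d.-tuple R -> R) :
  measurable_fun setT f -> measurable_fun setT g -> (forall x, usphere x -> f x = g x) ->
  (integ surf f -> integ surf g) /\ \int[surf]_x f x = \int[surf]_x g x.
Proof.
move=> mf mg fg; have [fi ->] := surface_integral mf; have [gi ->] := surface_integral mg.
have e x : d%:R * \1_pball x * f (radial_proj x) = d%:R * \1_pball x * g (radial_proj x).
  rewrite indicE; case: (boolP (x \in _)) => [|_]; last by rewrite mulr0 !mul0r.
  by rewrite inE => /andP[x0 _]; rewrite fg//; exact: enorm_radial_proj.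
by rewrite fi gi (funext e).
Qed.

Lemma measurable_usphere : measurable (@usphere R d).
Proof.
rewrite (_ : @usphere R d = setT `&` @enorm R d @^-1` [set 1]).
  by apply: measurable_enorm => //; exact: measurable_set1.
by rewrite setTI.
Qed.

Lemma integ_surface (f : d.-tuple R -> R) C : measurable_fun setT f ->
  (forall x, usphere x -> `|f x| <= C) -> integ surf f.
Proof.
move=> mf fC; have mS := measurable_usphere.
have mg : measurable_fun setT (fun x => \1_(@usphere R d) x * f x).
  by apply: measurable_funM => //; exact: measurable_indic.
have e x : usphere x -> \1_(@usphere R d) x * f x = f x.
  by move=> xS; rewrite indicE mem_set// mul1r.
have [h _] := eq_surface_integral mg mf e.
apply: h; apply: (integ_bounded (c := `|C|) surface_lty mg) => x.
rewrite indicE; case: (boolP (x \in _)) => [|_]; last by rewrite mul0r normr0.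
by rewrite inE => /fC h; rewrite mul1r (le_trans h)// ler_norm.
Qed.

Lemma sphere_innerE p q : sphere_inner p q = \int[surf]_x peval (p * q) x.
Proof.
rewrite /sphere_inner /Rintegral integral_mkcond -/(Rintegral _ _ _).
have mS := measurable_usphere.
have e : ((fun x => (peval p x * peval q x)%:E) \_ (@usphere R d)) =
    EFin \o (fun x => \1_(@usphere R d) x * (peval p x * peval q x)).
  apply/funext => x; rewrite patchE /= indicE.
  by case: (x \in _); rewrite ?mul1r ?mul0r.
rewrite e; have mf : measurable_fun setT (fun x => \1_(@usphere R d) x * (peval p x * peval q x)).
  apply: measurable_funM; first exact: measurable_indic.
  by apply: measurable_funM; exact: measurable_peval.
apply: (eq_surface_integral mf (@measurable_peval _ _ (p * q)) _).2 => x xS.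
by rewrite indicE mem_set// mul1r /peval mevalM.
Qed.

End surface_integrals.

Section left_rays.
Context (R : realType).
Implicit Types m : {measure set R -> \bar R}.

Lemma left_rays_measure_unique m1 m2 : (forall n : nat, (m1 `]-oo, n%:R]%classic < +oo)%E) ->
  (forall s, m1 `]-oo, s]%classic = m2 `]-oo, s]%classic) ->
  forall A, measurable A -> m1 A = m2 A.
Proof.
move=> m1oo h A mA; pose G := [set B : set R | exists s, B = `]-oo, s]%classic].
apply: (@measure_unique _ R _ G (fun n => `]-oo, n%:R]%classic)) => //.
- apply/seteqP; split; last first.
    apply: smallest_sub; first exact: sigma_algebra_measurable.
    by move=> _ [s ->]; exact: measurable_itv.
  have -> : @measurable _ R = <<s @RGenOInfty.G R >> := RGenOInfty.measurableE R.
  apply: smallest_sub; first exact: smallest_sigma_algebra.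
  move=> _ [s ->]; rewrite -setCitvl -setTD; apply: sigma_algebraCD.
  by apply: sub_sigma_algebra; exists s.
- move=> _ _ [x ->] [y ->]; exists (Num.min x y).
  by apply/seteqP; split => z /=; rewrite !in_itv/= le_min; [move=> [-> ->]|move=> /andP[]].
- by move=> n; exists n%:R.
- apply/seteqP; split => // x _; exists (Num.trunc `|x|).+1 => //=.
  by rewrite in_itv/= (le_trans (ler_norm x))// ltW// truncnS_gt.
- by move=> _ [x ->]; exact: h.
Qed.

End left_rays.

Section radial_laws.
Context (R : realType) (d : nat).
Hypothesis d0 : (0 < d)%N.
Local Notation lebd := (@lebesgue_tuple R d).
Local Notation surf := (@surface_measure R d).
Implicit Types (p q : mpoly d R) (x : d.-tuple R) (n : {measure set R -> \bar R}).

(** The distribution of |x| under a density homogeneous of degree 0: proportional to s^d, so that a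
    single number determines it. *)
Definition homogeneous_law n := (n `]-oo, 1%R]%classic < +oo)%E /\
  forall s, n `]-oo, s]%classic = ((if 0 < s then s ^+ d else 0)%:E * n `]-oo, 1%R]%classic)%E.

(** Scaling by s multiplies Lebesgue measure by s^d and fixes [G]; the vanishing of [G] at the
    origin settles s <= 0. *)
Lemma radial_law (G : d.-tuple R -> R) C : measurable_fun setT G -> (forall x, 0 <= G x <= C) ->
  (forall r x, 0 < r -> G (scale_tuple r x) = G x) -> (forall x, enorm x = 0 -> G x = 0) ->
  exists n, [/\ homogeneous_law n,
    forall g : R -> R, measurable_fun setT g ->
        (integ n g <-> integ lebd (fun x => G x * g (enorm x))) &
    forall g : R -> R, measurable_fun setT g ->
        \int[n]_y g y = \int[lebd]_x (G x * g (enorm x))].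
Proof.
move=> mG GC Gs G0; have Gge0 x : 0 <= G x by have /andP[] := GC x.
have [n [nE ni nR]] := weighted_pushforward_real lebd mG Gge0 (@measurable_enorm R d).
exists n; split=> //.
have nS (s : R) : n `]-oo, s]%classic = (\int[lebd]_x (G x * \1_(cball s) x)%:E)%E.
  have := nE (EFin \o \1_(`]-oo, s]%classic)).
  rewrite integral_indic ?setIT//.
  move=> ->; last 2 first.
  - by apply/measurable_EFinP; apply: measurable_indic; exact: measurable_itv.
  - by move=> y; rewrite lee_fin indicE.
  apply: eq_integral => x _; rewrite /= !indicE mem_setE in_itv/=; congr (_ * _%:R)%:E.
  by congr nat_of_bool; apply/idP/idP => [h|]; rewrite inE.
have mGc s : measurable_fun setT (fun x => (G x * \1_(cball s) x)%:E).
  apply/measurable_EFinP; apply: measurable_funM => //.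
  by apply: measurable_indic; exact: measurable_cball.
have Gc0 s x : (0 <= (G x * \1_(cball s) x)%:E)%E.
  by rewrite lee_fin mulr_ge0// indicE.
split.
  rewrite nS; apply: le_lt_trans (_ : (\int[lebd]_x (C * \1_(cball 1) x)%:E < +oo)%E).
    apply: ge0_le_integral => //.
      apply/measurable_EFinP; apply: measurable_funM => //.
      by apply: measurable_indic; exact: measurable_cball.
    move=> x _; rewrite lee_fin ler_wpM2r ?indicE//.
    by have /andP[] := GC x.
  have i1 : integ lebd (\1_(cball 1)).
    have mB := @measurable_cball R d 1; apply/integrableP; split.
      by apply/measurable_EFinP; exact: measurable_indic.
    under eq_integral do rewrite /= ger0_norm ?indicE//.
    rewrite -[X in (X < _)%E]/(\int[lebd]_x (\1_(cball 1) x)%:E)%E integral_indic// setIT.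
    exact: lebesgue_cball_lty.
  by rewrite -RintE ?ltry//; exact: integZ.
move=> s; rewrite !nS; case: ltP => [s0|s0]; last first.
  rewrite mul0e; apply: integral0_eq => x _; rewrite indicE.
  case: (boolP (x \in _)) => [|_]; last by rewrite mulr0.
  rewrite inE /cball/= => xs; rewrite G0 ?mul0r//.
  by apply/le_anti; rewrite enorm_ge0 (le_trans xs).
rewrite (lebesgue_tuple_scale s0)//; congr (_ * _)%E; apply: eq_integral => x _.
rewrite Gs// !indicE; congr (_ * _%:R)%:E; congr nat_of_bool.
apply/idP/idP; rewrite !inE /cball/= enorm_scale ?(ltW s0)//.
  by rewrite -ler_pdivlMl// mulVf ?gt_eqF.
by move=> h; rewrite ler_piMr// ltW.
Qed.

Lemma homogeneous_law_lty n : homogeneous_law n -> forall s, (n `]-oo, s]%classic < +oo)%E.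
Proof.
move=> [n1 nE] s; rewrite nE lte_mul_pinfty// lee_fin.
by case: ifP => // s0; rewrite exprn_ge0// ltW.
Qed.

(** After multiplication by c2 and c1 the two laws coincide on rays, hence everywhere;
    cross-multiplication includes laws of mass 0. *)
Lemma homogeneous_law_compare n1 n2 (g : R -> R) : homogeneous_law n1 -> homogeneous_law n2 ->
  measurable_fun setT g -> (forall r, 0 <= g r) -> integ n1 g -> integ n2 g ->
  fine (n2 `]-oo, 1%R]%classic) * \int[n1]_r g r = fine (n1 `]-oo, 1%R]%classic) * \int[n2]_r g r.
Proof.
move=> h1 h2 mg g0 i1 i2; set c1 := fine (n1 _); set c2 := fine (n2 _).
have c10 : 0 <= c1 by exact: fine_ge0.
have c20 : 0 <= c2 by exact: fine_ge0.
have f1 : n1 `]-oo, 1%R]%classic = c1%:E by rewrite fineK// ge0_fin_numE//; have [] := h1.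
have f2 : n2 `]-oo, 1%R]%classic = c2%:E by rewrite fineK// ge0_fin_numE//; have [] := h2.
pose m1 : {measure set R -> \bar R} := mscale (NngNum c20) n1.
pose m2 : {measure set R -> \bar R} := mscale (NngNum c10) n2.
have e A : measurable A -> m1 A = m2 A.
  apply: left_rays_measure_unique => [k|s].
    by rewrite /m1/= /mscale/= lte_mul_pinfty ?lee_fin//; exact: homogeneous_law_lty.
  rewrite /m1 /m2/= /mscale/= (h1.2 s) (h2.2 s) f1 f2.
  by rewrite -!EFinM; congr EFin; ring.
have : (\int[m1]_r (g r)%:E = \int[m2]_r (g r)%:E)%E.
  by apply: eq_measure_integral => A mA _; exact: e.
have mg' : measurable_fun setT (fun r => (g r)%:E) by exact/measurable_EFinP.
have g0' r : setT r -> (0 <= (g r)%:E)%E by move=> _; rewrite lee_fin.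
rewrite (ge0_integral_mscale _ measurableT _ mg' g0') (ge0_integral_mscale _ measurableT _ mg' g0').
by rewrite -!RintE//= -!EFinM => -[].
Qed.

Lemma homogeneous_law0 n (g : R -> R) : homogeneous_law n ->
  measurable_fun setT g -> (forall r, 0 <= g r) -> (forall r, 0 < r -> g r != 0) ->
  integ n g -> \int[n]_r g r = 0 -> n `]-oo, 1%R]%classic = 0%E.
Proof.
move=> [_ nE] mg g0 gn0 gi gI.
have : (\int[n]_r `|(g r)%:E| = 0)%E.
  by under eq_integral do rewrite gee0_abs ?lee_fin//; rewrite -RintE// gI.
have mg' : measurable_fun setT (EFin \o g) by exact/measurable_EFinP.
move=> /(ae_eq_integral_abs n measurableT mg')[N [mN N0 NE]].
apply/eqP; rewrite eq_le measure_ge0 andbT.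
apply: (@le_trans _ _ (n (`]-oo, 0%R]%classic `|` N))).
  apply: le_measure; rewrite ?inE//; first by apply: measurableU => //; exact: measurable_itv.
  move=> r /= _; have [r0|r0] := leP r 0; first by left; rewrite /= in_itv.
  right; apply: NE => /= /(_ I)[] /eqP; apply/negP; exact: gn0.
have n0 : n `]-oo, 0%R]%classic = 0%E by rewrite nE ltxx mul0e.
apply: (@le_trans _ _ (n `]-oo, 0%R]%classic + n N)%E); last by rewrite n0 N0 adde0.
by apply: measureU2 => //; exact: measurable_itv.
Qed.

Lemma peval_scale k p r x : p \is ishomog1 k mdeg -> peval p (scale_tuple r x) = r ^+ k * peval p x.
Proof.
move=> /dhomogP hp; rewrite /peval !mevalE mulr_sumr; apply: eq_big_seq => m mp.
rewrite mulrCA; congr (_ * _); have <- : mdeg m = k by exact: hp.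
rewrite mdegE -prodrXr -big_split/=; apply: eq_bigr => i _.
by rewrite tnth_mktuple exprMn.
Qed.

(* The radial laws of the positive and negative parts of p(x / |x|) are
   proportional by homogeneity, and have equal Gaussian moments of order k + 1. *)
Lemma gauss_mean0_surface k p : p \is ishomog1 k.+1 mdeg -> gauss_mean p = 0 ->
  \int[surf]_x peval p x = 0.
Proof.
move=> hp E0.
pose F x := if 0 < enorm x then peval p (radial_proj x) else 0.
have mF : measurable_fun setT F.
  apply: measurable_fun_ifT => //.
    by apply: measurable_fun_ltr => //; exact: measurable_enorm.
  exact: (measurableT_comp (@measurable_peval _ _ p) (@measurable_radial_proj R d)).
have [C hC] := peval_bounded 1 p.
have FC x : `|F x| <= `|C|.
  rewrite /F; case: ifP => x0; last by rewrite normr0.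
  by rewrite (le_trans (hC _ _)) ?ler_norm// enorm_radial_proj.
have Fs r x : 0 < r -> F (scale_tuple r x) = F x.
  move=> r0; rewrite /F enorm_scale ?ltW// pmulr_rgt0//.
  by case: ifP => // x0; rewrite radial_proj_scale.
have F0 x : enorm x = 0 -> F x = 0 by rewrite /F => ->; rewrite ltxx.
(* At x = 0 both sides vanish because the degree is positive. *)
have pF x : peval p x = enorm x ^+ k.+1 * F x.
  rewrite /F; case: ltP => x0; first by rewrite -(peval_scale _ _ hp) scale_radial_proj.
  have e0 : enorm x = 0 by apply/le_anti; rewrite x0 enorm_ge0.
  rewrite mulr0 -[x]/(x); have -> : x = scale_tuple 0 x.
    apply: eq_from_tnth => i; rewrite tnth_mktuple mul0r; apply/eqP.
    by rewrite -normr_eq0 eq_le normr_ge0 andbT -e0 tnth_le_enorm.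
  by rewrite (peval_scale _ _ hp) expr0n mul0r.
pose Fp x := Num.max (F x) 0; pose Fm x := Num.max (- F x) 0.
have FE x : F x = Fp x - Fm x by exact: max0_sub.
have mFp : measurable_fun setT Fp by apply: measurable_maxr.
have mFm : measurable_fun setT Fm by apply: measurable_maxr => //; exact: measurableT_comp.
have FpC x : 0 <= Fp x <= `|C|.
  by rewrite /Fp le_max lexx orbT/= ge_max normr_ge0 andbT (le_trans (ler_norm _)).
have FmC x : 0 <= Fm x <= `|C|.
  by rewrite /Fm le_max lexx orbT/= ge_max normr_ge0 andbT (le_trans (ler_norm _))// normrN.
have Fps r x : 0 < r -> Fp (scale_tuple r x) = Fp x by move=> r0; rewrite /Fp Fs.
have Fms r x : 0 < r -> Fm (scale_tuple r x) = Fm x by move=> r0; rewrite /Fm Fs.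
have Fp0 x : enorm x = 0 -> Fp x = 0 by move=> x0; rewrite /Fp F0// maxxx.
have Fm0 x : enorm x = 0 -> Fm x = 0 by move=> x0; rewrite /Fm F0// oppr0 maxxx.
have [np [hnp npi npR]] := radial_law mFp FpC Fps Fp0.
have [nm [hnm nmi nmR]] := radial_law mFm FmC Fms Fm0.
pose g (r : R) := `|r| ^+ k.+1 * expR (- r ^+ 2).
have mg : measurable_fun setT g.
  apply: measurable_funM; last exact: measurable_gauss_fun.
  by apply: measurable_funX; exact: normr_measurable.
have g0 r : 0 <= g r by rewrite mulr_ge0 ?exprn_ge0 ?expR_ge0.
have gn0 r : 0 < r -> g r != 0.
  move=> r0; apply: lt0r_neq0; rewrite mulr_gt0 ?expR_gt0// exprn_gt0// normr_gt0.
  exact: lt0r_neq0.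
have pg x : peval p x * gauss_weight x = F x * g (enorm x).
  by rewrite pF /g (ger0_norm (enorm_ge0 x)) /gauss_weight; ring.
have ig : integ lebd (fun x => `|F x| * g (enorm x)).
  have := integ_abs (integ_gauss_mean p).
  rewrite (_ : (fun x => `|_|) = fun x => `|F x| * g (enorm x))//.
  by apply/funext => x; rewrite pg normrM [X in _ * X]ger0_norm.
have mge : measurable_fun setT (fun x => g (enorm x)).
  exact: (measurableT_comp mg (@measurable_enorm R d)).
have ip : integ lebd (fun x => Fp x * g (enorm x)).
  apply: (integ_le _ ig) => [|x]; first exact: measurable_funM.
  rewrite normrM (ger0_norm (g0 _)) ler_wpM2r//.
  by rewrite ger0_norm; [rewrite ge_max ler_norm normr_ge0|have /andP[] := FpC x].
have im : integ lebd (fun x => Fm x * g (enorm x)).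
  apply: (integ_le _ ig) => [|x]; first exact: measurable_funM.
  rewrite normrM (ger0_norm (g0 _)) ler_wpM2r//.
  by rewrite ger0_norm; [rewrite ge_max -normrN ler_norm normr_ge0|have /andP[] := FmC x].
have jp := (npi g mg).2 ip; have jm := (nmi g mg).2 im.
have eA : \int[np]_r g r = \int[nm]_r g r.
  apply/eqP; rewrite -subr_eq0 npR// nmR// -RintB// -E0; apply/eqP.
  by apply: eq_Rintegral => x _; rewrite pg FE mulrBl.
(* A non-zero Gaussian moment can be cancelled; if it is 0, both laws vanish because [g] is positive
   on ]0, +oo[. *)
have ec : fine (np `]-oo, 1%R]%classic) = fine (nm `]-oo, 1%R]%classic).
  have := homogeneous_law_compare hnp hnm mg g0 jp jm; rewrite eA.
  have [A0|A0] := eqVneq (\int[nm]_r g r) 0; last by move=> /(mulIf A0).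
  by rewrite (homogeneous_law0 hnp mg)// ?eA// (homogeneous_law0 hnm mg).
have [_ ->] := surface_integral (@measurable_peval _ _ p).
pose u (r : R) : R := \1_(`]-oo, 1%R]%classic) r.
have mu : measurable_fun setT u by apply: measurable_indic; exact: measurable_itv.
have iu (n : {measure set R -> \bar R}) : homogeneous_law n -> integ n u /\
    \int[n]_r u r = fine (n `]-oo, 1%R]%classic).
  move=> hn; have mI : measurable `]-oo, (1 : R)]%classic by exact: measurable_itv.
  have nI : (\int[n]_r (u r)%:E = n `]-oo, 1%R]%classic)%E by rewrite integral_indic// setIT.
  split; last by rewrite /Rintegral nI.
  apply/integrableP; split; first exact/measurable_EFinP.
  under eq_integral do rewrite /= ger0_norm ?indicE//.
  by rewrite -[X in (X < _)%E]/(\int[n]_r (u r)%:E)%E nI; have [] := hn.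
have [iup eup] := iu _ hnp; have [ium eum] := iu _ hnm.
have lp := (npi u mu).1 iup; have lm := (nmi u mu).1 ium.
transitivity (d%:R * (\int[np]_r u r - \int[nm]_r u r)); last by rewrite eup eum ec subrr mulr0.
rewrite npR// nmR// -RintB// -RintZ; last exact: integB.
apply: eq_Rintegral => x _; have uE : u (enorm x) = (enorm x <= 1)%R%:R by rewrite /u indicE mem_setE in_itv.
rewrite -mulrA -mulrBl -FE uE /F !indicE.
congr (_ * _); case: ltP => x0; last first.
  rewrite mul0r (_ : x \in @punctured_ball R d = false) ?mul0r//.
  by apply/negbTE/negP; rewrite inE /punctured_ball/= ltNge x0.
rewrite mulrC; congr (_ * _%:R); congr nat_of_bool.
by apply/idP/idP => [|h]; rewrite inE /punctured_ball/= x0.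
Qed.

Lemma sphere_orthogonal k l p q : harmonic_homog k p -> harmonic_homog l q -> k != l ->
  sphere_inner p q = 0.
Proof.
move=> hp hq kl; rewrite sphere_innerE.
have hpq : p * q \is ishomog1 (k + l) mdeg by apply: homogM; [exact: hp.1|exact: hq.1].
case: (k + l)%N hpq (addn_eq0 k l) => [|n] hpq.
  by move=> /esym/andP[/eqP k0 /eqP l0]; rewrite k0 l0 eqxx in kl.
by move=> _; apply: (gauss_mean0_surface hpq); exact: harmonic_gauss_orthogonal hp hq kl.
Qed.

End radial_laws.

(** * Uniqueness implies determinacy *)

Section stieltjes_alternative.
Context (R : realType).
Implicit Types n nu rho tau : {measure set R -> \bar R}.

Lemma halfline_moment_integ n j : on_halfline n ->
  (\int[n]_(r in `[0%R, +oo[) (r ^+ j)%:E < +oo)%E -> integ n (fun r => r ^+ j).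
Proof.
move=> n0 h; have mj : measurable_fun setT (fun r : R => r ^+ j) by exact: measurable_funX.
apply/integrableP; split; first exact/measurable_EFinP.
rewrite -(halfline_integral n0); last by apply: measurableT_comp => //; exact/measurable_EFinP.
apply: le_lt_trans h; rewrite le_eqVlt; apply/orP; left; apply/eqP.
apply: eq_integral => r; rewrite inE/= in_itv/= andbT => r0.
by rewrite ger0_norm// exprn_ge0.
Qed.

Lemma integ_finite_moments n : (forall j, integ n (fun r => r ^+ j)) -> finite_moments n.
Proof.
move=> h q; rewrite (_ : horner q = fun r => \sum_(i < size q) q`_i * r ^+ i); last first.
  by apply/funext => r; rewrite horner_coef.
by apply: integ_sum => i; exact: integZ.
Qed.

Lemma finite_moments_integ n j : finite_moments n -> integ n (fun r => r ^+ j).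
Proof. by move=> /(_ 'X^j); rewrite (_ : horner _ = fun r => r ^+ j)//; apply/funext => r; rewrite hornerXn. Qed.

Lemma eq_same_moments n1 n2 : finite_moments n1 -> finite_moments n2 ->
  (forall j, \int[n1]_r r ^+ j = \int[n2]_r r ^+ j) -> same_moments n1 n2.
Proof.
move=> h1 h2 e q.
have key n : finite_moments n -> \int[n]_x q.[x] = \sum_(i < size q) q`_i * \int[n]_x x ^+ i.
  move=> h; under eq_Rintegral do rewrite horner_coef.
  rewrite Rint_sum => [|i]; last exact/integZ/finite_moments_integ.
  by apply: eq_bigr => i _; rewrite RintZ//; exact: finite_moments_integ.
by rewrite !key//; apply: eq_bigr => i _; rewrite e.
Qed.

Lemma same_moments_expr n1 n2 j : same_moments n1 n2 -> \int[n1]_r r ^+ j = \int[n2]_r r ^+ j.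
Proof.
by move=> /(_ 'X^j); under eq_Rintegral do rewrite hornerXn; under [in RHS]eq_Rintegral do rewrite hornerXn.
Qed.

Lemma halfline_measure_eq n (A B : set R) : on_halfline n -> measurable A -> measurable B ->
  (forall t : R, 0 <= t -> A t <-> B t) -> n A = n B.
Proof.
move=> n0 mA mB AB.
rewrite -(setIT A) -(setIT B) -!integral_indic//.
apply: ae_eq_integral => //; [exact/measurable_EFinP|exact/measurable_EFinP|].
exists `]-oo, 0[%classic; split => // r /= /not_implyP[_ hr].
rewrite in_itv/= ltNge; apply/negP => r0; apply: hr; congr EFin.
rewrite !indicE; congr (_%:R); congr nat_of_bool.
by apply/idP/idP; rewrite !inE => /AB; exact.
Qed.

Lemma sqrt_image rho : on_halfline rho -> finite_moments rho -> exists tau,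
  [/\ on_halfline tau, finite_moments tau,
    forall j, \int[tau]_r (r ^+ 2) ^+ j = \int[rho]_t t ^+ j,
    forall A, measurable A -> pushforward tau (@psi R) A = rho A &
    forall delta, 0 <= delta -> rho `]-oo, delta ^+ 2]%classic = 0%E ->
      tau `]-oo, delta]%classic = 0%E].
Proof.
move=> r0 rf.
have ms : measurable_fun setT (@Num.sqrt R).
  exact: (continuous_measurable_fun (@sqrt_continuous R)).
have [tau [tE ti tR]] := weighted_pushforward_real rho (measurable_cst (1 : R)) (fun _ => ler01) ms.
have mpsi := @measurable_psi R.
have tA A : measurable A -> tau A = rho (@Num.sqrt R @^-1` A).
  move=> mA; have mA' : measurable (@Num.sqrt R @^-1` A).
    by rewrite -[X in measurable X]setTI; exact: ms.
  have := tE (EFin \o \1_A).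
  rewrite integral_indic// setIT => ->; [|exact/measurable_EFinP|by move=> y; rewrite lee_fin].
  under eq_integral do rewrite mul1e.
  by rewrite -[LHS]/(\int[rho]_x (\1_(@Num.sqrt R @^-1` A) x)%:E)%E integral_indic// setIT.
exists tau; split.
- rewrite /on_halfline tA// (_ : _ @^-1` _ = set0) ?measure0//.
  by apply/seteqP; split => // t /=; rewrite in_itv/= ltNge sqrtr_ge0.
- apply: integ_finite_moments => j; apply/ti; first exact: measurable_funX.
  have i1 : integ rho (fun=> 1) by have := finite_moments_integ 0 rf; under eq_fun do rewrite expr0.
  (* Half-integer powers of t are dominated by integer ones: |sqrt t|^j <= 1 + |t|^j. *)
  apply: (integ_le _ (integD i1 (integ_abs (finite_moments_integ j rf)))).
    by apply: measurable_funM => //; exact: measurable_funX.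
  move=> t; rewrite mul1r normrX (ger0_norm (sqrtr_ge0 t)) normrX.
  have [t1|t1] := leP t 1.
    apply: (@le_trans _ _ 1); last by rewrite lerDl exprn_ge0.
    by rewrite exprn_ile1 ?sqrtr_ge0// -sqrtr1 ler_wsqrtr.
  apply: (@le_trans _ _ (`|t| ^+ j)); last by rewrite lerDr.
  have t0 : 0 <= t by rewrite (le_trans _ (ltW t1)).
  rewrite lerXn2r ?nnegrE ?sqrtr_ge0// ger0_norm//.
  rewrite -[X in _ <= X](ger0_norm t0) -sqrtr_sqr ler_wsqrtr// expr2.
  by rewrite ler_peMl// ltW.
- move=> j; rewrite tR; last by apply: measurable_funX; exact: mpsi.
  have m1 : measurable_fun setT (fun t : R => 1 * (Num.sqrt t ^+ 2) ^+ j).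
    by apply: measurable_funM => //; do 2 (try apply: measurable_funX).
  apply: (halfline_Rint r0 m1 (measurable_funX _ (@measurable_id _ R setT)) _).2 => t t0.
  by rewrite mul1r sqr_sqrtr.
- move=> A mA; rewrite /pushforward.
  have mB : measurable (@psi R @^-1` A) by rewrite -[X in measurable X]setTI; exact: mpsi.
  rewrite tA//; apply: (halfline_measure_eq r0) => //.
    by rewrite -[X in measurable X]setTI; exact: ms.
  by move=> t t0; rewrite /preimage/= /psi sqr_sqrtr.
- move=> delta d0 h; rewrite tA// -h; apply: (halfline_measure_eq r0) => //.
    by rewrite -[X in measurable X]setTI; apply: ms.
  move=> t t0; rewrite /preimage/= !in_itv/=.
  rewrite -[in X in _ <-> X](sqr_sqrtr t0) ler_sqr ?nnegrE ?sqrtr_ge0//.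
Qed.

(** For k > 0 the image of [nu] under [psi] has no atom at 0, so the competitor [nu'] can be
    exchanged for one without mass near 0; the square root then pulls the competitor back to the
    scale of r. Only even moments are preserved, and these are what polynomials in |x|^2 see. *)
Lemma stieltjes_alternative k nu nu' A : on_halfline nu -> finite_moments nu ->
  ((0 < k)%N -> nu [set 0] = 0%E) -> on_halfline nu' ->
  (forall m : nat, \int[nu']_(t in `[0%R, +oo[) (t ^+ m)%:E =
    \int[pushforward nu (@psi R)]_(t in `[0%R, +oo[) (t ^+ m)%:E)%E ->
  measurable A -> nu' A <> pushforward nu (@psi R) A ->
  exists tau, [/\ on_halfline tau, finite_moments tau,
    forall j, \int[tau]_r (r ^+ 2) ^+ j = \int[nu]_r (r ^+ 2) ^+ j,
    exists2 B, measurable B & tau B <> nu B &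
    (0 < k)%N -> exists2 delta, 0 < delta & tau `]-oo, delta]%classic = 0%E].
Proof.
move=> nu0 nuf nuk nu'0 nu'E mA neq.
have [al [alE al0 alj]] := pushforward_psi_measure nu.
have jE j : (\int[nu]_r ((r ^+ 2) ^+ j)%:E = (\int[nu]_r (r ^+ 2) ^+ j)%:E)%E.
  rewrite RintE//; have := finite_moments_integ (2 * j) nuf.
  by under eq_fun do rewrite exprM.
have alf : finite_moments al.
  by apply: integ_finite_moments => j; apply: halfline_moment_integ => //; rewrite alj jE ltry.
have nu'f : finite_moments nu'.
  apply: integ_finite_moments => j; apply: halfline_moment_integ => //.
  by rewrite nu'E (pushforward_psi_moment _ (erefl _)) jE ltry.
have mom n j : on_halfline n -> (\int[n]_r (r ^+ j)%:E = \int[n]_(r in `[0%R, +oo[) (r ^+ j)%:E)%E.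
  by move=> n0; rewrite halfline_integral//; apply/measurable_EFinP; exact: measurable_funX.
have same : same_moments al nu'.
  apply: eq_same_moments => // j; rewrite /Rintegral; congr fine.
  by rewrite !mom// nu'E alj (pushforward_psi_moment _ (erefl _)).
have [rho [rho0 rhof rhoS rhoN rhok]] : exists rho, [/\ on_halfline rho, finite_moments rho,
    same_moments al rho, exists2 B, measurable B & al B <> rho B &
    (0 < k)%N -> exists2 delta, 0 < delta & rho `]-oo, delta]%classic = 0%E].
  have neqA : exists2 B, measurable B & al B <> nu' B.
    by exists A => //; rewrite alE// => e; exact/neq/esym.
  case: (posnP k) => [k0|k0]; first by exists nu'; split=> //; rewrite k0.
  have al00 : al `]-oo, 0]%classic = 0%E.
    rewrite alE// -(nuk k0) /pushforward; congr (nu _); apply/seteqP; split => r /=.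
      rewrite in_itv/= /psi => h; apply/eqP; rewrite -sqrf_eq0; apply/eqP/le_anti.
      by rewrite h sqr_ge0.
    by move=> ->; rewrite in_itv/= /psi expr0n.
  have [delta [rho [delta0 rhod rhof rhoS rhoN]]] := separated_indeterminate al00 nu'0 alf nu'f same neqA.
  exists rho; split=> //; last by exists delta.
  apply/eqP; rewrite eq_le measure_ge0 andbT -rhod; apply: le_measure; rewrite ?inE//.
  by move=> r /=; rewrite !in_itv/= => /ltW/le_trans; apply; exact: ltW.
have [tau [tau0 tauf tauj taupsi taud]] := sqrt_image rho0 rhof.
exists tau; split=> //.
- move=> j; rewrite tauj -(same_moments_expr j rhoS) /Rintegral; congr fine.
  by rewrite mom// alj.
- have [B mB neqB] := rhoN; apply: contrapT => nex; apply: neqB.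
  rewrite alE// -taupsi// /pushforward.
  have mB' : measurable (@psi R @^-1` B).
    by rewrite -[X in measurable X]setTI; exact: measurable_psi.
  by apply: contrapT => h; apply: nex; exists (@psi R @^-1` B) => // /esym.
- move=> /rhok[delta delta0 hd]; exists (Num.sqrt delta); first by rewrite sqrtr_gt0.
  by apply: taud; rewrite ?sqrtr_ge0// sqr_sqrtr// ltW.
Qed.

End stieltjes_alternative.

(** * Perturbation of a single component *)

Section spread.
Context (R : realType) (d : nat).
Local Notation surf := (@surface_measure R d).
Implicit Types (p : mpoly d R) (x : d.-tuple R).

Let weighted_surface (w : d.-tuple R -> R) C : measurable_fun setT w -> (forall x, 0 <= w x) ->
  (forall x, usphere x -> w x <= C) ->
  exists s : {measure set (d.-tuple R) -> \bar R}, [/\ (s setT < +oo)%E,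
    s (~` @usphere R d) = 0%E,
    forall p, integ s (peval p) &
    forall p, \int[s]_x peval p x = \int[surf]_x (w x * peval p x)].
Proof.
move=> mw w0 wC.
have [s [sE si sR]] := weighted_pushforward_real surf mw w0 (@measurable_id _ (d.-tuple R) setT).
have mS := @measurable_usphere R d.
have ip p : integ s (peval p).
  apply/si; first exact: measurable_peval.
  have [K hK] := peval_bounded 1 p.
  apply: (integ_surface (C := C * K)); first by apply: measurable_funM => //; exact: measurable_peval.
  move=> x xS; rewrite normrM (ger0_norm (w0 x)) ler_pM//; first exact: wC.
  by apply: hK; rewrite xS.
have soo : (s setT < +oo)%E.
  have /integrableP[_] := ip (mpolyC d (1 : R)).
  rewrite (_ : (fun x => `|_|%E) = cst 1%E); first by rewrite integral_cst// mul1e.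
  by apply/funext => x; rewrite /= /peval mevalC normr1.
exists s; split=> //; last by move=> p; rewrite sR//; exact: measurable_peval.
have mC : measurable (~` @usphere R d) by exact: measurableC.
have I0 : \int[s]_x \1_(~` @usphere R d) x = 0.
  have mI : measurable_fun setT (fun x => w x * \1_(~` @usphere R d) x).
    by apply: measurable_funM => //; exact: measurable_indic.
  rewrite sR; last exact: measurable_indic.
  have mz : measurable_fun setT (fun _ : d.-tuple R => 0 : R) by exact: measurable_cst.
  rewrite (eq_surface_integral mI mz _).2; first exact: Rint0.
  by move=> x xS; rewrite indicE memNset ?mulr0//= => /(_ xS).
have := Rint_indic s mC; rewrite I0 fineK => [<-//|].
rewrite ge0_fin_numE//; apply: le_lt_trans soo; apply: le_measure; rewrite ?inE//.
Qed.

Lemma measurable_scale_pair :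
  measurable_fun setT (fun z : R * d.-tuple R => scale_tuple z.1 z.2).
Proof.
apply/measurable_fun_tnthP => i.
rewrite (_ : _ \o _ = fun z : R * d.-tuple R => z.1 * tnth z.2 i); last first.
  by apply/funext => z /=; rewrite tnth_mktuple.
apply: measurable_funM => //.
exact: (measurableT_comp (@measurable_tnth _ R d i) (@measurable_snd _ _ R (d.-tuple R))).
Qed.

(** The measure is the image of m(dr) w(theta) dtheta under (r, theta) |-> r theta; homogeneity of
    [p] separates the variables and produces the factor r^k. *)
Lemma spread (m : {measure set R -> \bar R}) (w : d.-tuple R -> R) C :
  (m setT < +oo)%E -> on_halfline m ->
  measurable_fun setT w -> (forall x, 0 <= w x) -> (forall x, usphere x -> w x <= C) ->
  exists s : {measure set (d.-tuple R) -> \bar R}, (s setT < +oo)%E /\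
  forall k p (g : R -> R), p \is ishomog1 k mdeg -> measurable_fun setT g ->
    integ m (fun r => g r * r ^+ k) ->
    integ s (fun x => g (enorm x) * peval p x) /\
    \int[s]_x (g (enorm x) * peval p x) =
      \int[m]_r (g r * r ^+ k) * \int[surf]_x (w x * peval p x).
Proof.
move=> moo m0 mw w0 wC.
have [t [too t0 ti tR]] := weighted_surface mw w0 wC.
have [m' m'E] := finite_measure_of moo; have [t' t'E] := finite_measure_of too.
have mA A : measurable A -> m A = m' A by move=> _; exact/esym/(congr1 (fun f => f A) m'E).
have tA A : measurable A -> t A = t' A by move=> _; exact/esym/(congr1 (fun f => f A) t'E).
pose P : {measure set (R * d.-tuple R)%type -> \bar R} := (m' \x t')%E.
have [s [_ si sR]] := weighted_pushforward_real P (measurable_cst (1 : R)) (fun _ => ler01)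
  measurable_scale_pair.
have key k p (g : R -> R) : p \is ishomog1 k mdeg -> measurable_fun setT g ->
    integ m (fun r => g r * r ^+ k) ->
    integ s (fun x => g (enorm x) * peval p x) /\
    \int[s]_x (g (enorm x) * peval p x) =
      \int[m]_r (g r * r ^+ k) * \int[surf]_x (w x * peval p x).
  move=> hp mg gi.
  have mgp : measurable_fun setT (fun x : d.-tuple R => g (enorm x) * peval p x).
    apply: measurable_funM; last exact: measurable_peval.
    exact: (measurableT_comp mg (@measurable_enorm R d)).
  have gi' : integ m' (fun r => g r * r ^+ k) by exact: eq_measure_integ mA gi.
  have ti' : integ t' (peval p) by exact: eq_measure_integ tA (ti p).
  have [iP eP] := product_integ gi' ti'.
  have mf1 : measurable_fun setT (fun z : R * d.-tuple R => g z.1 * z.1 ^+ k * peval p z.2).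
    exact: (integ_meas (f := fun z => _) iP).
  have mf2 : measurable_fun setT (fun z : R * d.-tuple R =>
      1 * (g (enorm (scale_tuple z.1 z.2)) * peval p (scale_tuple z.1 z.2))).
    by apply: measurable_funM => //; exact: (measurableT_comp mgp measurable_scale_pair).
  (* Both factors are measures on full spaces, so |r theta| = r holds only off this null set. *)
  pose N : set (R * d.-tuple R) := (`]-oo, 0[%classic `*` setT) `|` (setT `*` ~` @usphere R d).
  have mS := @measurable_usphere R d.
  have mN1 : measurable ((`]-oo, 0[%classic : set R) `*` (setT : set (d.-tuple R))).
    by apply: measurableX.
  have mN2 : measurable ((setT : set R) `*` ~` @usphere R d).
    by apply: measurableX => //; exact: measurableC.
  have mN : measurable N by exact: measurableU.
  have N0 : P N = 0%E.
    apply/eqP; rewrite eq_le measure_ge0 andbT; apply: (le_trans (measureU2 _ mN1 mN2)).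
    rewrite /P/= !product_measure1E//; last exact: measurableC.
    have e1 : m' `]-oo, 0[%classic = 0%E by rewrite -[RHS]m0; exact/esym/mA.
    have e2 : t' (~` @usphere R d) = 0%E by rewrite -[RHS]t0; exact/esym/tA/measurableC.
    by rewrite [X in (X * _)%E]e1 [X in (_ + _ * X)%E]e2 mul0e mule0 adde0.
  have eqN z : ~ N z -> g z.1 * z.1 ^+ k * peval p z.2 =
      1 * (g (enorm (scale_tuple z.1 z.2)) * peval p (scale_tuple z.1 z.2)).
    case: z => r th /= nN.
    have r0 : 0 <= r.
      by rewrite leNgt; apply/negP => r0; apply: nN; left; split => //=; rewrite in_itv.
    have thS : enorm th = 1.
      by apply: contrapT => h; apply: nN; right; split.
    by rewrite enorm_scale// thS mulr1 (peval_scale _ _ hp) mul1r mulrA.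
  have [h1 h2] := ae_eq0_Rint mN N0 mf1 mf2 eqN.
  split; first by apply/si => //; exact: h1.
  rewrite sR// -h2; apply: (etrans (congr1 fine eP)); rewrite /= -tR.
  by rewrite (eq_measure_Rintegral _ mA) (eq_measure_Rintegral _ tA).
exists s; split=> //.
have i1 : integ m (fun r => 1 * r ^+ 0).
  have -> : (fun r : R => 1 * r ^+ 0) = fun=> 1 by apply/funext => r; rewrite mul1r expr0.
  by apply: (integ_bounded (c := 1) moo) => // x; rewrite normr1.
have h1 : (1 : mpoly d R) \is ishomog1 0 mdeg by exact: dhomog1.
have [/integrableP[_ +] _] := key 0%N 1 (fun=> 1) h1 (measurable_cst _) i1.
rewrite (_ : (fun x => `|_|%E) = cst 1%E); first by rewrite integral_cst// mul1e.
by apply/funext => x; rewrite /= /peval meval1 mulr1 normr1.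
Qed.

End spread.

Section perturbation.
Context (R : realType).

(** The weight r^-k compensates the factor r^k that homogeneity produces, so that the radial part of
    the spread measure is [n] itself. *)
Lemma inverse_power_weight k (n : {measure set R -> \bar R}) : on_halfline n ->
  ((0 < k)%N -> n [set 0] = 0%E) ->
  (forall j, integ n (fun r => (`|r| ^+ k)^-1 * r ^+ j)) ->
  exists m : {measure set R -> \bar R}, [/\ on_halfline m, finite_moments m &
    forall g : R -> R, measurable_fun setT g -> integ n g ->
      integ m (fun r => g r * r ^+ k) /\ \int[m]_r (g r * r ^+ k) = \int[n]_r g r].
Proof.
move=> n0 nk ni.
have mw : measurable_fun setT (fun r : R => (`|r| ^+ k)^-1).
  apply: (measurableT_comp (@measurable_Rinv R)); apply: measurable_funX.
  exact: normr_measurable.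
have w0 (r : R) : 0 <= (`|r| ^+ k)^-1 by rewrite invr_ge0 exprn_ge0.
have [m [mE mi mR]] := weighted_pushforward_real n mw w0 (@measurable_id _ R setT).
exists m; split.
- have := mE (EFin \o \1_(`]-oo, (0 : R)[%classic)).
  rewrite integral_indic ?setIT// /on_halfline => ->.
  + apply: (halfline_integral0 (f := fun x => (`|x| ^+ k)^-1 * \1_(`]-oo, (0 : R)[%classic) x) n0).
      by apply: measurable_funM => //; exact: measurable_indic.
    by move=> t t0; rewrite indicE mem_setE in_itv/= ltNge t0 mulr0.
  + by apply/measurable_EFinP; exact: measurable_indic.
  + by move=> y; rewrite lee_fin indicE.
- by apply: integ_finite_moments => j; apply/mi => //; exact: measurable_funX.
move=> g mg gi.
have mgk : measurable_fun setT (fun r : R => g r * r ^+ k).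
  by apply: measurable_funM => //; exact: measurable_funX.
have mwgk : measurable_fun setT (fun r : R => (`|r| ^+ k)^-1 * (g r * r ^+ k)).
  exact: measurable_funM.
(* For k > 0 the real convention 0^-1 = 0 breaks r^-k r^k = 1 at 0, which has to be null; for k = 0
   the weight is 1 and an atom at 0 is kept. *)
pose N : set R := if k is 0%N then `]-oo, 0[%classic else `]-oo, 0]%classic.
have mN : measurable N by rewrite /N; case: k {ni mw w0 mE mi mR mgk mwgk nk N}.
have N0 : n N = 0%E.
  rewrite /N; case: k nk {ni mw w0 mE mi mR mgk mwgk mN N} => // k /(_ isT) nk.
  rewrite (_ : `]-oo, 0]%classic = `]-oo, 0[%classic `|` [set 0]).
    by rewrite measureU0.
  apply/seteqP; split => r /=; rewrite !in_itv/=.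
    by rewrite le_eqVlt => /predU1P[->|]; [right|left].
  by case=> [/ltW|->].
have e r : ~ N r -> g r = (`|r| ^+ k)^-1 * (g r * r ^+ k).
  rewrite /N; case: k {ni mw w0 mE mi mR mgk mwgk mN nk N0 N} => [|k].
    by rewrite !expr0 invr1 mul1r mulr1.
  rewrite /= in_itv/= => /negP; rewrite -ltNge => r0.
  by rewrite (gtr0_norm r0) mulrC mulfK// expf_neq0// gt_eqF.
have [h1 h2] := ae_eq0_Rint mN N0 mg mwgk e.
by split; [apply/mi => //; exact: h1|rewrite mR// h2].
Qed.

(** The charge is mu + (m1 - m2)(dr) q(theta) dtheta, with the signs of q and of m1 - m2 distributed
    over four spread measures. The factor [sphere_inner q p] confines the change to components not
    orthogonal to [q]. *)
Lemma perturbation d (mu : {charge set (d.-tuple R) -> \bar R}) k0 (q : mpoly d R)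
    (m1 m2 : {measure set R -> \bar R}) :
  on_halfline m1 -> on_halfline m2 -> (m1 setT < +oo)%E -> (m2 setT < +oo)%E ->
  q \is ishomog1 k0 mdeg ->
  exists s : {charge set (d.-tuple R) -> \bar R},
  forall k (p : mpoly d R) (g : R -> R), p \is ishomog1 k mdeg -> measurable_fun setT g ->
    cinteg mu (fun x => g (enorm x) * peval p x) ->
    integ m1 (fun r => g r * r ^+ k) -> integ m2 (fun r => g r * r ^+ k) ->
    cinteg s (fun x => g (enorm x) * peval p x) /\
    charge_integral s (fun x => g (enorm x) * peval p x) =
    charge_integral mu (fun x => g (enorm x) * peval p x) +
      (\int[m1]_r (g r * r ^+ k) - \int[m2]_r (g r * r ^+ k)) * sphere_inner q p.
Proof.
move=> m10 m20 m1oo m2oo hq.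
pose wp x := Num.max (peval q x) 0; pose wn x := Num.max (- peval q x) 0.
have mwp : measurable_fun setT wp.
  by apply: measurable_maxr => //; exact: measurable_peval.
have mwn : measurable_fun setT wn.
  apply: measurable_maxr => //; apply: measurableT_comp => //; exact: measurable_peval.
have wp0 x : 0 <= wp x by rewrite le_max lexx orbT.
have wn0 x : 0 <= wn x by rewrite le_max lexx orbT.
have wE x : peval q x = wp x - wn x by exact: max0_sub.
have [C hC] := peval_bounded 1 q.
have wpC x : usphere x -> wp x <= `|C|.
  move=> xS; rewrite ge_max normr_ge0 andbT (le_trans (ler_norm _))// (le_trans (hC x _)) ?ler_norm//.
  by rewrite xS.
have wnC x : usphere x -> wn x <= `|C|.
  move=> xS; rewrite ge_max normr_ge0 andbT (le_trans (ler_norm _))// normrN.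
  by rewrite (le_trans (hC x _)) ?ler_norm// xS.
have [s1 [s1oo s1E]] := spread m1oo m10 mwp wp0 wpC.
have [s2 [s2oo s2E]] := spread m2oo m20 mwn wn0 wnC.
have [s3 [s3oo s3E]] := spread m1oo m10 mwn wn0 wnC.
have [s4 [s4oo s4E]] := spread m2oo m20 mwp wp0 wpC.
have [t1 [t1A _ t1i t1R]] := measure_sum s1 s2.
have [t2 [t2A _ t2i t2R]] := measure_sum s3 s4.
have [u1 [u1A _ u1i u1R]] := measure_sum (cpos mu) t1.
have [u2 [u2A _ u2i u2R]] := measure_sum (cneg mu) t2.
have u1oo : (u1 setT < +oo)%E by rewrite u1A t1A !lte_add_pinfty// cpos_lty.
have u2oo : (u2 setT < +oo)%E by rewrite u2A t2A !lte_add_pinfty// cneg_lty.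
have [s sE] := charge_of_measures u1oo u2oo.
exists s => k p g hp mg [ip iN] i1 i2.
have [a1 b1] := s1E k p g hp mg i1; have [a2 b2] := s2E k p g hp mg i2.
have [a3 b3] := s3E k p g hp mg i1; have [a4 b4] := s4E k p g hp mg i2.
have c1 := (t1i _).2 (conj a1 a2); have c2 := (t2i _).2 (conj a3 a4).
have [e1 e2 ->] := charge_integral_measures u1oo u2oo (fun A _ => sE A)
  ((u1i _).2 (conj ip c1)) ((u2i _).2 (conj iN c2)).
split=> //; rewrite u1R// u2R// t1R// t2R// b1 b2 b3 b4.
have iw (w : d.-tuple R -> R) : measurable_fun setT w -> (forall x, 0 <= w x) ->
    (forall x, usphere x -> w x <= `|C|) -> integ (@surface_measure R d) (fun x => w x * peval p x).
  move=> mw w0 wC; have [K hK] := peval_bounded 1 p.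
  apply: (integ_surface (C := `|C| * K)).
    by apply: measurable_funM => //; exact: measurable_peval.
  move=> x xS; rewrite normrM (ger0_norm (w0 x)) ler_pM//; first exact: wC.
  by apply: hK; rewrite xS.
have -> : sphere_inner q p = \int[@surface_measure R d]_x (wp x * peval p x) -
    \int[@surface_measure R d]_x (wn x * peval p x).
  rewrite sphere_innerE -RintB; [|exact: iw|exact: iw].
  by apply: eq_Rintegral => x _; rewrite -mulrBl -wE /peval mevalM.
by rewrite /charge_integral -/(cpos mu) -/(cneg mu); ring.
Qed.

End perturbation.

Section inverse_moments.
Context (R : realType).

(** The integral is extended-real with 0^-k = +oo for k > 0. At j = 0 its finiteness forbids an atom
    at 0; for j > 0 the integrand 0^j 0^-k is 0 there and carries no such information. *)
Lemma inverse_moments (nu : {measure set R -> \bar R}) k j : on_halfline nu ->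
  (\int[nu]_(r in `[0%R, +oo[) (r%:E ^+ j * (r%:E ^+ k)^-1) < +oo)%E ->
  integ nu (fun r => (`|r| ^+ k)^-1 * r ^+ j) /\
  (j = 0%N -> (0 < k)%N -> nu [set 0] = 0%E).
Proof.
move=> nu0 fin.
have mw : measurable_fun setT (fun r : R => (`|r| ^+ k)^-1 * r ^+ j).
  apply: measurable_funM; last exact: measurable_funX.
  apply: (measurableT_comp (@measurable_Rinv R)); apply: measurable_funX.
  exact: normr_measurable.
(* The real formula off 0 and the extended-real value at 0, where the two conventions for 0^-1
   differ. *)
pose h (r : R) : \bar R := if r == 0 then (0%:E ^+ j * (0%:E ^+ k)^-1)%E
  else ((`|r| ^+ k)^-1 * r ^+ j)%:E.
have mh : measurable_fun setT h.
  apply: measurable_fun_ifT => //; first exact: measurable_fun_eqr.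
  exact/measurable_EFinP.
have eh : (\int[nu]_(r in `[0%R, +oo[) h r < +oo)%E.
  move: fin; congr (_ < _)%E; apply: eq_integral => r; rewrite inE/= in_itv/= andbT => r0.
  rewrite /h; case: eqVneq => [->//|rn0].
  rewrite -!EFin_expe inver expf_eq0 (negbTE rn0) andbF -EFinM mulrC.
  by rewrite (ger0_norm r0).
have h0 (r : R) : 0 <= r -> (0 <= h r)%E.
  move=> r0; rewrite /h; case: eqP => _.
    by rewrite mule_ge0 ?inve_ge0 ?expe_ge0.
  by rewrite lee_fin mulr_ge0 ?invr_ge0 ?exprn_ge0.
have ih : nu.-integrable `[0%R, +oo[ h.
  apply/integrableP; split; first exact: measurable_funTS.
  apply: le_lt_trans eh; rewrite le_eqVlt; apply/orP; left; apply/eqP.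
  apply: eq_integral => r; rewrite inE/= in_itv/= andbT => r0.
  by rewrite gee0_abs// h0.
have mabs : measurable_fun setT (fun r : R => `|((`|r| ^+ k)^-1 * r ^+ j)%:E|%E).
  by apply: measurableT_comp => //; exact/measurable_EFinP.
split.
  apply/integrableP; split; first exact/measurable_EFinP.
  rewrite -(halfline_integral nu0 mabs); apply: le_lt_trans eh.
  have m1 : measurable_fun `[(0:R), +oo[ (fun r : R => `|((`|r| ^+ k)^-1 * r ^+ j)%:E|%E).
    exact: measurable_funTS.
  have m2 : measurable_fun `[(0:R), +oo[ h by exact: measurable_funTS.
  have h0' r : `[(0:R), +oo[%classic r -> (0 <= h r)%E by rewrite /= in_itv/= andbT; exact: h0.
  apply: ge0_le_integral => //.
  move=> r; rewrite /= in_itv/= andbT => r0.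
  rewrite ger0_norm; last by rewrite mulr_ge0 ?invr_ge0 ?exprn_ge0.
  rewrite /h; case: eqP => [->|//]; rewrite normr0.
  case: (posnP k) => [->|k0].
    by rewrite !expr0 expe0 inve1 mule1 invr1 mul1r EFin_expe.
  by rewrite expr0n (gtn_eqF k0) invr0 mul0r mule_ge0 ?inve_ge0 ?expe_ge0.
move=> j0 k0; have [N [mN N0 NE]] := integrable_ae (measurable_itv _) ih.
apply/eqP; rewrite eq_le measure_ge0 andbT -N0; apply: le_measure; rewrite ?inE//.
move=> r -> ; apply: NE => /= /(_ _); rewrite in_itv/= lexx => /(_ isT).
by rewrite /h eqxx j0 expe0 mul1e -EFin_expe expr0n (gtn_eqF k0) inver eqxx.
Qed.

End inverse_moments.

Section compact_support.
Context (R : realType).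

Lemma compact_support_bounded (h : R -> R) : {within `[0, +oo[, continuous h} ->
  compact (closure [set r | 0 <= r /\ h r != 0]) ->
  exists C, forall r, 0 <= r -> `|h r| <= C.
Proof.
move=> ch cK; set K := closure _ in cK.
(* The closure is taken in R but stays in the closed half-line, where [h] is continuous. *)
have K0 : K `<=` `[0, +oo[%classic.
  have cl : closed `[(0 : R), +oo[%classic by exact: interval_closed.
  rewrite ((closure_id `[(0 : R), +oo[%classic).1 cl); apply: closure_subset.
  by move=> r /= [r0 _]; rewrite in_itv/= r0.
have /compact_bounded[M [_ MA]] : compact (h @` K).
  by apply: continuous_compact => //; exact: continuous_subspaceW ch.
exists (`|M| + 1) => r r0; have [->|h0] := eqVneq (h r) 0.
  by rewrite normr0 addr_ge0.
apply: (MA (`|M| + 1)); first by rewrite (le_lt_trans (ler_norm M))// ltrDl.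
by exists r => //; apply: subset_closure.
Qed.

Lemma halfline_extension (h : R -> R) : {within `[0, +oo[, continuous h} ->
  measurable_fun setT (h \_ `[0, +oo[).
Proof.
move=> ch; apply/(measurable_restrictT _ _).1 => //.
by apply: subspace_continuous_measurable_fun.
Qed.

Lemma integ_bounded_moment (m : {measure set R -> \bar R}) (g : R -> R) C k :
  finite_moments m -> measurable_fun setT g -> (forall r, `|g r| <= C) ->
  integ m (fun r => g r * r ^+ k).
Proof.
move=> mf mg gC; apply: (integ_le _ (integZ C (integ_abs (finite_moments_integ k mf)))).
  by apply: measurable_funM => //; exact: measurable_funX.
by move=> r; rewrite normrM ler_wpM2r.
Qed.

End compact_support.

Section indeterminate_solutions.
Context (R : realType) (d : nat).
Variables (a : nat -> nat) (Y : forall k, 'I_(a k) -> mpoly d R).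
Arguments Y : clear implicits.
Hypothesis d0 : (0 < d)%N.
Hypothesis Yh : forall k l, harmonic_homog k (Y k l).
Hypothesis Yspan : forall k p, harmonic_homog k p ->
  exists c : 'I_(a k) -> R, p = \sum_(l < a k) c l *: Y k l.
Hypothesis Yn : forall k l l', sphere_inner (Y k l) (Y k l') = (l == l')%:R.
Implicit Types (mu s : {charge set (d.-tuple R) -> \bar R}).

(** The perturbation replaces the component [nu] by [tau]. Polynomials see only even moments of it,
    which agree; the last clause reads the component off the charge, so that different components
    mean different solutions. *)
Lemma indeterminate_solution mu k0 (l0 : 'I_(a k0)) (nu tau : {measure set R -> \bar R}) :
  moment_measure mu -> pseudo_positive Y mu -> radial_measure mu (Y k0 l0) nu ->
  finite_moments nu -> (forall j, integ nu (fun r => (`|r| ^+ k0)^-1 * r ^+ j)) ->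
  ((0 < k0)%N -> nu [set 0] = 0%E) ->
  on_halfline tau -> finite_moments tau ->
  (forall j, \int[tau]_r (r ^+ 2) ^+ j = \int[nu]_r (r ^+ 2) ^+ j) ->
  ((0 < k0)%N -> exists2 delta, 0 < delta & tau `]-oo, delta]%classic = 0%E) ->
  exists s, solution_set Y mu s /\
    ((forall A, measurable A -> s A = mu A) -> forall B, measurable B -> tau B = nu B).
Proof.
move=> mum mup nur nuf nuw nu0 tau0 tauf even taud.
have [nuh nuoo nuE] := nur.
(* For k0 > 0 the weight r^-k0 is at most delta^-k0 where [tau] has its mass. *)
have tauw j : integ tau (fun r => (`|r| ^+ k0)^-1 * r ^+ j).
  case: (posnP k0) => k00.
    rewrite (_ : (fun r => _) = fun r => r ^+ j); first exact: finite_moments_integ.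
    by apply/funext => r; rewrite k00 expr0 invr1 mul1r.
  have [delta delta0 td] := taud k00.
  have mw : measurable_fun setT (fun r : R => (`|r| ^+ k0)^-1 * r ^+ j).
    apply: measurable_funM; last exact: measurable_funX.
    apply: (measurableT_comp (@measurable_Rinv R)); apply: measurable_funX.
    exact: normr_measurable.
  pose f (r : R) := if r <= delta then 0 else (`|r| ^+ k0)^-1 * r ^+ j.
  have mf : measurable_fun setT f.
    by apply: measurable_fun_ifT => //; exact: measurable_fun_ler.
  have fE r : ~ `]-oo, delta]%classic r -> f r = (`|r| ^+ k0)^-1 * r ^+ j.
    by rewrite /f /= in_itv/= => /negP/negbTE ->.
  have mD : measurable `]-oo, delta]%classic by exact: measurable_itv.
  have [h _] := ae_eq0_Rint mD td mf mw fE.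
  apply: h; apply: (integ_le mf (integZ (delta ^+ k0)^-1 (integ_abs (finite_moments_integ j tauf)))).
  move=> r; rewrite /f; case: (leP r delta) => rd; first by rewrite normr0 mulr_ge0// invr_ge0 exprn_ge0// ltW.
  rewrite normrM ler_wpM2r//.
  have r0 := lt_trans delta0 rd.
  rewrite ger0_norm ?invr_ge0 ?exprn_ge0// lef_pV2 ?posrE ?exprn_gt0 ?normr_gt0 ?gt_eqF//.
  by rewrite gtr0_norm// lerXn2r ?nnegrE ?ltW.
have tau00 : (0 < k0)%N -> tau [set 0] = 0%E.
  move=> /taud[delta delta0 td]; apply/eqP; rewrite eq_le measure_ge0 andbT -td.
  apply: le_measure; rewrite ?inE// => r ->; rewrite /= in_itv/=; exact: ltW.
have [ta [tah taf taE]] := inverse_power_weight tau0 tau00 tauw.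
have [na [nah naf naE]] := inverse_power_weight nuh nu0 nuw.
have [s sP] := perturbation mu tah nah (finite_moments_lty taf) (finite_moments_lty naf) (Yh l0).1.
(* Every pair other than (k0, l0) is orthogonal to it: for another degree by [sphere_orthogonal],
   for the same degree by orthonormality. *)
have ind (Q : forall k, 'I_(a k) -> Prop) :
    (forall k l, sphere_inner (Y k0 l0) (Y k l) = 0 -> Q k l) -> Q k0 l0 -> forall k l, Q k l.
  move=> Q0 Q1 k l; have [e|kk] := eqVneq k0 k; last first.
    by apply: Q0; exact: sphere_orthogonal (Yh l0) (Yh l) kk.
  subst k; have [<-//|ll] := eqVneq l0 l.
  by apply: Q0; rewrite Yn (negbTE ll).
have Y1 : sphere_inner (Y k0 l0) (Y k0 l0) = 1 by rewrite Yn eqxx.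
have s0 (g : R -> R) : measurable_fun setT g -> cinteg mu (fun x => g (enorm x) * peval (Y k0 l0) x) ->
    integ tau g -> integ nu g ->
    cinteg s (fun x => g (enorm x) * peval (Y k0 l0) x) /\
    charge_integral s (fun x => g (enorm x) * peval (Y k0 l0) x) = \int[tau]_r g r.
  move=> mg cg i1 i2; have [j1 e1] := taE g mg i1; have [j2 e2] := naE g mg i2.
  have [cs ->] := sP k0 (Y k0 l0) g (Yh l0).1 mg cg j1 j2; split=> //.
  rewrite Y1 mulr1 e1 e2; have [_ ->] := nuE g mg cg.1 cg.2.
  by ring.
have bnd (g : R -> R) C : measurable_fun setT g -> (forall r, `|g r| <= C) -> forall k l,
    [/\ cinteg mu (fun x => g (enorm x) * peval (Y k l) x),
    integ ta (fun r => g r * r ^+ k) & integ na (fun r => g r * r ^+ k)].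
  move=> mg gC k l; have [i1 i2] := (moment_measureP mu).1 mum (Y k l).
  split; [|exact: integ_bounded_moment gC|exact: integ_bounded_moment gC].
  by split; apply: (integ_bounded_radial (C := C)).
have bnd0 (m : {measure set R -> \bar R}) (g : R -> R) C : finite_moments m ->
    measurable_fun setT g -> (forall r, `|g r| <= C) -> integ m g.
  move=> mf mg gC; have := integ_bounded_moment 0 mf mg gC.
  by under eq_fun do rewrite expr0 mulr1.
have keyg (g : R -> R) : measurable_fun setT g ->
    (forall k l, cinteg mu (fun x => g (enorm x) * peval (Y k l) x)) ->
    (forall (m : {measure set R -> \bar R}) i, finite_moments m -> integ m (fun r => g r * r ^+ i)) ->
    \int[tau]_r g r = \int[nu]_r g r -> forall k l,
    cinteg s (fun x => g (enorm x) * peval (Y k l) x) /\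
    charge_integral s (fun x => g (enorm x) * peval (Y k l) x) =
    charge_integral mu (fun x => g (enorm x) * peval (Y k l) x).
  move=> mg cg gi eg; apply: ind => [k l Y0|].
    have [cs ->] := sP k (Y k l) g (Yh l).1 mg (cg k l) (gi _ _ taf) (gi _ _ naf).
    by split=> //; rewrite Y0 mulr0 addr0.
  have i0 (m : {measure set R -> \bar R}) : finite_moments m -> integ m g.
    by move=> /(gi m 0%N); under eq_fun do rewrite expr0 mulr1.
  have [cs ->] := s0 g mg (cg _ _) (i0 _ tauf) (i0 _ nuf); split=> //.
  by rewrite eg; have [_ ->] := nuE g mg (cg _ _).1 (cg _ _).2.
have cmu q : cinteg mu (peval q) by exact: (moment_measureP mu).1.
have same p : cinteg s (peval p) /\ charge_integral s (peval p) = charge_integral mu (peval p).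
  move: p; apply: harmonic_ind => //.
  - have -> : peval 0 = (fun=> 0) :> (d.-tuple R -> R).
      by apply/funext => x; rewrite /peval meval0.
    split; first by split; exact: integ0.
    by rewrite /charge_integral !Rint0.
  - move=> p q [p1 p2] [q1 q2].
    have -> : peval (p + q) = (fun x => peval p x + peval q x).
      by apply/funext => x; rewrite /peval mevalD.
    split; first exact: cintegD.
    by rewrite !charge_integralD// p2 q2.
  move=> j k h /Yspan[c ->].
  pose g (r : R) := (r ^+ 2) ^+ j.
  have mg : measurable_fun setT g by apply: measurable_funX; exact: measurable_funX.
  have -> : peval (sqnorm R d ^+ j * \sum_(l < a k) c l *: Y k l) =
      (fun x => \sum_(l < a k) c l * (g (enorm x) * peval (Y k l) x)).
    apply/funext => x; rewrite peval_sqnormX /peval linear_sum/= !mulr_sumr.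
    by apply: eq_bigr => l _; rewrite mevalZ /g mulrCA.
  have cg i l : cinteg mu (fun x => g (enorm x) * peval (Y i l) x).
    have := cmu (sqnorm R d ^+ j * Y i l).
    by rewrite (_ : peval _ = fun x => g (enorm x) * peval (Y i l) x)//; apply/funext => x; exact: peval_sqnormX.
  have gi (m : {measure set R -> \bar R}) i : finite_moments m -> integ m (fun r => g r * r ^+ i).
    move=> mf; have := finite_moments_integ (2 * j + i) mf.
    by under eq_fun do rewrite exprD exprM.
  have key := keyg g mg cg gi (even j) k.
  have cs' l := cintegZ (c l) (key l).1; have cg' l := cintegZ (c l) (cg k l).
  have [cs ->] := charge_integral_sum (index_enum 'I_(a k)) cs'; split=> //.
  rewrite (charge_integral_sum _ cg').2; apply: eq_bigr => l _.
  by rewrite !charge_integralZ; [rewrite (key l).2|exact: cg|have [] := key l].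
exists s; split.
  split.
  - by apply/moment_measureP => p; have [] := same p.
  - move=> h ch h0 hc k l.
    have [C hC] := compact_support_bounded ch hc.
    (* [h] is controlled on [0, +oo) only; its extension by 0 is measurable on R and yields the same
       function of |x|. *)
    pose g := h \_ `[0, +oo[.
    have gE r : 0 <= r -> g r = h r by move=> r0; rewrite /g patchE mem_set//= in_itv/= r0.
    have g0 r : 0 <= g r.
      by rewrite /g patchE; case: ifP => //; rewrite inE/= in_itv/= andbT; exact: h0.
    have gC r : `|g r| <= `|C|.
      rewrite /g patchE; case: ifP => [|_]; last by rewrite normr0.
      by rewrite inE/= in_itv/= andbT => /hC/le_trans; apply; exact: ler_norm.
    have mg : measurable_fun setT g := halfline_extension ch.
    have hgE k' (l' : 'I_(a k')) : (fun x => h (enorm x) * peval (Y k' l') x) =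
        (fun x => g (enorm x) * peval (Y k' l') x).
      by apply/funext => x; rewrite gE// enorm_ge0.
    rewrite hgE; move: k l; apply: ind => [k l Y0|].
      have [c1 c2 c3] := bnd g _ mg gC k l.
      have [_ ->] := sP k (Y k l) g (Yh l).1 mg c1 c2 c3.
      by rewrite Y0 mulr0 addr0 -hgE; exact: mup.
    have [c1 _ _] := bnd g _ mg gC k0 l0.
    have [_ ->] := s0 g mg c1 (bnd0 _ _ _ tauf mg gC) (bnd0 _ _ _ nuf mg gC).
    exact: Rint_ge0.
  - by apply/same_cmomentsP => p; have [] := same p.
(* Indicators are admissible radial functions, and their integrals are the values of the
   components. *)
move=> smu B mB; pose g : R -> R := \1_B.
have mg : measurable_fun setT g by exact: measurable_indic.
have gC r : `|g r| <= 1 by rewrite /g indicE; case: (_ \in _); rewrite ?normr1 ?normr0.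
have [c1 _ _] := bnd g _ mg gC k0 l0.
have [c2 e] := s0 g mg c1 (bnd0 _ _ _ tauf mg gC) (bnd0 _ _ _ nuf mg gC).
have := eq_charge_integral smu c2.1 c2.2; rewrite e.
have [_ ->] := nuE g mg c1.1 c1.2; move=> h; have {h} := congr1 EFin h.
rewrite !Rint_indic//.
by rewrite !fineK ?fin_num_lty ?finite_moments_lty.
Qed.

End indeterminate_solutions.

Theorem theorem19 (R : realType) (d : nat) (d_ge2 : (2 <= d)%N)
  (a : nat -> nat) (Y : forall k : nat, 'I_(a k) -> mpoly d R)
  (Y_basis : orthonormal_harmonic_basis Y)
  (mu : {charge set (d.-tuple R) -> \bar R})
  (mu_moment : moment_measure mu) (mu_pp : pseudo_positive Y mu)
  (muc : forall k : nat, 'I_(a k) -> {measure set R -> \bar R})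
  (mucP : forall (k : nat) (l : 'I_(a k)),
     component_measure mu (Y k l) (muc k l))
  (mu_summable : forall N : nat,
     (\sum_(0 <= k <oo) \sum_(l < a k)
        \int[muc k l]_(r in `[0%R, +oo[) (r%:E ^+ N * (r%:E ^+ k)^-1)
      < +oo)%E) :
  (exists sigma, solution_set Y mu sigma /\
     forall tau, solution_set Y mu tau ->
       forall A : set (d.-tuple R), measurable A -> tau A = sigma A)
  <->
  (forall (k : nat) (l : 'I_(a k)),
     stieltjes_determined (pushforward (muc k l) psi)).
Proof.
have d0 : (0 < d)%N by exact: ltnW.
have Yh k l : harmonic_homog k (Y k l) by have [] := Y_basis k.
have Yspan k p : harmonic_homog k p -> exists c : 'I_(a k) -> R, p = \sum_(l < a k) c l *: Y k l.
  by move=> hp; have [_ /(_ p hp)[c [pE _]] _] := Y_basis k; exists c.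
have Yn k l l' : sphere_inner (Y k l) (Y k l') = (l == l')%:R by have [] := Y_basis k.
have mur k l := component_radial_measure mu_moment (mucP k l).
have mu_sol : solution_set Y mu mu by split.
split=> [[s0 [s0_sol s0_uniq]] k l nu' nu'0 nu'E A mA|det]; last first.
  by exists mu; split=> // tau; apply: (determined_unique d0 Yspan mu_moment mur det).
have [nu0 nufin _] := mucP k l.
have nuf : finite_moments (muc k l).
  by apply: integ_finite_moments => j; exact: halfline_moment_integ.
(* A single term of the non-negative double series is at most its sum. *)
have fin N : (\int[muc k l]_(r in `[0%R, +oo[) (r%:E ^+ N * (r%:E ^+ k)^-1) < +oo)%E.
  pose F i (l' : 'I_(a i)) := (\int[muc i l']_(r in `[0%R, +oo[) (r%:E ^+ N * (r%:E ^+ i)^-1))%E.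
  have F0 i l' : (0 <= F i l')%E.
    apply: integral_ge0 => r; rewrite /= in_itv/= andbT => r0.
    by rewrite mule_ge0 ?inve_ge0 ?expe_ge0 ?lee_fin.
  apply: le_lt_trans (mu_summable N).
  apply: (@le_trans _ _ (\sum_(0 <= i < k.+1) \sum_(l' < a i) F i l')%E); last first.
    by apply: nneseries_lim_ge => i *; exact: sume_ge0.
  rewrite big_nat_recr//= (bigD1 l)//=.
  rewrite addeCA leeDl//; apply: adde_ge0; apply: sume_ge0 => i _ //.
  exact: sume_ge0.
have nuw j : integ (muc k l) (fun r => (`|r| ^+ k)^-1 * r ^+ j).
  by have [] := inverse_moments nu0 (fin j).
have nuk : (0 < k)%N -> muc k l [set 0] = 0%E.
  by have [_ h] := inverse_moments nu0 (fin 0%N); exact: h.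
(* A discrepancy at [A] produces a different component [tau] and a solution [s] carrying it. As [s]
   and [mu] both coincide with [s0], the component would have to be unchanged. *)
apply: contrapT => neq.
have [tau [tau0 tauf even [B mB neqB] taud]] := stieltjes_alternative nu0 nuf nuk nu'0 nu'E mA neq.
have [s [s_sol s_eq]] := indeterminate_solution d0 Yh Yspan Yn mu_moment mu_pp (mur k l)
  nuf nuw nuk tau0 tauf even taud.
by apply: neqB; apply: s_eq => // C mC; rewrite s0_uniq// s0_uniq.
Qed.
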